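(* Let $G$ be a locally profinite group, $H\subset G$ an open normal subgroup of finite index with $G/H$ abelian, $N\subset G$ a closed subgroup, $N_H=N\cap H$, and $S\subset N_H$ an abelian open normal subgroup of $N$ of finite index in $N$. Let $\theta$ be a smooth character of $S$ normalized by $N$, and assume every element of $\mathrm{Irr}(N_H,\theta)$ is $1$-dimensional. Form $H\rtimes N\subset G\rtimes N$ with $N$ acting by conjugation, and let $\sigma$ be a smooth finite-length semisimple representation of $H\rtimes N$ such that $s^{-1}\rtimes s$ acts on $\sigma$ by $\theta(s)$ for every $s\in S$. Assume moreover: (i) $\mathrm{End}_H(\sigma)=\bigoplus_{n\in N_H/S}\mathbb C\cdot\sigma(n^{-1}\rtimes n)$; (ii) for each $g\in G$, the representation ${}^{g\rtimes1}(\sigma|_H)$ is isomorphic to $\sigma|_H$ if $g\in H\cdot N$, and ${}^{g\rtimes 1}(\sigma|_H)$ and $\sigma|_H$ have no common irreducible constituents otherwise; (iii) every irreducible constituent of $\sigma|_H$ has the same dimension. Let $I_\sigma$ be the (semisimple) representation of $G\times N$ given by $I_\sigma(g,n)=\left(\mathrm{Ind}_{H\rtimes N}^{G\rtimes N}\sigma\right)(gn^{-1}\rtimes n)$, and decompose $$I_\sigma=\bigoplus_{\pi\in[I_\sigma|_G],\ \rho\in\mathrm{Irr}(N,\theta)}(\pi\boxtimes\rho)^{\oplus m_{\pi,\rho}}.$$ Then: (1) $m_{\pi,\rho}\in\{0,1\}$, and for any $\rho\in\mathrm{Irr}(N,\theta)$ there exists exactly one $\pi\in[I_\sigma|_G]$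 such that $m_{\pi,\rho}=1$. So the condition $m_{\pi,\rho}=1$ defines a correspondence $\mathrm{Irr}(N,\theta)\longleftrightarrow[I_\sigma|_G]$. (2) For $\rho\in\mathrm{Irr}(N,\theta)$, let $\pi_\rho\in[I_\sigma|_G]$ be the unique $G$-representation with $m_{\pi_\rho,\rho}=1$. Then $$\frac{\dim(\pi_\rho)}{\dim(\rho)}=\frac{|G/H|\cdot\dim(\sigma)}{|N/S|}.$$
   Context: All representations are over $\mathbb C$. $\mathrm{Irr}(N_H,\theta)$ (resp. $\mathrm{Irr}(N,\theta)$) is the set of irreducible representations of $N_H$ (resp. $N$) whose restriction to $S$ is $\theta$-isotypic. ''$N$ normalizes $\theta$'' means $\theta(nsn^{-1})=\theta(s)$ for $n\in N$, $s\in S$. For a representation $\tau$ of a subgroup $K$ of a group and an element $h$ of the group, ${}^h\tau$ is the representation $x\mapsto\tau(h^{-1}xh)$ of $hKh^{-1}$. $\mathrm{Ind}_{H\rtimes N}^{G\rtimes N}\sigma$ is the right-translation representation on $\{f\colon G\rtimes N\to\sigma\mid f(xy)=\sigma(x)f(y),\ x\in H\rtimes N,\ y\in G\rtimes N\}$. $[I_\sigma|_G]$ is the set (not multiset) of irreducible constituents of the restriction of $I_\sigma$ to $G$. Under these hypotheses $(1,s)$ acts on $I_\sigma$ by $\theta(s)$ for $s\in S$, so the displayed decomposition makes sense, with $m_{\pi,\rho}$ the multiplicity of $\pi\boxtimes\rho$ in $I_\sigma$. *)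

(* Defs.v *)
From HB Require Import structures.
From mathcomp Require Import all_boot all_order all_algebra.
From mathcomp Require Import complex.
From mathcomp Require Import all_classical all_reals topology.

Set Implicit Arguments.
Unset Strict Implicit.
Unset Printing Implicit Defensive.

Import GRing.Theory.

Local Open Scope classical_set_scope.
Local Open Scope ring_scope.
Local Open Scope group_scope.

HB.mixin Record isTopologicalGroup G of Topological G & Group G := {
  mulg_continuous : continuous (fun x : G * G => x.1 * x.2);
  invg_continuous : continuous (fun x : G => x^-1)
}.

#[short(type="topGroupType")]
HB.structure Definition TopologicalGroup :=
  {G of Topological G & Group G & isTopologicalGroup G}.

Section Subgroups.
Variable gT : groupType.

Record subgroup := Subgroup {
  sgset :> gT -> Prop;
  sg1 : sgset 1;
  sgM : forall x y, sgset x -> sgset y -> sgset (x * y);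
  sgV : forall x, sgset x -> sgset x^-1
}.

Record normalSubgroup := NormalSubgroup {
  nsgval :> subgroup;
  nsgJ : forall g x, nsgval x -> nsgval (g * x * g^-1)
}.

Lemma nsgJV (H : normalSubgroup) g x : H x -> H (g^-1 * x * g).
Proof. by move=> /(nsgJ g^-1); rewrite invgK. Qed.

Definition sgT : normalSubgroup :=
  @NormalSubgroup (@Subgroup setT I (fun _ _ _ _ => I) (fun _ _ => I))
    (fun _ _ _ => I).

Definition sgI (A B : subgroup) : subgroup.
Proof.
exists (sgset A `&` sgset B).
- by split; exact: sg1.
- by move=> x y [Ax Bx] [Ay By]; split; exact: sgM.
- by move=> x [Ax Bx]; split; exact: sgV.
Defined.

(* t lists representatives of the left cosets of K in L *)
Definition coset_reps (L K : subgroup) n (t : 'I_n -> gT) :=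
  (forall i, L (t i)) /\ (forall x, L x -> exists! i, K ((t i)^-1 * x)).

Definition has_index (L K : subgroup) (n : nat) :=
  exists t : 'I_n -> gT, coset_reps L K t.

End Subgroups.

Definition sgX (gT gT' : groupType) (A : subgroup gT) (B : subgroup gT') :
  subgroup (gT * gT')%type.
Proof.
exists (sgset A `*` sgset B).
- by split; exact: sg1.
- by move=> x y [Ax Bx] [Ay By]; split; exact: sgM.
- by move=> x [Ax Bx]; split; exact: sgV.
Defined.

(* The semidirect product of gT with itself acting by conjugation. For H normal
   in gT and N a subgroup, the semidirect product of H by N is the subgroup
   [sdprod H N] of [sdp gT]. *)
Definition sdp (gT : Type) : Type := (gT * gT)%type.

Definition rtimes (gT : Type) (g n : gT) : sdp gT := (g, n).
Notation "g \rtimes n" := (rtimes g n) (at level 35, no associativity).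

Section SemidirectGroup.
Variable gT : groupType.

Definition sdp_mul (x y : sdp gT) : sdp gT :=
  (x.1 * (x.2 * y.1 * x.2^-1), x.2 * y.2).
Definition sdp_inv (x : sdp gT) : sdp gT := (x.2^-1 * x.1^-1 * x.2, x.2^-1).
Definition sdp_one : sdp gT := (1, 1).

HB.instance Definition _ := Choice.on (sdp gT).

Lemma sdp_mulA : associative sdp_mul.
Proof.
by move=> [a b] [c d] [e f]; rewrite /sdp_mul /= invgM !mulgA mulgVK.
Qed.
Lemma sdp_mul1 : left_id sdp_one sdp_mul.
Proof. by case=> a b; rewrite /sdp_mul /= !(mul1g, invg1, mulg1). Qed.
Lemma sdp_1mul : right_id sdp_one sdp_mul.
Proof. by case=> a b; rewrite /sdp_mul /= !(mul1g, mulg1, mulgV). Qed.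
Lemma sdp_mulV : left_inverse sdp_one sdp_inv sdp_mul.
Proof.
by case=> a b; rewrite /sdp_mul /sdp_inv /= invgK !mulgA mulgK mulgVK !mulVg.
Qed.
Lemma sdp_Vmul : right_inverse sdp_one sdp_inv sdp_mul.
Proof.
by case=> a b; rewrite /sdp_mul /sdp_inv /= !mulgA !mulgK !mulgV.
Qed.

HB.instance Definition _ := isGroup.Build (sdp gT)
  sdp_mulA sdp_mul1 sdp_1mul sdp_mulV sdp_Vmul.

Definition sdprod (H : normalSubgroup gT) (N : subgroup gT) :
  subgroup (sdp gT).
Proof.
exists (fun x : sdp gT => H x.1 /\ N x.2).
- by split; exact: sg1.
- by move=> [a b] [c d] [/= Ha Nb] [/= Hc Nd]; split=> /=; apply: sgM => //; exact: nsgJ.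
- move=> [a b] [/= Ha Nb]; split=> /=; last exact: sgV.
  by apply: nsgJV; exact: sgV.
Defined.


End SemidirectGroup.

Section SemidirectTopology.
Variable gT : topGroupType.

HB.instance Definition _ := Topological.copy (sdp gT) (gT * gT)%type.

Lemma mulg_cvg (T : Type) (F : set_system T) (FF : Filter F) (f g : T -> gT)
    (a b : gT) :
  f @ F --> a -> g @ F --> b -> (fun x => f x * g x) @ F --> a * b.
Proof.
move=> fa gb.
apply: (@cvg_comp _ _ _ (fun x => (f x, g x)) (fun z : gT * gT => z.1 * z.2)
  F (nbhs (a, b))); first exact: cvg_pair.
exact: (@mulg_continuous gT (a, b)).
Qed.

Lemma invg_cvg (T : Type) (F : set_system T) (FF : Filter F) (f : T -> gT)
    (a : gT) :
  f @ F --> a -> (fun x => (f x)^-1) @ F --> a^-1.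
Proof.
move=> fa; apply: (@cvg_comp _ _ _ f (fun z : gT => z^-1) F (nbhs a)) => //.
exact: (@invg_continuous gT a). Qed.

Lemma sdp_mul_continuous :
  continuous (fun x : sdp gT * sdp gT => x.1 * x.2).
Proof.
move=> [[a b] [c d]].
have fstc : fst @ nbhs ((a, b), (c, d)) --> (a, b) by exact: cvg_fst.
have sndc : snd @ nbhs ((a, b), (c, d)) --> (c, d) by exact: cvg_snd.
have c1 : (fun x : sdp gT * sdp gT => x.1.1) @ nbhs ((a, b), (c, d)) --> a.
  by apply: (@cvg_comp _ _ _ fst fst (nbhs _) (nbhs (_, _)) _ fstc); exact: cvg_fst.
have c2 : (fun x : sdp gT * sdp gT => x.1.2) @ nbhs ((a, b), (c, d)) --> b.
  by apply: (@cvg_comp _ _ _ fst snd (nbhs _) (nbhs (_, _)) _ fstc); exact: cvg_snd.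
have c3 : (fun x : sdp gT * sdp gT => x.2.1) @ nbhs ((a, b), (c, d)) --> c.
  by apply: (@cvg_comp _ _ _ snd fst (nbhs _) (nbhs (_, _)) _ sndc); exact: cvg_fst.
have c4 : (fun x : sdp gT * sdp gT => x.2.2) @ nbhs ((a, b), (c, d)) --> d.
  by apply: (@cvg_comp _ _ _ snd snd (nbhs _) (nbhs (_, _)) _ sndc); exact: cvg_snd.
apply: (@cvg_pair _ _ _ _ (nbhs (a * (b * c * b^-1))) (nbhs (b * d))).
- by apply: mulg_cvg => //; apply: mulg_cvg; [exact: mulg_cvg|exact: invg_cvg].
- exact: mulg_cvg.
Qed.

Lemma sdp_inv_continuous : continuous (fun x : sdp gT => x^-1).
Proof.
move=> [a b].
have c1 : (fun x : sdp gT => x.1) @ nbhs (a, b) --> a by exact: cvg_fst.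
have c2 : (fun x : sdp gT => x.2) @ nbhs (a, b) --> b by exact: cvg_snd.
apply: (@cvg_pair _ _ _ _ (nbhs (b^-1 * a^-1 * b)) (nbhs b^-1)).
- by apply: mulg_cvg => //; apply: mulg_cvg; exact: invg_cvg.
- exact: invg_cvg.
Qed.

HB.instance Definition _ := isTopologicalGroup.Build (sdp gT)
  sdp_mul_continuous sdp_inv_continuous.

End SemidirectTopology.

Definition locally_profinite (G : topGroupType) :=
  hausdorff_space G /\
  forall U : set G, nbhs 1 U ->
    exists K : subgroup G,
      [/\ open (sgset K), compact (sgset K) & sgset K `<=` U].

Section Representations.
Variable R : realType.
Local Notation C := R[i].

Section Dimension.

(* e is a (Hamel) basis *)
Definition is_basis (V : lmodType C) (I : choiceType) (e : I -> V) :=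
  forall v, exists! c : I -> C,
    finite_set [set i | c i != 0%R] /\ v = (\sum_(i \in [set: I]) c i *: e i)%R.

(* dim V is the cardinality of I; dimensions may be infinite, so an equation
   between products of dimensions is stated as a bijection between products of
   index types *)
Definition has_dim (V : lmodType C) (I : choiceType) :=
  exists e : I -> V, is_basis e.

End Dimension.

Section Tensor.

Definition is_bilinear (V W Z : lmodType C) (b : V -> W -> Z) :=
  (forall v, linear (b v)) /\ (forall w, linear (b ^~ w)).

(* (T, b) is a tensor product of V and W *)
Definition is_tensor (V W T : lmodType C) (b : V -> W -> T) :=
  is_bilinear b /\
  forall (Z : lmodType C) (b' : V -> W -> Z), is_bilinear b' ->
    exists f : {linear T -> Z}, (forall v w, f (b v w) = b' v w) /\
      forall f' : {linear T -> Z}, (forall v w, f' (b v w) = b' v w) ->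
        forall t, f' t = f t.

End Tensor.

(* A representation of the subgroup K of gT. As for matrix representations in
   MathComp, the operators rop x are only meaningful for x in K, and every
   notion below only depends on these. *)
Record rep (gT : groupType) (K : subgroup gT) := Rep {
  rspace :> lmodType C;
  rop : gT -> {linear rspace -> rspace};
  rop1 : forall v, rop 1 v = v;
  ropM : forall x y v, K x -> K y -> rop (x * y) v = rop x (rop y v)
}.

Section Theory.
Variables (gT : groupType) (K : subgroup gT).
Implicit Types V W : rep K.

Definition is_hom V W (f : V -> W) :=
  forall x v, K x -> f (rop V x v) = rop W x (f v).

Definition isomorphic V W :=
  exists2 f : {linear V -> W}, is_hom f & bijective f.

Definition subrep V (U : set V) :=
  [/\ U 0%R,
      forall u v, U u -> U v -> U (u + v)%R,
      forall (a : C) u, U u -> U (a *: u)%R &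
      forall x u, K x -> U u -> U (rop V x u)].

Definition irreducible V :=
  (exists v : V, v != 0%R) /\
  forall U : set V, subrep U -> U = [set 0%R] \/ U = setT.

(* (V, j) is the direct sum of the W i *)
Definition is_direct_sum (I : choiceType) (W : I -> rep K) V
    (j : forall i, {linear W i -> V}) :=
  (forall i, is_hom (j i)) /\
  forall v, exists! w : forall i, W i,
    finite_set [set i | w i != 0%R] /\ v = (\sum_(i \in [set: I]) j i (w i))%R.

Definition semisimple V :=
  exists (I : choiceType) (W : I -> rep K) (j : forall i, {linear W i -> V}),
    (forall i, irreducible (W i)) /\ is_direct_sum j.

(* existence of a composition series *)
Definition finite_length V :=
  exists (n : nat) (F : nat -> set V),
    [/\ F 0%N = [set 0%R], F n = setT, (forall i, (i <= n)%N -> subrep (F i)) &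
      forall i, (i < n)%N ->
        F i `<` F i.+1 /\
        forall U, subrep U -> F i `<=` U -> U `<=` F i.+1 ->
          U = F i \/ U = F i.+1].

(* T is isomorphic to an irreducible subquotient of V *)
Definition constituent V (T : rep K) :=
  irreducible T /\
  exists (W : rep K) (i : {linear W -> V}) (p : {linear W -> T}),
    [/\ is_hom i, injective i, is_hom p & forall t, exists w, p w = t].

(* X lists the isomorphism classes of representations satisfying P, each of
   them exactly once *)
Definition lists_classes (P : rep K -> Prop) (A : Type) (X : A -> rep K) :=
  (forall a, P (X a)) /\ forall V, P V -> exists! a, isomorphic V (X a).

End Theory.

(* the stabilizer of v is open in K as soon as it is a neighbourhood of 1 *)
Definition smooth (gT : topGroupType) (K : subgroup gT) (V : rep K) :=
  forall v : V, \forall x \near within (sgset K) (nbhs 1), rop V x v = v.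

(* theta is given by its values on S, and is unspecified outside *)
Definition smooth_character (gT : topGroupType) (S : subgroup gT)
    (theta : gT -> C) :=
  [/\ theta 1 = 1%R,
      forall s t, S s -> S t -> theta (s * t) = (theta s * theta t)%R &
      \forall s \near within (sgset S) (nbhs 1), theta s = 1%R].

(* Smoothness is automatic when S is open in N and theta is smooth. *)
Definition Irr (gT : groupType) (N S : subgroup gT) (theta : gT -> C)
    (V : rep N) :=
  irreducible V /\ forall s (v : V), S s -> rop V s v = (theta s *: v)%R.

(* pull-back along a homomorphism f from K' to K *)
Definition pull (gT gT' : groupType) (K : subgroup gT) (K' : subgroup gT')
    (f : gT' -> gT) (f1 : f 1 = 1) (fK : forall x, K' x -> K (f x))
    (fM : forall x y, K' x -> K' y -> f (x * y) = f x * f y) (V : rep K) :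
  rep K'.
Proof.
apply: (@Rep _ K' (rspace V) (fun x => rop V (f x))).
- by move=> v; rewrite f1 rop1.
- by move=> x y v Kx Ky; rewrite fM// ropM//; exact: fK.
Defined.

(* T is the external tensor product of V and W *)
Definition is_ext_tensor (gT gT' : groupType) (K : subgroup gT)
    (L : subgroup gT') (V : rep K) (W : rep L) (T : rep (sgX K L)) :=
  exists2 b : V -> W -> T, is_tensor b &
    forall x y v w, K x -> L y ->
      rop T (x, y) (b v w) = b (rop V x v) (rop W y w).

(* V is the direct sum of the (X a \boxtimes Y b)^{m a b} *)
Definition decomposes (gT gT' : groupType) (K : subgroup gT)
    (L : subgroup gT') (V : rep (sgX K L)) (A B : choiceType)
    (X : A -> rep K) (Y : B -> rep L) (m : A -> B -> nat) :=
  exists T : A -> B -> rep (sgX K L),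
    (forall a b, is_ext_tensor (X a) (Y b) (T a b)) /\
    exists j : forall i : {ab : A * B & 'I_(m ab.1 ab.2)},
        {linear T (tag i).1 (tag i).2 -> V},
      is_direct_sum j.

Section Induction.
Variables (gT : groupType) (K L : subgroup gT).
Hypothesis KL : forall x, K x -> L x.
Variable V : rep K.

(* A function on L is encoded by its extension by 0 to gT. *)
Definition ind_pred : {pred gT -> V} := [pred f : gT -> V | `[<
  (forall x y, K x -> L y -> f (x * y) = rop V x (f y)) /\
  (forall y, ~ L y -> f y = 0%R) >]].

Lemma ind_pred_submod : GRing.submod_closed ind_pred.
Proof.
split; first by apply/asboolP; split=> [x y _ _|//]; rewrite linear0.
move=> a f g /asboolP[fK fL] /asboolP[gK gL]; apply/asboolP; split.
- move=> x y Kx Ly; rewrite linearP -fK// -gK//.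
- by move=> y nLy; rewrite -[LHS]/(a *: f y + g y)%R fL// gL// scaler0 addr0.
Qed.

HB.instance Definition _ :=
  GRing.isSubmodClosed.Build C (gT -> V) ind_pred ind_pred_submod.

Record ind := Ind { indval : gT -> V; _ : indval \in ind_pred }.
HB.instance Definition _ := [isSub for indval].
HB.instance Definition _ := [Choice of ind by <:].
HB.instance Definition _ := [SubChoice_isSubLmodule of ind by <:].

Lemma ind_translP (y : gT) (f : ind) :
  (fun x => if `[< L x >] then indval f (x * y) else 0%R) \in ind_pred.
Proof.
case: f => f /= /asboolP[fK fL]; apply/asboolP; split.
- move=> k x Kk Lx.
  have Lkx : L (k * x) by apply: sgM => //; exact: KL.
  rewrite !asboolT// -mulgA.
  have [Lxy|nLxy] := pselect (L (x * y)); first exact: fK.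
  rewrite !fL ?linear0// => Lkxy; apply: nLxy.
  by rewrite -[x * y](mulKg k); apply: sgM => //; apply: sgV; exact: KL.
- by move=> x nLx; rewrite asboolF.
Qed.

(* right translation by y, for y in L *)
Definition ind_transl (y : gT) (f : ind) : ind := Ind (ind_translP y f).

Lemma ind_transl_linear y : linear (ind_transl y).
Proof.
move=> a f g; apply/val_inj/funext => x /=.
rewrite -[RHS]/(a *: (if `[< L x >] then indval f (x * y) else 0) +
  (if `[< L x >] then indval g (x * y) else 0))%R.
by case: ifP => // _; rewrite scaler0 addr0.
Qed.

HB.instance Definition _ y :=
  GRing.isLinear.Build C ind ind *:%R (ind_transl y) (ind_transl_linear y).

Lemma ind_transl1 f : ind_transl 1 f = f.
Proof.
apply/val_inj/funext => x /=; rewrite mulg1.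
case: f => f /= /asboolP[_ fL]; case: ifP => // /asboolP nLx.
by rewrite fL.
Qed.

Lemma ind_translM x y f :
  L x -> L y -> ind_transl (x * y) f = ind_transl x (ind_transl y f).
Proof.
move=> Lx Ly; apply/val_inj/funext => z /=.
case: ifP => // /asboolP Lz; rewrite mulgA asboolT//; exact: sgM.
Qed.

(* {f : L -> V | f (x * y) = V x (f y) for x in K and y in L}, on which L acts
   by right translation *)
Definition Ind_rep : rep L := @Rep _ L ind ind_transl ind_transl1 ind_translM.

End Induction.

Section Setting.
Variables (G : groupType) (H : normalSubgroup G) (N : subgroup G).

Fact incl1 : (1 : G) \rtimes 1 = 1 :> sdp G.
Proof. by []. Qed.
Fact inclP h : H h -> sdprod H N (h \rtimes 1).
Proof. by move=> Hh; split=> //; exact: sg1. Qed.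
Fact inclM h h' : H h -> H h' ->
  (h * h') \rtimes 1 = (h \rtimes 1) * (h' \rtimes 1).
Proof. by move=> _ _; congr pair; rewrite /= ?(mul1g, invg1, mulg1). Qed.

(* restriction to H = H \rtimes 1 *)
Definition resH (V : rep (sdprod H N)) : rep H :=
  pull (f := fun h => h \rtimes 1) incl1 inclP inclM V.

Fact conj1 (g : G) : g^-1 * 1 * g = 1.
Proof. by rewrite mulg1 mulVg. Qed.
Fact conjP (g h : G) : H h -> H (g^-1 * h * g).
Proof. exact: nsgJV. Qed.
Fact conjM (g h h' : G) : H h -> H h' ->
  g^-1 * (h * h') * g = (g^-1 * h * g) * (g^-1 * h' * g).
Proof. by move=> _ _; rewrite !mulgA mulgK. Qed.

(* {}^g V : x |-> V (g^-1 x g) *)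
Definition conj_rep (g : G) (V : rep H) : rep H :=
  pull (f := fun x => g^-1 * x * g) (conj1 g) (@conjP g) (@conjM g) V.

Fact sdprodT x : sdprod H N x -> sdprod (sgT G) N x.
Proof. by case. Qed.

Fact twist1 : (1 * 1^-1 : G) \rtimes 1 = 1 :> sdp G.
Proof. by rewrite mulgV. Qed.
Fact twistP (x : G * G) :
  sgX (sgT G) N x -> sdprod (sgT G) N ((x.1 * x.2^-1) \rtimes x.2).
Proof. by case. Qed.
Fact twistM (x y : G * G) : sgX (sgT G) N x -> sgX (sgT G) N y ->
  ((x * y).1 * (x * y).2^-1) \rtimes (x * y).2 =
  ((x.1 * x.2^-1) \rtimes x.2) * ((y.1 * y.2^-1) \rtimes y.2).
Proof. by move=> _ _; congr pair; rewrite /= invgM !mulgA mulgVK. Qed.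

(* I_V (g, n) = Ind V (g n^-1 \rtimes n) *)
Definition Irep (V : rep (sdprod H N)) : rep (sgX (sgT G) N) :=
  pull (f := fun x : G * G => (x.1 * x.2^-1) \rtimes x.2)
    twist1 twistP twistM (Ind_rep sdprodT V).

Fact inclGP g : sgT G g -> sgX (sgT G) N (g, 1).
Proof. by move=> _; split=> //; exact: sg1. Qed.
Fact inclGM g g' : sgT G g -> sgT G g' ->
  ((g * g', 1) : G * G) = (g, 1) * (g', 1).
Proof. by move=> _ _; congr pair; rewrite /= mulg1. Qed.

Definition resG (V : rep (sgX (sgT G) N)) : rep (sgT G) :=
  pull (f := fun g => (g, 1) : G * G) erefl inclGP inclGM V.

End Setting.
End Representations.

(* Main.v *)
(* By Frobenius reciprocity and Mackey, (ii) leaves only the cosets of H in H N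
   to contribute to the endomorphisms of I_sigma over G, and with (i) these
   form the group algebra A of N / S twisted by theta, acting through N.  As
   I_sigma is completely reducible over G, its endomorphism algebra A has a
   basis of matrix units E_ij.  Then E_ii I_sigma is irreducible over G, the
   column of matrix units through i is an irreducible representation of N, and
   each block of matrix units contributes the tensor product of the two.  In any
   decomposition of I_sigma, E_ii kills all the constituents but one, and has
   rank one on the N-factor of the latter.

   For the dimensions, (i) says that the endomorphisms of sigma over H form the
   twisted group algebra of N_H / S, which is commutative because its simple
   modules are lines.  So sigma is the direct sum of as many irreducibles of the
   same dimension, hence free over this algebra; I_sigma is then free over A,
   and E_ii I_sigma has a basis made of row i of the matrix units applied to a
   basis of I_sigma over A. *)
From HB Require Import structures.
Require Import Defs.
From mathcomp Require Import all_boot all_order all_algebra.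
From mathcomp Require Import complex spectral.
From mathcomp Require Import all_classical all_reals topology.

Set Implicit Arguments.
Unset Strict Implicit.
Unset Printing Implicit Defensive.

Import GRing.Theory.

Local Open Scope classical_set_scope.
Local Open Scope ring_scope.
Local Open Scope group_scope.

(** * Homomorphisms and complete reducibility *)

(** The spaces may be infinite-dimensional, which shapes three steps. Schur's lemma cannot use an
    eigenvalue of an operator on the space; it takes one of left multiplication on the endomorphism
    algebra, which is finite-dimensional by (i) and (ii). Complete reducibility is handled through
    essential subrepresentations, those meeting every nonzero subrepresentation: it amounts to
    having no proper one, and essential subrepresentations behave well under translation by N,
    finite intersection, and passage between sigma and induced functions. Finally, infinite
    cardinals cannot be divided, so explicit bases are exhibited. With k = |N_H/S|, D the common
    dimension of the constituents of sigma over H, and d = dim(rho), these give dim(sigma) = k D and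
    dim(pi) = d |G/HN| D, while |G/H| = |HN/H| |G/HN| and |N/S| = |HN/H| k; hence the ratio. *)

Section LinearFunctions.
Local Open Scope ring_scope.
Variable R : realType.
Local Notation C := R[i].
Variables U V W : lmodType C.
Implicit Types f : U -> V.

(** Linearity is kept as a proposition on plain functions, so that operators built pointwise need no
    canonical instance; one is packed only when a library lemma asks for it. *)
Definition to_linear f (lf : linear f) : {linear U -> V} :=
  HB.pack f (GRing.isLinear.Build C U V *:%R f lf).

Lemma lin0 f : linear f -> f 0 = 0.
Proof. by move=> lf; exact: (linear0 (to_linear lf)). Qed.

Lemma linD f u v : linear f -> f (u + v) = f u + f v.
Proof. by move=> lf; exact: (linearD (to_linear lf)). Qed.

Lemma linB f u v : linear f -> f (u - v) = f u - f v.
Proof. by move=> lf; exact: (linearB (to_linear lf)). Qed.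

Lemma linZ f a v : linear f -> f (a *: v) = a *: f v.
Proof. by move=> lf; exact: (linearZZ (to_linear lf)). Qed.

Lemma lin_sum f I (r : seq I) P F : linear f ->
  f (\sum_(i <- r | P i) F i) = \sum_(i <- r | P i) f (F i).
Proof. by move=> lf; exact: (linear_sum (to_linear lf)). Qed.

Lemma linear_linear (f : {linear U -> V}) : linear f.
Proof. by move=> a u v; rewrite linearP. Qed.

Lemma linear_comp f (g : V -> W) : linear f -> linear g -> linear (g \o f).
Proof. by move=> lf lg a u v; rewrite /= lf lg. Qed.

Lemma linear_add f (g : U -> V) :
  linear f -> linear g -> linear (fun v => f v + g v).
Proof. by move=> lf lg a u v; rewrite lf lg scalerDr addrACA. Qed.

Lemma linear_scale f (b : C) : linear f -> linear (fun v => b *: f v).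
Proof. by move=> lf a u v; rewrite lf scalerDr !scalerA mulrC. Qed.

Lemma linear_bigsum I (r : seq I) (F : I -> U -> V) :
  (forall i, linear (F i)) -> linear (fun v => \sum_(i <- r) F i v).
Proof.
move=> lF a u v; rewrite scaler_sumr -big_split /=.
by apply: eq_bigr => i _; rewrite lF.
Qed.

End LinearFunctions.

Section Homs.
Local Open Scope ring_scope.
Variable R : realType.
Local Notation C := R[i].
Variables (gT : groupType) (K : subgroup gT).
Implicit Types V W Z : rep R K.

Definition lhom V W (f : V -> W) := linear f /\ is_hom f.

Lemma lhom_rop V W (f : V -> W) x v : lhom f -> K x ->
  f (rop V x v) = rop W x (f v).
Proof. by case=> _; exact. Qed.

Lemma lhom_id V : lhom (idfun : V -> V).
Proof. by []. Qed.

Lemma lhom_comp V W Z (f : V -> W) (g : W -> Z) :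
  lhom f -> lhom g -> lhom (g \o f).
Proof.
move=> [lf hf] [lg hg]; split; first exact: linear_comp.
by move=> x v Kx /=; rewrite hf// hg.
Qed.

Lemma lhom_add V W (f g : V -> W) :
  lhom f -> lhom g -> lhom (fun v => f v + g v).
Proof.
move=> [lf hf] [lg hg]; split; first exact: linear_add.
by move=> x v Kx /=; rewrite hf// hg// linearD.
Qed.

Lemma lhom_scale V W (f : V -> W) a : lhom f -> lhom (fun v => a *: f v).
Proof.
move=> [lf hf]; split; first exact: linear_scale.
by move=> x v Kx /=; rewrite hf// linearZZ.
Qed.

Lemma lhom_sub V W (f g : V -> W) :
  lhom f -> lhom g -> lhom (fun v => f v - g v).
Proof.
move=> hf hg; have := lhom_add hf (lhom_scale (-1) hg).
by under eq_fun do rewrite scaleN1r.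
Qed.

Lemma lhom_sum V W I (r : seq I) (F : I -> V -> W) :
  (forall i, lhom (F i)) -> lhom (fun v => \sum_(i <- r) F i v).
Proof.
move=> hF; split; first by apply: linear_bigsum => i; case: (hF i).
by move=> x v Kx; rewrite linear_sum; apply: eq_bigr => i _; case: (hF i) => _ ->.
Qed.

Lemma lhom_linear V W (f : {linear V -> W}) : is_hom f -> lhom f.
Proof. by split=> //; exact: linear_linear. Qed.

Lemma isomorphicI V W (f : V -> W) : lhom f -> bijective f -> isomorphic V W.
Proof. by move=> [lf hf] bf; exists (to_linear lf). Qed.

Lemma isomorphic_refl V : isomorphic V V.
Proof. by apply: (@isomorphicI _ _ idfun (lhom_id V)); exists id. Qed.

Lemma lhom_inv V W (f : V -> W) g :
  lhom f -> cancel f g -> cancel g f -> lhom g.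
Proof.
move=> [lf hf] fK gK; split; first exact: (@can2_linear _ _ _ (to_linear lf) g).
by move=> x v Kx; apply: (can_inj fK); rewrite gK hf// gK.
Qed.

Lemma isomorphic_sym V W : isomorphic V W -> isomorphic W V.
Proof.
move=> [f hf [g fK gK]]; apply: (@isomorphicI _ _ g); last by exists f.
exact: lhom_inv (lhom_linear hf) fK gK.
Qed.

Lemma isomorphic_trans V W Z :
  isomorphic V W -> isomorphic W Z -> isomorphic V Z.
Proof.
move=> [f hf bf] [g hg bg]; apply: (@isomorphicI _ _ (g \o f)).
  by apply: lhom_comp; exact: lhom_linear.
exact: bij_comp.
Qed.

Lemma subrep_sum V (U : set V) I (r : seq I) (P : pred I) (F : I -> V) :
  subrep U -> (forall i, P i -> U (F i)) -> U (\sum_(i <- r | P i) F i).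
Proof. by move=> [U0 UD _ _] UF; elim/big_ind: _. Qed.

Lemma subrepB V (U : set V) u v : subrep U -> U u -> U v -> U (u - v).
Proof.
by move=> [_ UD UZ _] Uu Uv; apply: UD => //; rewrite -scaleN1r; exact: UZ.
Qed.

Lemma subrep_preim V W (f : V -> W) (U : set W) :
  lhom f -> subrep U -> subrep [set v | U (f v)].
Proof.
move=> [lf hf] [U0 UD UZ UK]; split=> /=.
- by rewrite lin0.
- by move=> u v *; rewrite linD//; exact: UD.
- by move=> a u *; rewrite linZ//; exact: UZ.
- by move=> x u *; rewrite hf//; exact: UK.
Qed.

Lemma subrep_im V W (f : V -> W) (U : set V) :
  lhom f -> subrep U -> subrep [set w | exists2 v, U v & f v = w].
Proof.
move=> [lf hf] [U0 UD UZ UK]; split=> /=.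
- by exists 0; rewrite ?lin0.
- move=> _ _ [u Uu <-] [v Uv <-]; exists (u + v); first exact: UD.
  by rewrite linD.
- by move=> a _ [u Uu <-]; exists (a *: u); [exact: UZ|rewrite linZ].
- by move=> x _ Kx [u Uu <-]; exists (rop V x u); [exact: UK|rewrite hf].
Qed.

Lemma subrep_setT V : subrep [set: V].
Proof. by []. Qed.

Lemma subrep_ker V W (f : V -> W) : lhom f -> subrep [set v | f v = 0].
Proof.
move=> hf; apply: (@subrep_preim _ _ f [set 0] hf); split=> //=.
- by move=> u v -> ->; rewrite addr0.
- by move=> a u ->; rewrite scaler0.
- by move=> x u _ ->; rewrite linear0.
Qed.

Lemma subrep_add V (A B : set V) : subrep A -> subrep B ->
  subrep [set v | exists a b, [/\ A a, B b & v = a + b]].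
Proof.
move=> [A0 AD AZ AK] [B0 BD BZ BK]; split=> /=.
- by exists 0, 0; rewrite addr0.
- move=> _ _ [a [b [Aa Bb ->]]] [c [d [Ac Bd ->]]]; exists (a + c), (b + d).
  by rewrite addrACA; split; [exact: AD|exact: BD|].
- move=> x _ [a [b [Aa Bb ->]]]; exists (x *: a), (x *: b).
  by rewrite scalerDr; split; [exact: AZ|exact: BZ|].
- move=> x _ Kx [a [b [Aa Bb ->]]]; exists (rop V x a), (rop V x b).
  by rewrite linearD; split; [exact: AK|exact: BK|].
Qed.

Lemma irreducible_sub V (U : set V) u :
  irreducible V -> subrep U -> u != 0 -> U u -> forall v, U v.
Proof.
move=> [_ irrV] sU u0 Uu v; have [UE|->//] := irrV _ sU.
by move: Uu u0; rewrite UE => -> /eqP.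
Qed.

Lemma irreducible_hom_bij V W (f : V -> W) v :
  irreducible V -> irreducible W -> lhom f -> f v != 0 -> bijective f.
Proof.
move=> iV iW hf fv0; have lf := hf.1.
have inj u : f u = 0 -> u = 0.
  move=> fu; apply/eqP; apply: contraNT fv0 => u0; apply/eqP.
  exact: (irreducible_sub iV (subrep_ker hf) u0 fu v).
have surj w : exists u, f u = w.
  have := irreducible_sub iW (subrep_im hf (@subrep_setT V)) fv0.
  by move=> /(_ _ w)[|u _ <-]; [exists v|exists u].
have [g gP] := choice surj.
exists g => [u|w]; last exact: gP.
by apply/eqP; rewrite -subr_eq0; apply/eqP/inj; rewrite linB// gP subrr.
Qed.

Lemma schur_iso V W (f : V -> W) v :
  irreducible V -> irreducible W -> lhom f -> f v != 0 -> isomorphic V W.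
Proof.
by move=> iV iW hf fv; apply: (isomorphicI hf); exact: irreducible_hom_bij fv.
Qed.

(** Essential submodules in the sense of ring theory, except that stability of [E] is left out and
    required separately where it is used. *)
Definition essential V (E : set V) := forall Y : set V, subrep Y ->
  (exists2 y, y != 0 & Y y) -> exists y, [/\ y != 0, Y y & E y].

Definition completely_reducible V := forall U : set V, subrep U ->
  exists p : V -> V, [/\ lhom p, forall v, U (p v) & forall u, U u -> p u = u].

(** By Zorn, take [A] maximal among the subrepresentations meeting [U] only in 0. Then U + A is
    essential, hence everything, and [p] is the projection onto [U] along [A]. *)
Lemma essential_completely_reducible V :
  (forall E : set V, subrep E -> essential E -> forall v, E v) ->
  completely_reducible V.
Proof.
move=> essT U sU; have [U0 UD UZ UK] := sU.
(* Zorn_bigcup asks for the union of the empty chain, hence the added 0 *)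
pose P := [set A : set V | subrep [set v | A v \/ v = 0] /\
  (forall v, U v -> A v -> v = 0)].
have [F FP totF|A [[sA UA] Amax]] := @Zorn_bigcup V P.
  split; last by move=> v Uv [X FX Xv]; apply: (FP _ FX).2.
  split=> /=; first by right.
  - move=> u v [[X FX Xu]|->] [[Y FY Yv]|->]; rewrite ?add0r ?addr0; last by right.
    + have [XY|YX] := totF _ _ FX FY.
      * have [_ /(_ u v) + _ _] := (FP _ FY).1.
        by case=> /=; [by left; exact: XY|by left| |by right]; left; exists Y.
      * have [_ /(_ u v) + _ _] := (FP _ FX).1.
        by case=> /=; [by left|by left; exact: YX| |by right]; left; exists X.
    + by left; exists X.
    + by left; exists Y.
  - move=> a u [[X FX Xu]|->]; last by right; rewrite scaler0.
    have [_ _ /(_ a u) + _] := (FP _ FX).1.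
    by case=> /=; [by left| |by right]; left; exists X.
  - move=> x u Kx [[X FX Xu]|->]; last by right; rewrite linear0.
    have [_ _ _ /(_ x u)] := (FP _ FX).1.
    by case=> //=; [by left| |by right]; left; exists X.
set B := [set v | A v \/ v = 0] in sA.
have UB v : U v -> B v -> v = 0 by move=> Uv [|//]; exact: UA.
have sE := subrep_add sU sA; set E := (X in subrep X) in sE.
(* A nonzero [Y] meeting U + A trivially would give A + Y, which still meets [U] trivially and
   strictly contains [A]. *)
have ET : forall v, E v.
  apply: essT => // Y sY [y y0 Yy]; apply: contrapT => nex.
  have EY z : Y z -> E z -> z = 0.
    move=> Yz Ez; apply/eqP; apply: contra_notT nex => z0; by exists z.
  have sD := subrep_add sA sY; set D := (X in subrep X) in sD.
  have AD : A `<` D.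
    split.
      move=> v Av; exists v, 0; rewrite addr0; split => //; first by left.
      by case: sY.
    move=> DA; move/eqP: (y0); apply; apply: EY => //.
    exists 0, y; rewrite add0r; split=> //.
    by left; apply: DA; exists 0, y; split; [right|exact: Yy|rewrite add0r].
  apply: (Amax D AD); split.
    suff -> : [set v | D v \/ v = 0] = D by [].
    apply/seteqP; split=> v /=; last by left.
    by case=> // ->; case: sD.
  move=> v Uv [b [z [Bb Yz vE]]].
  have z0 : z = 0.
    apply: EY => //; exists v, (- b); split=> //; last by rewrite vE addrC addKr.
    by rewrite -sub0r; apply: (subrepB sA) => //; case: sA.
  by apply: UB => //; rewrite vE z0 addr0.
have Edec v : exists u, U u /\ B (v - u).
  have [u [b [Uu Bb ->]]] := ET v; exists u; split=> //.
  by rewrite addrC addKr.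
have [p pP] := choice Edec.
(* Uniqueness of the component in [U] is what makes the chosen [p] linear and equivariant. *)
have puniq v u : U u -> B (v - u) -> p v = u.
  move=> Uu Bu; have [Up Bp] := pP v.
  apply/eqP; rewrite -subr_eq0; apply/eqP/UB; first exact: subrepB.
  have -> : p v - u = (v - u) - (v - p v) by rewrite opprB [RHS]addrC addrA subrK.
  exact: subrepB.
have [B0 BD BZ BK] := sA.
exists p; split.
- split.
    move=> a u v; have [Up Bp] := pP u; have [Uq Bq] := pP v.
    apply: puniq; first by apply: UD => //; exact: UZ.
    by rewrite opprD addrACA -scalerBr; apply: BD => //; exact: BZ.
  move=> x u Kx; have [Up Bp] := pP u.
  by apply: puniq; [exact: UK|rewrite -linearB; exact: BK].
- by move=> v; case: (pP v).
- by move=> u Uu; apply: puniq => //; rewrite subrr.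
Qed.

(** The kernel of a projector onto [E] meets [E] trivially, so it is 0 and the projector is the
    identity. *)
Lemma completely_reducible_essential V (E : set V) :
  completely_reducible V -> subrep E -> essential E -> forall v, E v.
Proof.
move=> crV sE eE v; have [p [hp pE pid]] := crV _ sE.
suff vp : v - p v = 0 by rewrite -[v](subrK (p v)) vp add0r.
apply/eqP; apply: contraT => v0.
have [|y [y0 py Ey]] := eE _ (subrep_ker hp).
  by exists (v - p v); rewrite //= (linB _ _ hp.1) (pid (p v)) ?subrr.
by rewrite -(pid _ Ey) py eqxx in y0.
Qed.

End Homs.

(** * Matrix units of the endomorphism algebra *)

(** [pick] gives equal answers on extensionally equal predicates, so it is constant on each class;
    the default is never reached, by reflexivity. *)
Lemma equiv_representatives (T : finType) (e : rel T) :
  (forall i, e i i) -> (forall i j, e i j -> e j i) ->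
  (forall i j k, e i j -> e j k -> e i k) ->
  exists r : T -> T, (forall i, e i (r i)) /\ forall i j, e i j -> r i = r j.
Proof.
move=> er es et; exists (fun i => odflt i [pick j | e j i]); split=> [i|i j ij].
  by case: pickP => [j|_] /=; [exact: es|exact: er].
rewrite (@eq_pick _ _ (fun k => e k j)) => [|k].
  by case: pickP => // /(_ j); rewrite er.
by apply/idP/idP => h; [exact: et ij|apply: et h _; exact: es].
Qed.

Section MatrixUnits.
Local Open Scope ring_scope.
Variable R : realType.
Local Notation C := R[i].
Variables (gT : groupType) (K : subgroup gT) (M : rep R K).

Definition orthogonal_idempotents (I : finType) (p : I -> M -> M) :=
  [/\ forall i, lhom (p i),
      forall i j v, p i (p j v) = if i == j then p i v else 0,
      forall v, v = \sum_i p i v &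
      forall i, exists v, p i v != 0].

(* E i j is a matrix unit of the block rt i if rt i = rt j, and is 0
   otherwise *)
Record matrix_units (I : finType) (rt : I -> I) (E : I -> I -> M -> M) := {
  mu_hom : forall i j, lhom (E i j);
  mu_rt : forall i, rt (rt i) = rt i;
  mu_mul : forall i j k l v, rt i = rt j ->
    E i j (E k l v) = if j == k then E i l v else 0;
  mu_off : forall i j v, rt i != rt j -> E i j v = 0;
  mu_sum : forall v, v = \sum_i E i i v;
  mu_neq0 : forall i, exists v, E i i v != 0;
  mu_span : forall T, lhom T -> exists t : I -> I -> C,
    forall v, T v = \sum_i \sum_j t i j *: E i j v;
  mu_irr : forall i (U : set M), subrep U -> (forall u, U u -> E i i u = u) ->
    forall u, U u -> u != 0 -> forall v, U (E i i v)
}.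

Variables (n : nat) (q : 'I_n -> M -> M).
Hypothesis q_hom : forall j, lhom (q j).
Hypothesis q_span : forall T, lhom T ->
  exists c : 'I_n -> C, forall v, T v = \sum_j c j *: q j v.
Hypothesis q_free : forall c : 'I_n -> C,
  (forall v, \sum_j c j *: q j v = 0) -> forall j, c j = 0.
Hypothesis M_cr : completely_reducible M.

(** [x] is the coordinate vector of an endomorphism in the basis [q]; ranks and eigenvalues of
    matrices thereby become available. *)
Let comb (x : 'rV[C]_n) v := \sum_j x 0 j *: q j v.

Let combP T : lhom T -> exists x, forall v, T v = comb x v.
Proof.
move=> /q_span[c cP]; exists (\row_j c j) => v; rewrite cP.
by apply: eq_bigr => j _; rewrite mxE.
Qed.

Let comb_inj x y : (forall v, comb x v = comb y v) -> x = y.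
Proof.
move=> xy; apply/rowP => j; apply/eqP; rewrite -subr_eq0; apply/eqP; move: j.
apply: (@q_free (fun j => x 0 j - y 0 j)) => v.
under eq_bigr do rewrite scalerBl.
by rewrite big_split /= sumrN -/(comb x v) -/(comb y v) xy subrr.
Qed.

Let comb0 v : comb 0 v = 0.
Proof. by rewrite /comb big1// => j _; rewrite mxE scale0r. Qed.

Let comb_mul m (x : 'rV_m) (A : 'M_(m, n)) v :
  comb (x *m A) v = \sum_i x 0 i *: comb (row i A) v.
Proof.
rewrite /comb; under [RHS]eq_bigr do rewrite scaler_sumr.
rewrite exchange_big /=; apply: eq_bigr => j _; rewrite mxE scaler_suml.
by apply: eq_bigr => i _; rewrite scalerA mxE.
Qed.

(** Applying one idempotent to a linear relation isolates its coefficient, so the family is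
    independent. The bound makes refinement terminate. *)
Lemma card_orthogonal_idempotents (I : finType) (p : I -> M -> M) :
  orthogonal_idempotents p -> (#|I| <= n)%N.
Proof.
move=> [hp pp _ p0].
have [c cP] := choice (fun i => combP (hp i)).
pose A : 'M_(#|I|, n) := \matrix_i c (enum_val i).
suff /eqP <- : row_free A by exact: rank_leq_col.
apply: inj_row_free => x xA; apply/rowP => i; rewrite mxE.
have [v pv] := p0 (enum_val i).
have : p (enum_val i) (comb (x *m A) v) = 0.
  by rewrite xA comb0 (lin0 (hp _).1).
rewrite comb_mul (lin_sum _ _ _ (hp _).1) (bigD1 i)//= big1 => [|j ji].
  rewrite addr0 rowK -cP (linZ _ _ (hp _).1) pp eqxx => /eqP.
  by rewrite scaler_eq0 (negbTE pv) orbF => /eqP.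
rewrite rowK -cP (linZ _ _ (hp _).1) pp ifF ?scaler0//.
by apply/negbTE; rewrite (inj_eq enum_val_inj) eq_sym.
Qed.

(** Replaces [p i0] by [e], placed at [None], and their difference; the last two hypotheses keep
    both nonzero. *)
Lemma split_idempotents (I : finType) (p : I -> M -> M) i0 e :
  orthogonal_idempotents p -> lhom e ->
  (forall v, e (e v) = e v) -> (forall v, p i0 (e v) = e v) ->
  (forall v, e (p i0 v) = e v) ->
  (exists v, e v != 0) -> (exists v, e v != p i0 v) ->
  exists p' : option I -> M -> M, orthogonal_idempotents p'.
Proof.
move=> [hp pp psum p0] he ee pe ep [v1 ev1] [v2 ev2].
have pe0 i v : i != i0 -> p i (e v) = 0.
  by move=> ii; rewrite -pe pp (negbTE ii).
have ep0 i v : i != i0 -> e (p i v) = 0.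
  by move=> ii; rewrite -ep pp eq_sym (negbTE ii) (lin0 he.1).
pose p' o := match o with
  | None => e
  | Some i => if i == i0 then fun v => p i0 v - e v else p i end.
exists p'; split.
- case=> [i|] //=; case: eqP => // _; exact: lhom_sub.
- case=> [i|] [j|] v //=.
  + have -> : (Some i == Some j) = (i == j) by [].
    have [ii|ii] := eqVneq i i0; have [jj|jj] := eqVneq j i0.
    * rewrite ii jj eqxx !(linB _ _ (hp _).1) !(linB _ _ he.1) pp eqxx pe ep ee.
      by rewrite subrr subr0.
    * rewrite ii eq_sym (negbTE jj) pp eq_sym (negbTE jj).
      by rewrite ep0// subrr.
    * by rewrite jj (negbTE ii) (linB _ _ (hp _).1) pp (negbTE ii) pe0// subrr.
    * by rewrite pp.
  + have [_|ii] := eqVneq i i0; first by rewrite pe ee subrr.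
    by rewrite pe0.
  + have [_|ii] := eqVneq j i0; first by rewrite (linB _ _ he.1) ep ee subrr.
    by rewrite ep0.
- move=> v; rewrite [LHS]psum (bigD1 i0)//= [RHS](bigD1 None)//=.
  rewrite (bigD1 (Some i0))//= eqxx addrA [e v + _]addrC subrK; congr (_ + _).
  rewrite [RHS](reindex_omap Some id) => [|[i|]]//=.
  apply: eq_big => [i|i /negbTE ->//]; by rewrite eqxx andbT.
- case=> [i|] /=; last by exists v1.
  have [_|_] := eqVneq i i0; last exact: p0.
  by exists v2; rewrite subr_eq0 eq_sym.
Qed.

(** A family with the largest possible number of members is primitive: a projector onto a proper
    nonzero subrepresentation of one of the images would refine it. *)
Lemma primitive_idempotents : exists (I : finType) (p : I -> M -> M),
  orthogonal_idempotents p /\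
  forall i (U : set M), subrep U -> (forall u, U u -> p i u = u) ->
    forall u, U u -> u != 0 -> forall v, U (p i v).
Proof.
pose P m := `[<exists (I : finType) (p : I -> M -> M),
  #|I| = m /\ orthogonal_idempotents p>].
have exP : exists m, P m.
  (* The identity is a nonzero idempotent unless [M] is 0, where the empty family is used. *)
  have [M0|nM0] := pselect (forall v : M, v = 0).
    exists 0; apply/asboolP; exists void, (fun _ => id).
    split; first by rewrite card_void.
    by split=> [[]|[]|v|[]]; rewrite [LHS]M0 big1// => -[].
  exists 1; apply/asboolP; exists unit, (fun _ => idfun).
  split; first by rewrite card_unit.
  split=> [_|[] []//|v|_]; first exact: lhom_id.
    by rewrite big_const card_unit /= addr0.
  apply: contrapT => nex; apply: nM0 => v; apply/eqP; apply: contraT => v0.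
  by exfalso; apply: nex; exists v.
have ubP m : P m -> (m <= n)%N.
  by move=> /asboolP[I [p [<- op]]]; exact: card_orthogonal_idempotents op.
have [m /asboolP[I [p [cI op]]] maxm] := ex_maxnP exP ubP.
exists I, p; split=> // i U sU Up u Uu u0 v; apply: contrapT => nUv.
have [e [he eU eid]] := M_cr sU; have [hp pp psum p0] := op.
have [||||||p' op'] := @split_idempotents I p i (e \o p i) op.
- exact: lhom_comp.
- by move=> w /=; rewrite [p i (e _)]Up// eid.
- by move=> w /=; rewrite Up.
- by move=> w /=; rewrite pp eqxx.
- by exists u; rewrite /= Up// eid.
- by exists v; apply: contra_notN nUv => /eqP <-; exact: eU.
suff /maxm : P #|{: option I}| by rewrite card_option cI ltnn.
by apply/asboolP; exists (option I), p'.
Qed.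

(** Left multiplication by [f] on coordinate rows is a matrix [L]. It preserves the row space of
    [P], which is the right ideal p End(M), and has an eigenvector [y] there. The image of [comb y]
    lies in the subrepresentation of the image of [p] where [f] is the scalar [a]; by irreducibility
    this is the whole image. *)
Lemma schur_scalar p f : lhom p -> lhom f -> (exists v, p v != 0) ->
  (forall v, p (p v) = p v) ->
  (forall v, p (f v) = f v) -> (forall v, f (p v) = f v) ->
  (forall U : set M, subrep U -> (forall u, U u -> p u = u) ->
    forall u, U u -> u != 0 -> forall v, U (p v)) ->
  exists a : C, forall v, f v = a *: p v.
Proof.
move=> hp hf [v0 pv0] pp pf fp irr.
have left_mul g : lhom g ->
    exists A : 'M_n, forall x v, comb (x *m A) v = g (comb x v).
  move=> hg; have [c cP] := choice (fun j => combP (lhom_comp (q_hom j) hg)).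
  exists (\matrix_j c j) => x v; rewrite comb_mul (lin_sum _ _ _ hg.1).
  by apply: eq_bigr => j _; rewrite rowK -cP (linZ _ _ hg.1).
have [P PE] := left_mul _ hp; have [L LE] := left_mul _ hf.
have PL : P *m L = L *m P.
  apply/row_matrixP => i; rewrite !row_mul; apply: comb_inj => v.
  by rewrite LE !rowE PE PE LE fp pf.
(* The coordinates of the identity: [P] sends them to those of [p], so [P] is nonzero. *)
have [x xE] := combP (lhom_id M).
have rP : (0 < \rank P)%N.
  rewrite lt0n mxrank_eq0; apply: contraNneq pv0 => P0.
  by rewrite -[v0]/(idfun v0) xE -PE P0 mulmx0 comb0.
have /submxP[A AE] : (row_base P *m L <= row_base P)%MS.
  have sPL : (row_base P *m L <= P *m L)%MS by apply: submxMr; rewrite eq_row_base.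
  by rewrite eq_row_base (submx_trans sPL)// PL submxMl.
have [a /eigenvalueP[w wA w0]] := eigenvalue_closed A rP.
pose y := w *m row_base P.
have y0 : y != 0.
  apply: contra_neq w0 => y0; have /row_free_inj := row_base_free P.
  by apply; rewrite mul0mx.
have fy v : f (comb y v) = a *: comb y v.
  rewrite -LE /y -mulmxA AE mulmxA wA -scalemxAl /comb scaler_sumr.
  by apply: eq_bigr => j _; rewrite mxE scalerA.
have py v : p (comb y v) = comb y v.
  have /submxP[z zE] : (y <= P)%MS.
    by rewrite -(eq_row_base P) submxMl.
  by rewrite zE PE pp.
have [v yv] : exists v, comb y v != 0.
  apply: contrapT => nex; move/eqP: y0; apply; apply: comb_inj => v.
  rewrite comb0; apply/eqP; apply: contraT => yv.
  by exfalso; apply: nex; exists v.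
exists a => u.
pose U := [set u | p u = u /\ f u = a *: u].
have sU : subrep U.
  split; rewrite /U /=.
  - by rewrite (lin0 hp.1) (lin0 hf.1) scaler0.
  - move=> s t [ps fs] [pt ft].
    by rewrite (linD _ _ hp.1) (linD _ _ hf.1) ps pt fs ft scalerDr.
  - move=> b s [ps fs]; rewrite (linZ _ _ hp.1) (linZ _ _ hf.1) ps fs.
    by rewrite !scalerA mulrC.
  - move=> g s Kg [ps fs]; rewrite (lhom_rop _ hp Kg) (lhom_rop _ hf Kg) ps fs.
    by rewrite linearZZ.
have [||_ fpu] := irr U sU _ (comb y v) _ yv u; first by move=> ? [].
  by split.
by rewrite -fp fpu.
Qed.


(** Primitive idempotents are grouped by isomorphism of their images. With [f i] and [g i] inverse
    isomorphisms between the image at the representative [rt i] and the image at [i], the matrix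
    unit is the passage f_i g_j through the common representative. *)
Theorem matrix_units_exist :
  exists (I : finType) (rt : I -> I) (E : I -> I -> M -> M), matrix_units rt E.
Proof.
have [I [p [[hp pp psum p0] irr]]] := primitive_idempotents.
have ppid i v : p i (p i v) = p i v by rewrite pp eqxx.
pose iso i j f g := [/\ lhom f, lhom g,
  (forall v, p i (f v) = f v) /\ (forall v, f (p j v) = f v),
  (forall v, p j (g v) = g v) /\ (forall v, g (p i v) = g v) &
  (forall v, f (g v) = p i v) /\ (forall v, g (f v) = p j v)].
pose eqv i j := `[<exists f g, iso i j f g>].
have eqv_refl i : eqv i i.
  apply/asboolP; exists (p i), (p i).
  by split; [exact: hp|exact: hp|split|split|split].
have eqv_sym i j : eqv i j = eqv j i.
  by apply/asboolP/asboolP => -[f [g [hf hg [? ?] [? ?] [? ?]]]]; exists g, f.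
have eqv_trans i j k : eqv i j -> eqv j k -> eqv i k.
  move=> /asboolP[f [g [hf hg [f1 f2] [g1 g2] [fg gf]]]].
  move=> /asboolP[f' [g' [hf' hg' [f1' f2'] [g1' g2'] [fg' gf']]]].
  apply/asboolP; exists (f \o f'), (g' \o g); split=> /=.
  - exact: lhom_comp.
  - exact: lhom_comp.
  - by split=> v; rewrite ?f1 ?f2'.
  - by split=> v; rewrite ?g2 ?g1'.
  - by split=> v; rewrite ?fg' ?f2 ?fg// gf g2' gf'.
have [|rt [eqv_rt rtE]] := equiv_representatives eqv_refl _ eqv_trans.
  by move=> i j; rewrite eqv_sym.
have rtP i j : rt i = rt j -> eqv i j.
  by move=> ij; apply: eqv_trans (eqv_rt i) _; rewrite ij eqv_sym.
have /choice[fg fgP] : forall i, exists fg, iso i (rt i) fg.1 fg.2.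
  by move=> i; have /asboolP[f [g ?]] := eqv_rt i; exists (f, g).
pose f i := (fg i).1; pose g i := (fg i).2.
pose E i j v := if rt i == rt j then f i (g j v) else 0.
have hf i : lhom (f i) by case: (fgP i).
have hg i : lhom (g i) by case: (fgP i).
have f1 i v : p i (f i v) = f i v by case: (fgP i) => _ _ [h _] _ _; exact: h.
have f2 i v : f i (p (rt i) v) = f i v.
  by case: (fgP i) => _ _ [_ h] _ _; exact: h.
have g1 i v : p (rt i) (g i v) = g i v.
  by case: (fgP i) => _ _ _ [h _] _; exact: h.
have g2 i v : g i (p i v) = g i v by case: (fgP i) => _ _ _ [_ h] _; exact: h.
have fgE i v : f i (g i v) = p i v by case: (fgP i) => _ _ _ _ [h _]; exact: h.
have gfE i v : g i (f i v) = p (rt i) v.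
  by case: (fgP i) => _ _ _ _ [_ h]; exact: h.
have Eii i v : E i i v = p i v by rewrite /E eqxx fgE.
(* Schur's lemma between images: a nonzero corner p_i T p_j is injective on one image and onto the
   other, so it has an inverse [h]. *)
have hom_eqv i j T u : lhom T -> p i (T (p j u)) != 0 -> eqv i j.
  move=> hT Tu; pose T' v := p i (T (p j v)).
  have hT' : lhom T' := lhom_comp (lhom_comp (hp j) hT) (hp i).
  have inj v : p j v = v -> T' v = 0 -> v = 0.
    move=> pv Tv; apply/eqP; apply: contraNT Tu => v0; apply/eqP.
    have sU : subrep [set v | p j v = v /\ T' v = 0].
      split=> /=.
      - by rewrite (lin0 (hp j).1) (lin0 hT'.1).
      - move=> s t [ps Ts] [pt Tt].
        by rewrite (linD _ _ (hp j).1) (linD _ _ hT'.1) ps pt Ts Tt addr0.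
      - move=> b s [ps Ts]; rewrite (linZ _ _ (hp j).1) (linZ _ _ hT'.1) ps Ts.
        by rewrite scaler0.
      - move=> x s Kx [ps Ts].
        by rewrite (lhom_rop _ (hp j) Kx) (lhom_rop _ hT' Kx) ps Ts linear0.
    have [||_] := irr j _ sU _ v _ v0 u; [by move=> ? []|by split|].
    by rewrite /T' ppid.
  have surj v : exists w, p j w = w /\ T' w = p i v.
    have sU : subrep [set w | exists2 u, [set: M] u & T' u = w].
      exact: subrep_im hT' (@subrep_setT _ _ _ _).
    have [||w _ Tw] := irr i _ sU _ (T' u) _ Tu v.
    - by move=> _ [w _ <-]; rewrite /T' ppid.
    - by exists u.
    - by exists (p j w); rewrite ppid /T' ppid.
  have [h hP] := choice surj.
  have hU v w : p j w = w -> T' w = p i v -> h v = w.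
    move=> pw Tw; have [ph Th] := hP v.
    apply/eqP; rewrite -subr_eq0; apply/eqP/inj.
      by rewrite (linB _ _ (hp j).1) pw ph.
    by rewrite (linB _ _ hT'.1) Tw Th subrr.
  apply/asboolP; exists T', h; split=> //.
  - split.
      move=> a s t; have [ps Ts] := hP s; have [pt Tt] := hP t.
      apply: hU; first by rewrite (hp j).1 ps pt.
      by rewrite hT'.1 Ts Tt (hp i).1.
    move=> x v Kx; have [pv Tv] := hP v.
    apply: hU; first by rewrite (lhom_rop _ (hp j) Kx) pv.
    by rewrite (lhom_rop _ hT' Kx) Tv (lhom_rop _ (hp i) Kx).
  - by split=> v; rewrite /T' ppid.
  - split=> v; first by case: (hP v).
    by have [ph Th] := hP v; apply: hU => //; rewrite Th ppid.
  - split=> v; first by case: (hP v).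
    by apply: hU; rewrite ?ppid// /T' ?ppid.
exists I, rt, E; split.
- move=> i j; rewrite /E; case: eqP => _; first exact: lhom_comp.
  by split=> [a u v|x u _]; rewrite ?linear0 ?addr0.
- by move=> i; apply: esym; exact: rtE.
- move=> i j k l v ij; rewrite {1}/E ij eqxx.
  have [<-|jk] := eqVneq j k.
    rewrite /E ij; case: eqP => jl; last by rewrite (lin0 (hg _).1) (lin0 (hf _).1).
    by rewrite gfE -ij f2.
  rewrite /E; case: eqP => kl; last by rewrite (lin0 (hg _).1) (lin0 (hf _).1).
  by rewrite -(f1 k) -(g2 j) pp (negbTE jk) (lin0 (hg _).1) (lin0 (hf _).1).
- by move=> i j v /negbTE ij; rewrite /E ij.
- by move=> v; rewrite {1}(psum v); apply: eq_bigr => i _; rewrite Eii.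
- by move=> i; have [v pv] := p0 i; exists v; rewrite Eii.
- move=> T hT.
  (* The corner p_i T p_j is 0 between different classes. Within a class, [f j] and [g i] carry it
     to an endomorphism of the image at the representative, which is a scalar there. *)
  have /choice[t tP] : forall ij : I * I, exists a : C, forall v,
      p ij.1 (T (p ij.2 v)) = a *: E ij.1 ij.2 v.
    move=> [i j] /=; rewrite /E; case: eqP => [ij|/eqP ij]; last first.
      exists 0 => v; rewrite scaler0; apply/eqP; apply: contraTT ij => Tv.
      by rewrite negbK; apply/eqP/rtE; exact: hom_eqv hT Tv.
    have hh : lhom (g i \o T \o f j).
      exact: lhom_comp (hf j) (lhom_comp hT (hg i)).
    have [| | | | | |a aE] := @schur_scalar (p (rt i)) _ _ hh.
    - by [].
    - exact: p0.
    - by [].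
    - by move=> v /=; rewrite g1.
    - by move=> v /=; rewrite ij f2.
    - exact: irr.
    exists a => v.
    have := aE (g j v); rewrite /= fgE ij g1 => /(congr1 (f i)).
    by rewrite fgE (linZ _ _ (hf _).1).
  exists (fun i j => t (i, j)) => v.
  rewrite [LHS]psum; apply: eq_bigr => i _.
  rewrite {1}(psum v) (lin_sum _ _ _ hT.1) (lin_sum _ _ _ (hp _).1).
  by apply: eq_bigr => j _; rewrite (tP (i, j)).
- move=> i U sU Up u Uu u0 v; rewrite Eii.
  by apply: (irr _ _ sU _ _ Uu) => // w /Up; rewrite Eii.
Qed.

End MatrixUnits.

(** * Commuting actions *)

Section IdempotentImage.
Local Open Scope ring_scope.
Variable R : realType.
Local Notation C := R[i].
Variables (gT : groupType) (K : subgroup gT) (M : rep R K) (p : M -> M).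
Hypotheses (p_hom : lhom p) (p_idem : forall v, p (p v) = p v).

Definition img_pred : {pred M} := [pred v | p v == v].

Lemma img_pred_submod : GRing.submod_closed img_pred.
Proof.
split; first by apply/eqP; exact: lin0 p_hom.1.
move=> a u v /eqP pu /eqP pv; apply/eqP; by rewrite p_hom.1 pu pv.
Qed.

HB.instance Definition _ :=
  GRing.isSubmodClosed.Build C M img_pred img_pred_submod.

Record img := Img { imv : M; _ : imv \in img_pred }.
HB.instance Definition _ := [isSub for imv].
HB.instance Definition _ := [Choice of img by <:].
HB.instance Definition _ := [SubChoice_isSubLmodule of img by <:].

Fact imp_subproof v : p v \in img_pred.
Proof. by apply/eqP; exact: p_idem. Qed.

Definition imp v : img := Img (imp_subproof v).

Lemma imvP (u : img) : p (imv u) = imv u.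
Proof. by case: u => u /= /eqP. Qed.

Lemma imvK u : imp (imv u) = u.
Proof. by apply: val_inj; exact: imvP. Qed.

(** Operators are total in [x]; outside [K] the image need not be stable, so [p] is applied once
    more. *)
Definition img_op (x : gT) (u : img) := imp (rop M x (imv u)).

Lemma img_op_linear x : linear (img_op x).
Proof.
move=> a u v; apply: val_inj.
rewrite -[LHS]/(p (rop M x (a *: imv u + imv v))).
by rewrite linearP p_hom.1.
Qed.

HB.instance Definition _ x :=
  GRing.isLinear.Build C img img *:%R (img_op x) (img_op_linear x).

Lemma img_op1 u : img_op 1%g u = u.
Proof. by rewrite /img_op rop1 imvK. Qed.

Lemma img_opM x y u : K x -> K y ->
  img_op (x * y)%g u = img_op x (img_op y u).
Proof.
move=> Kx Ky; apply: val_inj => /=.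
by rewrite ropM// !(lhom_rop _ p_hom)// !p_idem.
Qed.

Definition img_rep : rep R K := @Rep _ _ K img img_op img_op1 img_opM.

Lemma imv_hom : @lhom _ _ _ img_rep M imv.
Proof.
by split=> [//|x u Kx]; rewrite /= (lhom_rop _ p_hom Kx) imvP.
Qed.

Lemma imp_hom : @lhom _ _ _ M img_rep imp.
Proof.
split=> [a u v|x u Kx]; apply: val_inj => /=; first by rewrite p_hom.1.
by rewrite !(lhom_rop _ p_hom Kx) p_idem.
Qed.

End IdempotentImage.

Section DoubleCentralizer.
Local Open Scope ring_scope.
Variable R : realType.
Local Notation C := R[i].
Variables (gT : groupType) (K : subgroup gT) (M : rep R K).
Variables (gQ : groupType) (Q S : subgroup gQ) (theta : gQ -> C).
Variable iota : gQ -> M -> M.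
Variables (J : finType) (u : J -> gQ).

(* The endomorphism algebra of M is thus the group algebra of Q twisted by
   theta. *)
Record commutant := {
  cm_hom : forall x, Q x -> lhom (iota x);
  cm1 : forall v, iota 1%g v = v;
  cmM : forall x y v, Q x -> Q y -> iota (x * y)%g v = iota x (iota y v);
  cm_sub : forall s, S s -> Q s;
  cm_theta : forall s v, S s -> iota s v = theta s *: v;
  cm_rep : forall j, Q (u j);
  cm_coset : forall x, Q x -> exists j, S ((u j)^-1 * x)%g;
  cm_span : forall T, lhom T ->
    exists c : J -> C, forall v, T v = \sum_j c j *: iota (u j) v;
  cm_free : forall c : J -> C,
    (forall v, \sum_j c j *: iota (u j) v = 0) -> forall j, c j = 0
}.

Hypothesis cm : commutant.

Lemma commutant_matrix_units : completely_reducible M ->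
  exists (I : finType) (rt : I -> I) (E : I -> I -> M -> M), matrix_units rt E.
Proof.
move=> M_cr.
apply: (@matrix_units_exist _ _ _ M #|J| (fun j => iota (u (enum_val j)))) => //.
- by move=> j; exact: cm_hom (cm_rep cm _).
- move=> T /(cm_span cm)[c cP]; exists (fun j => c (enum_val j)) => v.
  by rewrite cP (reindex _ (onW_bij _ (@enum_val_bij J))).
- move=> c c0 j; rewrite -(enum_valK j).
  apply: (cm_free cm (c := fun i => c (enum_rank i))) => v.
  rewrite -[RHS](c0 v) (reindex _ (onW_bij _ (@enum_val_bij J))).
  by apply: eq_bigr => i _; rewrite enum_valK.
Qed.

(** Guarding the equation by [lhom T] makes [coefs] total; on other functions its value is
    arbitrary. *)
Fact coefs_subproof T : exists c : J -> C,
  lhom T -> forall v, T v = \sum_j c j *: iota (u j) v.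
Proof.
have [hT|nT] := pselect (lhom T); last by exists (fun _ => 0).
by have [c cP] := cm_span cm hT; exists c.
Qed.

Definition coefs T := projT1 (cid (coefs_subproof T)).

Lemma coefsP T v : lhom T -> T v = \sum_j coefs T j *: iota (u j) v.
Proof. by rewrite /coefs; case: cid => c /= cP hT; exact: cP. Qed.

Lemma coefsE T c : lhom T ->
  (forall v, T v = \sum_j c j *: iota (u j) v) -> coefs T = c.
Proof.
move=> hT cP; apply/funext => j; apply/eqP; rewrite -subr_eq0; apply/eqP.
apply: (cm_free cm (c := fun j => coefs T j - c j)) => v.
under eq_bigr do rewrite scalerBl.
by rewrite sumrB -coefsP// -cP subrr.
Qed.

Definition theta_rep (V : rep R Q) :=
  forall s (v : V), S s -> rop V s v = theta s *: v.

(** Turns [V] into a module over the endomorphism algebra of [M], each endomorphism acting by its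
    coordinates. It respects composition once [S] acts on [V] by [theta]. *)
Definition act (V : rep R Q) (T : M -> M) (v : V) :=
  \sum_j coefs T j *: rop V (u j) v.

Implicit Types V W : rep R Q.

Lemma act_linear V T : linear (@act V T).
Proof. by apply: linear_bigsum => j; apply: linear_scale; exact: linear_linear. Qed.

Lemma act_hom V W (f : V -> W) T v : lhom f -> f (act T v) = act T (f v).
Proof.
move=> hf; rewrite (lin_sum _ _ _ hf.1); apply: eq_bigr => j _.
by rewrite (linZ _ _ hf.1) (lhom_rop _ hf)//; exact: cm_rep.
Qed.

Lemma act_sub V (U : set V) T v : subrep U -> U v -> U (act T v).
Proof.
move=> sU Uv; apply: (subrep_sum _ sU) => j _.
have [_ _ UZ UK] := sU; apply: UZ; apply: UK => //; exact: cm_rep.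
Qed.

Lemma act_intertwine V (f : V -> M) T v : linear f ->
  (forall x w, Q x -> f (rop V x w) = iota x (f w)) -> lhom T ->
  f (act T v) = T (f v).
Proof.
move=> lf hf hT; rewrite (lin_sum _ _ _ lf) coefsP//; apply: eq_bigr => j _.
by rewrite (linZ _ _ lf) hf//; exact: cm_rep.
Qed.

Lemma act_sum V (L : finType) (a : L -> C) (F : L -> M -> M) T v :
  (forall l, lhom (F l)) -> (forall w, T w = \sum_l a l *: F l w) ->
  @act V T v = \sum_l a l *: act (F l) v.
Proof.
move=> hF TE.
have hT : lhom T.
  rewrite (funext TE); apply: lhom_sum => l; exact: lhom_scale.
have -> : @act V T v = \sum_j (\sum_l a l * coefs (F l) j) *: rop V (u j) v.
  rewrite /act (@coefsE T (fun j => \sum_l a l * coefs (F l) j) hT)// => w.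
  rewrite TE.
  under eq_bigr => l _ do rewrite (coefsP _ (hF l)) scaler_sumr.
  rewrite exchange_big; apply: eq_bigr => j _ /=; rewrite scaler_suml.
  by apply: eq_bigr => l _; rewrite scalerA.
under [RHS]eq_bigr do rewrite scaler_sumr.
rewrite exchange_big; apply: eq_bigr => j _ /=; rewrite scaler_suml.
by apply: eq_bigr => l _; rewrite scalerA.
Qed.

(** Writing x = u_i s with [s] in [S], both sides become theta(s) times the operator of [u i]. *)
Lemma act_iota V x v : theta_rep V -> Q x -> act (iota x) v = rop V x v.
Proof.
move=> tV Qx; have [i Si] := cm_coset cm Qx.
set s := ((u i)^-1 * x)%g in Si.
have xE : x = (u i * s)%g by rewrite /s mulVKg.
have cE : coefs (iota x) = fun j => if j == i then theta s else 0.
  apply: coefsE => [|w]; first exact: cm_hom.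
  rewrite (bigD1 i)//= eqxx big1 ?addr0 => [|j /negbTE ->]; last first.
    by rewrite scale0r.
  rewrite xE (cmM cm) ?(cm_theta cm w Si).
  - by rewrite (linZ _ _ (cm_hom cm (cm_rep cm i)).1).
  - exact: cm_rep.
  - exact: cm_sub.
rewrite /act cE (bigD1 i)//= eqxx big1 ?addr0 => [|j /negbTE ->]; last first.
  by rewrite scale0r.
rewrite xE ropM ?(tV _ _ Si) ?linearZZ//; [exact: cm_rep|exact: cm_sub].
Qed.

Lemma act_id V v : theta_rep V -> act idfun v = v :> V.
Proof.
move=> tV; have <- : iota 1%g = idfun by apply/funext => w; rewrite (cm1 cm).
by rewrite act_iota ?rop1//; exact: sg1.
Qed.

(** Products of representatives are not representatives, but [act_iota] evaluates them in [V] as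
    [cmM] does on [M]; structure constants never have to be written down. *)
Lemma act_comp V F G v : theta_rep V -> lhom F -> lhom G ->
  @act V (F \o G) v = act F (act G v).
Proof.
move=> tV hF hG; have Qu := cm_rep cm.
rewrite (@act_sum _ (J * J)%type (fun jk => coefs F jk.1 * coefs G jk.2)
  (fun jk => iota (u jk.1 * u jk.2)%g)); first last.
- move=> w /=; rewrite (coefsP _ hF).
  rewrite (coefsP w hG).
  under [LHS]eq_bigr => j _ do
    rewrite (lin_sum _ _ _ (cm_hom cm (Qu j)).1) scaler_sumr.
  rewrite pair_bigA; apply: eq_bigr => -[j k] _ /=.
  by rewrite (linZ _ _ (cm_hom cm (Qu j)).1) (cmM cm)// scalerA.
- by move=> jk; apply: cm_hom => //; apply: sgM.
rewrite [RHS]/act.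
under [RHS]eq_bigr => j _ do rewrite linear_sum scaler_sumr.
rewrite [RHS]pair_bigA; apply: eq_bigr => -[j k] _ /=.
by rewrite act_iota//; [rewrite linearZZ ropM// scalerA|exact: sgM].
Qed.

Lemma act0 V T v : (forall w, T w = 0) -> act T v = 0 :> V.
Proof.
move=> T0; rewrite (@act_sum _ void (fun _ => 0) (fun _ => idfun)).
- by rewrite big1// => -[].
- by case.
- by move=> w; rewrite T0 big1// => -[].
Qed.

Variables (I : finType) (rt : I -> I) (E : I -> I -> M -> M).
Hypothesis mu : matrix_units rt E.

Let E_hom i j : lhom (E i j). Proof. exact: mu_hom mu i j. Qed.


Lemma act_mul V i j k l v : theta_rep V -> rt i = rt j ->
  @act V (E i j) (act (E k l) v) = if j == k then act (E i l) v else 0.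
Proof.
move=> tV; rewrite -act_comp//; have [->|jk] := eqVneq j k => ij.
  by congr act; apply/funext => w /=; rewrite (mu_mul mu)// eqxx.
by apply: act0 => w /=; rewrite (mu_mul mu)// (negbTE jk).
Qed.

Lemma act_one V v : theta_rep V -> v = \sum_i @act V (E i i) v.
Proof.
move=> tV; rewrite -{1}(act_id v tV) (@act_sum _ I (fun=> 1) (fun i => E i i))//.
  by apply: eq_bigr => i _; rewrite scale1r.
move=> w /=; under eq_bigr do rewrite scale1r.
exact: (mu_sum mu).
Qed.

End DoubleCentralizer.

Section IrreducibleCriteria.
Local Open Scope ring_scope.
Variable R : realType.
Variables (gT : groupType) (K : subgroup gT).
Implicit Types V W T : rep R K.

Lemma irreducibleI V (v : V) : v != 0 ->
  (forall (U : set V) u, subrep U -> U u -> u != 0 -> forall w, U w) ->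
  irreducible V.
Proof.
move=> v0 irr; split=> [|U sU]; first by exists v.
have [[u Uu u0]|nex] := pselect (exists2 u, U u & u != 0); [right|left].
  by apply/seteqP; split=> // w _; exact: irr u0 w.
apply/seteqP; split=> [u Uu|_ ->]; last by case: sU.
by apply/eqP; apply: contra_notT nex => u0; exists u.
Qed.

(* A projector onto the kernel of the quotient map splits it. *)
Lemma constituent_embeds V T : completely_reducible V -> constituent V T ->
  exists f : T -> V, lhom f /\ forall t, f t = 0 -> t = 0.
Proof.
move=> crV [irrT [W [i [p [hi injI hp surjp]]]]].
have hi' := lhom_linear hi; have hp' := lhom_linear hp.
have sU : subrep [set v | exists2 w, p w = 0 & i w = v].
  exact: subrep_im hi' (subrep_ker hp').
have [e [he eU eid]] := crV _ sU.
have [s sP] := choice surjp.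
have fE w t : p w = t -> i (s t) - e (i (s t)) = i w - e (i w).
  move=> pw; have Uw : exists2 w', p w' = 0 & i w' = i (s t) - i w.
    by exists (s t - w); rewrite linearB//= sP pw subrr.
  have := eid _ Uw; rewrite (linB _ _ he.1) => e1.
  have e2 : i (s t) = e (i (s t)) - e (i w) + i w by rewrite e1 subrK.
  by rewrite {1}e2 addrAC [_ - e (i w)]addrC addrK addrC.
exists (fun t => i (s t) - e (i (s t))); split; last first.
  move=> t /eqP; rewrite subr_eq0 => /eqP ist.
  have [w pw iw] := eU (i (s t)); rewrite -ist in iw.
  by rewrite -(sP t) -(injI _ _ iw).
split=> [a t t'|x t Kx].
  rewrite (fE (a *: s t + s t')) ?linearP ?sP// he.1.
  by rewrite scalerBr opprD addrACA.
rewrite (fE (rop W x (s t))) ?hp// ?sP// hi// (lhom_rop _ he Kx).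
by rewrite linearB.
Qed.

End IrreducibleCriteria.

(** * Blocks of matrix units and their column modules *)

Section Blocks.
Local Open Scope ring_scope.
Variable R : realType.
Local Notation C := R[i].
Variables (gT : groupType) (K : subgroup gT) (M : rep R K).
Variables (I : finType) (rt : I -> I) (E : I -> I -> M -> M).
Hypothesis mu : matrix_units rt E.

Let E_hom i j : lhom (E i j). Proof. exact: mu_hom mu i j. Qed.

Definition block (i : I) : {pred I} := [pred a | rt a == rt i].
Definition blk i : finType := {a : I | a \in block i}.
Definition self i : blk i := exist _ i (eqxx (rt i)).
Definition classrep : finType := {i : I | rt i == i}.

Lemma blkP i (a : blk i) : rt (val a) = rt i.
Proof. by apply/eqP; exact: (valP a). Qed.

Lemma mu_idem i v : E i i (E i i v) = E i i v.
Proof. by rewrite (mu_mul mu)// eqxx. Qed.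

Lemma mu_off2 i j k l v : rt k != rt j -> E i j (E k l v) = 0.
Proof.
move=> kj; have [ij|ij] := eqVneq (rt i) (rt j); last by rewrite (mu_off mu).
by rewrite (mu_mul mu)// ifF//; apply/negbTE; apply: contra_neq kj => ->.
Qed.

Lemma sum_blk (V : nmodType) i (F : I -> V) :
  (forall a, rt a != rt i -> F a = 0) -> \sum_a F a = \sum_(a : blk i) F (val a).
Proof.
move=> F0; rewrite -(big_sub (block i) F) [RHS]big_mkcond/=.
by apply: eq_bigr => a _; case: ifP => // /negbT /F0.
Qed.

Fact entry_subproof T : exists t : I -> I -> C, lhom T ->
  forall v, T v = \sum_i \sum_j t i j *: E i j v.
Proof.
have [hT|nT] := pselect (lhom T); last by exists (fun _ _ => 0).
by have [t tP] := mu_span mu hT; exists t.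
Qed.

(** Only entries inside a block are determined: between different blocks [E] vanishes and the
    coefficient is arbitrary. *)
Definition entry T := projT1 (cid (entry_subproof T)).

(** The column of matrix units through [i] spans a left ideal, on which [T] acts by its matrix. *)
Lemma entryP T i (b : blk i) v : lhom T ->
  T (E (val b) i v) = \sum_(a : blk i) entry T (val a) (val b) *: E (val a) i v.
Proof.
move=> hT; rewrite -(@sum_blk _ i (fun a => entry T a (val b) *: E a i v));
  last by move=> a ai; rewrite (mu_off mu)// scaler0.
have -> w : T w = \sum_i \sum_j entry T i j *: E i j w.
  by rewrite /entry; case: cid => t /= tP; exact: tP.
apply: eq_bigr => a _; rewrite (bigD1 (val b))//= big1 => [|c cb].
  have [ab|ab] := eqVneq (rt a) (rt (val b)).
    by rewrite (mu_mul mu)// eqxx addr0.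
  have ai : rt a != rt i by rewrite -(blkP b).
  by rewrite (mu_off mu _ ab) (mu_off mu _ ai) !scaler0 addr0.
have [ac|ac] := eqVneq (rt a) (rt c).
  by rewrite (mu_mul mu)// (negbTE cb) scaler0.
by rewrite (mu_off mu _ ac) scaler0.
Qed.

Definition vec i := E i i (projT1 (cid (mu_neq0 mu i))).

Lemma vec_neq0 i : vec i != 0.
Proof. by rewrite /vec; case: cid. Qed.

Lemma E_vec i : E i i (vec i) = vec i.
Proof. exact: mu_idem. Qed.

Section Simple.
Variable i : I.
Local Notation Yt := {ffun blk i -> C^o}.

(** Realises column vectors inside [M], as what the matrix units make of the single vector [vec i].
    Its injectivity reduces identities between matrices to identities between operators on [M]. *)
Definition emb (w : Yt) : M := \sum_a (w a : C) *: E (val a) i (vec i).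

Lemma emb_linear : linear emb.
Proof.
move=> a v w; rewrite /emb scaler_sumr -big_split /=; apply: eq_bigr => b _.
by rewrite !ffunE scalerA -scalerDl.
Qed.

Lemma E_emb (a b : blk i) w :
  E (val a) (val b) (emb w) = (w b : C) *: E (val a) i (vec i).
Proof.
have ab : rt (val a) = rt (val b) by rewrite !blkP.
rewrite (lin_sum _ _ _ (E_hom _ _).1) (bigD1 b)//= big1 => [|c cb].
  by rewrite (linZ _ _ (E_hom _ _).1) (mu_mul mu)// eqxx addr0.
rewrite (linZ _ _ (E_hom _ _).1) (mu_mul mu)// ifF ?scaler0//.
by apply/negbTE; rewrite eq_sym.
Qed.

Lemma emb_inj : injective emb.
Proof.
move=> v w vw; apply/ffunP => a.
have := E_emb (self i) a w; rewrite -vw E_emb E_vec.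
move/eqP; rewrite -subr_eq0 -scalerBl scaler_eq0 (negbTE (vec_neq0 i)) orbF.
by rewrite subr_eq0 => /eqP.
Qed.

Definition mxop T (w : Yt) : Yt :=
  [ffun a => \sum_b entry T (val a) (val b) * w b].

Lemma mxop_linear T : linear (mxop T).
Proof.
move=> a v w; apply/ffunP => b; rewrite !ffunE scaler_sumr -big_split /=.
by apply: eq_bigr => c _; rewrite !ffunE mulrDr; congr (_ + _); exact: mulrCA.
Qed.

HB.instance Definition _ T :=
  GRing.isLinear.Build C Yt Yt *:%R (mxop T) (mxop_linear T).

Lemma emb_mxop T w : lhom T -> emb (mxop T w) = T (emb w).
Proof.
move=> hT; rewrite /emb (lin_sum _ _ _ hT.1).
under [RHS]eq_bigr do rewrite (linZ _ _ hT.1) entryP// scaler_sumr.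
rewrite exchange_big /=; apply: eq_bigr => a _; rewrite ffunE scaler_suml.
by apply: eq_bigr => b _; rewrite scalerA mulrC.
Qed.

Definition dlt (a : blk i) : Yt := [ffun b => (b == a)%:R].

Lemma emb_dlt a : emb (dlt a) = E (val a) i (vec i).
Proof.
rewrite /emb (bigD1 a)//= big1 => [|b /negbTE ba]; rewrite ffunE.
  by rewrite eqxx scale1r addr0.
by rewrite ba scale0r.
Qed.

Lemma dlt_sum (w : Yt) : w = \sum_a (w a : C) *: dlt a.
Proof.
apply/ffunP => b; rewrite sum_ffunE (bigD1 b)//= big1 => [|c cb]; rewrite !ffunE.
  by rewrite eqxx addr0 [_ *: _]mulr1.
by rewrite eq_sym (negbTE cb) [_ *: _]mulr0.
Qed.

Lemma entry_id (a b : blk i) : entry idfun (val a) (val b) = (a == b)%:R.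
Proof.
have /ffunP/(_ a) : mxop idfun (dlt b) = dlt b.
  by apply: emb_inj; rewrite emb_mxop.
rewrite !ffunE => <-; rewrite (bigD1 b)//= big1 => [|c /negbTE cb].
  by rewrite ffunE eqxx mulr1 addr0.
by rewrite ffunE cb mulr0.
Qed.

Lemma entry_comp F G (a c : blk i) : lhom F -> lhom G ->
  entry (F \o G) (val a) (val c) =
  \sum_(b : blk i) entry F (val a) (val b) * entry G (val b) (val c).
Proof.
move=> hF hG.
have colE T b : mxop T (dlt c) b = entry T (val b) (val c).
  rewrite ffunE (bigD1 c)//= big1 => [|d /negbTE dc]; rewrite ffunE.
    by rewrite eqxx mulr1 addr0.
  by rewrite dc mulr0.
rewrite -colE; have <- : mxop F (mxop G (dlt c)) = mxop (F \o G) (dlt c) :> Yt.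
  by apply: emb_inj; rewrite !emb_mxop//; exact: lhom_comp.
by rewrite ffunE; apply: eq_bigr => b _; rewrite colE.
Qed.

End Simple.
End Blocks.

(** * Irreducible constituents as images of the diagonal matrix units *)

Section BlockImages.
Local Open Scope ring_scope.
Variable R : realType.
Local Notation C := R[i].
Variables (gT : groupType) (K : subgroup gT) (M : rep R K).
Variables (I : finType) (rt : I -> I) (E : I -> I -> M -> M).
Hypothesis mu : matrix_units rt E.

Let E_hom i j : lhom (E i j). Proof. exact: mu_hom mu i j. Qed.

Definition Xrep i : rep R K := img_rep (E_hom i i) (mu_idem mu i).

Lemma Xrep_imv i : @lhom _ _ _ (Xrep i) M (fun v => imv v).
Proof. exact: imv_hom (E_hom i i) (mu_idem mu i). Qed.

Lemma Xrep_imp i : @lhom _ _ _ M (Xrep i) (imp (mu_idem mu i)).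
Proof. exact: imp_hom (E_hom i i) (mu_idem mu i). Qed.

Lemma Xrep_irreducible i : irreducible (Xrep i).
Proof.
have iv := Xrep_imv i.
have ip := Xrep_imp i.
apply: (@irreducibleI _ _ _ (Xrep i) (imp (mu_idem mu i) (vec mu i))).
  apply: contra_neq (vec_neq0 mu i) => /(congr1 (fun w => imv w)) /=.
  by rewrite E_vec.
move=> U u sU Uu u0 w.
have sV := subrep_im iv sU.
have [|||w' Uw' ww'] := mu_irr mu (i := i) sV _ (u := imv u) _ _ (imv w).
- by move=> _ [v _ <-]; exact: imvP.
- by exists u.
- by apply: contra_neq u0 => iu; apply: val_inj; exact: iu.
by have -> : w = w' by apply: val_inj; rewrite /= ww' imvP.
Qed.

Lemma Xrep_constituent i : constituent M (Xrep i).
Proof.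
split; first exact: Xrep_irreducible.
have iv := Xrep_imv i.
exists (Xrep i), (to_linear iv.1), idfun; split=> //.
- exact: iv.2.
- exact: val_inj.
- by move=> t; exists t.
Qed.

Lemma iso_Xrep (V : rep R K) (f : V -> M) i v : irreducible V -> lhom f ->
  E i i (f v) != 0 -> isomorphic V (Xrep i).
Proof.
move=> irrV hf fv; have ip := Xrep_imp i.
apply: (@schur_iso _ _ _ V (Xrep i) (imp (mu_idem mu i) \o f) v irrV).
- exact: Xrep_irreducible.
- exact: lhom_comp.
- by apply: contra_neq fv => /(congr1 (fun w => imv w)).
Qed.

(** An isomorphism extends to an endomorphism [T] of [M] with values in the image of [E j j]. By
    [entryP], [T] maps the image of [E i i] into the block of [i], which [E j j] kills when the
    blocks differ. *)
Lemma Xrep_inj i j : isomorphic (Xrep i) (Xrep j) -> rt i = rt j.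
Proof.
move=> [f hf bf]; apply/eqP; rewrite eq_sym; apply: contraT => ij.
pose v : Xrep i := imp (mu_idem mu i) (vec mu i).
have ip := Xrep_imp i.
have iv := Xrep_imv j.
pose T : M -> M := (fun w => imv w) \o f \o imp (mu_idem mu i).
have hT : lhom T := lhom_comp (lhom_comp ip (lhom_linear hf)) iv.
have TE : T (vec mu i) = 0.
  have -> : T (vec mu i) = E j j (T (E (val (self rt i)) i (vec mu i))).
    by rewrite /T /= E_vec imvP.
  rewrite (entryP mu _ _ hT) (lin_sum _ _ _ (E_hom _ _).1) big1// => a _.
  rewrite (linZ _ _ (E_hom _ _).1).
  have [ja|ja] := eqVneq j (val a).
    by move/eqP: ij; rewrite ja blkP.
  by rewrite (mu_mul mu)// (negbTE ja) scaler0.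
have v0 : v = 0.
  apply: (bij_inj bf); rewrite linear0; apply: val_inj; exact: TE.
have := vec_neq0 mu i; rewrite -[X in X != 0]E_vec.
by move/(congr1 (fun w => imv w)): v0 => /= ->; rewrite eqxx.
Qed.

(** Some [E i i] is nonzero on an embedded copy of [V], and [E (rt i) i] moves that copy to the
    representative of the block. *)
Lemma constituent_Xrep V : completely_reducible M -> constituent M V ->
  exists2 i, rt i = i & isomorphic V (Xrep i).
Proof.
move=> crM cV; have [f [hf injf]] := constituent_embeds crM cV.
have [[v v0] _] := cV.1.
have [i Ei] : exists i, E i i (f v) != 0.
  apply: contrapT => nex; move/eqP: v0; apply; apply: injf.
  rewrite [LHS](mu_sum mu) big1// => i _; apply/eqP; apply: contraT => Ei.
  by exfalso; apply: nex; exists i.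
exists (rt i); first exact: mu_rt mu i.
have rti : rt (rt i) = rt i := mu_rt mu i.
apply: (@iso_Xrep V (E (rt i) i \o f) _ v cV.1); first exact: lhom_comp.
rewrite /= (mu_mul mu)// eqxx; apply: contra_neq Ei => Ef.
have <- : E i (rt i) (E (rt i) i (f v)) = E i i (f v).
  by rewrite (mu_mul mu)// eqxx.
by rewrite Ef (lin0 (E_hom _ _).1).
Qed.

Theorem lists_Xrep : completely_reducible M ->
  lists_classes (constituent M) (fun i : classrep rt => Xrep (val i)).
Proof.
move=> crM; split=> [i|V cV]; first exact: Xrep_constituent.
have [i rti Vi] := constituent_Xrep crM cV.
have ri : rt i == i by rewrite rti.
exists (exist _ i ri); split=> // -[j rj] /= Vj.
apply: val_inj => /=; rewrite -rti -(eqP rj); apply: Xrep_inj.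
exact: isomorphic_trans (isomorphic_sym Vi) Vj.
Qed.

End BlockImages.

(** * Irreducible representations of Q as column modules *)

Section BlockModules.
Local Open Scope ring_scope.
Variable R : realType.
Local Notation C := R[i].
Variables (gT : groupType) (K : subgroup gT) (M : rep R K).
Variables (gQ : groupType) (Q S : subgroup gQ) (theta : gQ -> C).
Variable iota : gQ -> M -> M.
Variables (J : finType) (u : J -> gQ).
Hypothesis cm : commutant Q S theta iota u.
Variables (I : finType) (rt : I -> I) (E : I -> I -> M -> M).
Hypothesis mu : matrix_units rt E.

Let E_hom i j : lhom (E i j). Proof. exact: mu_hom mu i j. Qed.
Let iota_hom x : Q x -> lhom (iota x). Proof. exact: cm_hom cm x. Qed.

Fact iota1E : iota 1%g = idfun.
Proof. by apply/funext => v; exact: cm1 cm v. Qed.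

Fact iotaME x y : Q x -> Q y -> iota (x * y)%g = iota x \o iota y.
Proof. by move=> Qx Qy; apply/funext => v; exact: cmM cm _ _ v Qx Qy. Qed.

Section Module.
Variable i : I.
Local Notation Yt := {ffun blk rt i -> C^o}.

Fact Yrep1 (w : Yt) : mxop mu (iota 1%g) w = w.
Proof.
by apply: (@emb_inj _ _ _ _ _ _ _ mu i); rewrite emb_mxop// iota1E//; exact: lhom_id.
Qed.

Fact YrepM x y (w : Yt) : Q x -> Q y ->
  mxop mu (iota (x * y)%g) w = mxop mu (iota x) (mxop mu (iota y) w).
Proof.
move=> Qx Qy; apply: (@emb_inj _ _ _ _ _ _ _ mu i).
by rewrite !emb_mxop ?iotaME//; [exact: iota_hom|exact: iota_hom|
  apply: lhom_comp; exact: iota_hom].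
Qed.

Definition Yrep : rep R Q :=
  @Rep _ _ Q Yt (fun x => @mxop _ _ _ _ _ _ _ mu i (iota x)) Yrep1 YrepM.

Lemma emb_act T (w : Yrep) : lhom T -> emb mu (act cm T w) = T (emb mu w).
Proof.
apply: (@act_intertwine _ _ _ _ _ _ _ _ _ _ _ cm Yrep (@emb _ _ _ _ _ _ _ mu i)).
  exact: emb_linear.
by move=> x v Qx; rewrite emb_mxop//; exact: iota_hom.
Qed.

Lemma act_E_Yrep (a b : blk rt i) (w : Yrep) :
  act cm (E (val a) (val b)) w = (w b : C) *: (dlt R a : Yrep).
Proof.
apply: (@emb_inj _ _ _ _ _ _ _ mu i); rewrite emb_act// E_emb.
by rewrite (linZ _ _ (emb_linear mu (i := i))) emb_dlt.
Qed.

Lemma Yrep_theta : theta_rep S theta Yrep.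
Proof.
move=> s w Ss; apply: (@emb_inj _ _ _ _ _ _ _ mu i); rewrite emb_mxop//; last first.
  by apply: iota_hom; exact: cm_sub cm s Ss.
by rewrite (cm_theta cm)// (linZ _ _ (emb_linear mu (i := i))).
Qed.

(** From a vector with nonzero coordinate at [a], the matrix unit at (b, a) produces the basis
    vector at [b], and [act_sub] keeps it inside any subrepresentation. *)
Lemma Yrep_Irr : Irr S theta Yrep.
Proof.
split; last exact: Yrep_theta.
apply: (@irreducibleI _ _ _ Yrep (dlt R (self rt i))).
  apply/eqP => /ffunP/(_ (self rt i)); rewrite !ffunE eqxx => /eqP.
  by rewrite oner_eq0.
move=> U w sU Uw w0 v; have [U0 UD UZ UK] := sU.
have [a wa] : exists a, w a != 0.
  apply: contrapT => nex; move/eqP: w0; apply; apply/ffunP => a.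
  rewrite ffunE; apply/eqP; apply: contraT => wa.
  by exfalso; apply: nex; exists a.
have Ud b : U (dlt R b).
  have -> : (dlt R b : Yrep) = (w a)^-1 *: act cm (E (val b) (val a)) w.
    by rewrite act_E_Yrep scalerA mulVf// scale1r.
  by apply: UZ; exact: act_sub.
rewrite (dlt_sum v); apply: (subrep_sum _ sU) => b _; exact: UZ.
Qed.

(** The basis column at [i] generates the column module and can be sent to any vector fixed by
    [E i i], here to E_ii v; the column at [b] must then go to E_bi v. *)
Lemma iso_Yrep (V : rep R Q) (v : V) : Irr S theta V -> act cm (E i i) v != 0 ->
  isomorphic (Yrep : rep R Q) V.
Proof.
move=> [irrV tV] v0.
pose F (w : Yrep) : V := \sum_b (w b : C) *: act cm (E (val b) i) v.
have lF : linear F.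
  move=> a w w'; rewrite /F scaler_sumr -big_split /=; apply: eq_bigr => b _.
  by rewrite !ffunE scalerA -scalerDl.
apply: (@schur_iso _ _ _ Yrep V F (dlt R (self rt i))) => //.
- exact: Yrep_Irr.1.
- split=> // x w Qx; rewrite linear_sum /F.
  under [RHS]eq_bigr => b _.
    rewrite linearZZ -(act_iota cm _ tV Qx) -(act_comp cm)//; last exact: iota_hom.
    rewrite (@act_sum _ _ _ _ _ _ _ _ _ _ _ cm _ (blk rt i)
      (fun a => entry mu (iota x) (val a) (val b)) (fun a => E (val a) i))//;
      last by move=> w'; exact: entryP (iota_hom Qx).
    rewrite scaler_sumr; over.
  rewrite exchange_big /=; apply: eq_bigr => a _; rewrite ffunE scaler_suml.
  by apply: eq_bigr => b _; rewrite scalerA mulrC.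
- rewrite /F (bigD1 (self rt i))//= big1 => [|b /negbTE bi]; rewrite ffunE.
    by rewrite eqxx scale1r addr0.
  by rewrite bi scale0r.
Qed.

End Module.

Lemma Yrep_inj i j : isomorphic (Yrep i) (Yrep j) -> rt i = rt j.
Proof.
move=> [f hf bf]; apply/eqP; apply: contraT => ij.
pose d : Yrep i := dlt R (self rt i).
have hf' := lhom_linear hf.
have : emb mu (f (act cm (E i i) d)) = 0.
  rewrite (act_hom cm _ _ hf') emb_act//.
  rewrite /emb (lin_sum _ _ _ (E_hom _ _).1) big1// => a _.
  rewrite (linZ _ _ (E_hom _ _).1).
  have [ia|ia] := eqVneq i (val a).
    by rewrite -(blkP a) -ia eqxx in ij.
  by rewrite (mu_mul mu)// (negbTE ia) scaler0.
rewrite (act_E_Yrep (self rt i) (self rt i)).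
rewrite ffunE eqxx scale1r => fd0.
have d0 : d = 0.
  apply: (bij_inj bf); rewrite linear0; apply: (@emb_inj _ _ _ _ _ _ _ mu j).
  by rewrite fd0 (lin0 (emb_linear mu (i := j))).
by move/ffunP/(_ (self rt i)): d0 => /eqP; rewrite !ffunE eqxx oner_eq0.
Qed.

Theorem lists_Yrep :
  lists_classes (Irr S theta) (fun i : classrep rt => Yrep (val i)).
Proof.
split=> [i|V IV]; first exact: Yrep_Irr.
have [[[v v0] _] tV] := IV.
have [i Ei] : exists i, act cm (E i i) v != 0.
  apply: contrapT => nex; move/eqP: v0; apply.
  rewrite [LHS](act_one cm mu v tV) big1// => i _; apply/eqP; apply: contraT => Ei.
  by exfalso; apply: nex; exists i.
have rti : rt (rt i) = rt i := mu_rt mu i.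
have Vi : isomorphic V (Yrep (rt i)).
  apply: isomorphic_sym; apply: (iso_Yrep (v := act cm (E (rt i) i) v) IV).
  rewrite (act_mul cm mu)// eqxx; apply: contra_neq Ei => Ef.
  have <- : act cm (E i (rt i)) (act cm (E (rt i) i) v) = act cm (E i i) v.
    by rewrite (act_mul cm mu)// eqxx.
  by rewrite Ef (lin0 (act_linear cm _)).
have ri : rt (rt i) == rt i by rewrite rti.
exists (exist _ (rt i) ri); split=> // -[j rj] /= Vj.
apply: val_inj => /=; rewrite -(eqP rj) -rti; apply: Yrep_inj.
exact: isomorphic_trans (isomorphic_sym Vi) Vj.
Qed.

End BlockModules.

Section FiniteDirectSums.
Local Open Scope ring_scope.

Lemma fsbig_fintype (V : nmodType) (T : finType) (F : T -> V) :
  \sum_(i \in [set: T]) F i = \sum_i F i.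
Proof.
rewrite (@fsbigE _ _ _ _ _ (index_enum T)) ?index_enum_uniq//=.
- by apply: eq_bigl => i; rewrite in_setT.
- by move=> i _; rewrite mem_index_enum.
Qed.

Variable R : realType.
Variables (gT : groupType) (K : subgroup gT).

(** The index type of a decomposition is a dependent sum over [choiceType]s; [h] replaces it by a
    finite type, over which ordinary sums are available. *)
Lemma direct_sum_fintype (L : finType) (I : choiceType) (h : L -> I)
    (W : I -> rep R K) (V : rep R K) (j : forall i, {linear W i -> V}) :
  bijective h -> (forall i, is_hom (j i)) ->
  (forall v, exists w : forall i, W i, v = \sum_l j (h l) (w (h l))) ->
  (forall w : forall i, W i, \sum_l j (h l) (w (h l)) = 0 ->
     forall l, w (h l) = 0) ->
  is_direct_sum j.
Proof.
move=> bh homj exj injj; split=> // v; have [w vE] := exj v.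
have sumE (F : I -> V) : \sum_(i \in [set: I]) F i = \sum_l F (h l).
  by rewrite (reindex_fsbigT h)// fsbig_fintype.
exists w; split.
  split; last by rewrite sumE.
  have [h' hK h'K] := bh.
  apply: (@sub_finite_set _ _ (h @` [set: L])).
    by move=> i _; exists (h' i).
  by apply: finite_image; exact: finite_finset.
move=> w' [_]; rewrite sumE => vE'.
have [h' hK h'K] := bh.
apply: functional_extensionality_dep => i; rewrite -(h'K i).
apply/eqP; rewrite -subr_eq0; apply/eqP.
apply: (injj (fun i => w i - w' i)).
under eq_bigr do rewrite linearB.
by rewrite sumrB -vE -vE' subrr.
Qed.

End FiniteDirectSums.

(** * External tensor products and the decomposition into blocks *)

Section TensorWithBlock.
Local Open Scope ring_scope.
Variable R : realType.
Local Notation C := R[i].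
Variables (gT : groupType) (K : subgroup gT) (M : rep R K).
Variables (gQ : groupType) (Q S : subgroup gQ) (theta : gQ -> C).
Variable iota : gQ -> M -> M.
Variables (J : finType) (u : J -> gQ).
Hypothesis cm : commutant Q S theta iota u.
Variables (I : finType) (rt : I -> I) (E : I -> I -> M -> M).
Hypothesis mu : matrix_units rt E.

Variables (gV : groupType) (L : subgroup gV) (V : rep R L) (i : I).
Local Notation Tt := {ffun blk rt i -> V}.

(** Model of the tensor product of [V] with a column space: columns with entries in [V], on which
    [L] acts entrywise and [Q] by matrices. *)
Definition tens_op (x : gV * gQ) (f : Tt) : Tt :=
  [ffun a => \sum_b entry mu (iota x.2) (val a) (val b) *: rop V x.1 (f b)].

Lemma tens_op_linear x : linear (tens_op x).
Proof.
move=> a f g; apply/ffunP => b; rewrite !ffunE scaler_sumr -big_split /=.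
apply: eq_bigr => c _; rewrite !ffunE linearP scalerDr.
by rewrite !scalerA mulrC.
Qed.

HB.instance Definition _ x :=
  GRing.isLinear.Build C Tt Tt *:%R (tens_op x) (tens_op_linear x).

Lemma tens_op1 f : tens_op (1%g : gV * gQ) f = f.
Proof.
apply/ffunP => a; rewrite ffunE /= (iota1E cm) (bigD1 a)//= big1 => [|b ba].
  by rewrite entry_id eqxx scale1r rop1 addr0.
by rewrite entry_id eq_sym (negbTE ba) scale0r.
Qed.

Lemma tens_opM x y f : sgX L Q x -> sgX L Q y ->
  tens_op (x * y)%g f = tens_op x (tens_op y f).
Proof.
move=> [Lx Qx] [Ly Qy]; apply/ffunP => a; rewrite !ffunE.
under [RHS]eq_bigr do rewrite ffunE linear_sum scaler_sumr.
rewrite exchange_big /=; apply: eq_bigr => c _.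
rewrite (iotaME cm)// (entry_comp mu)//; try exact: (cm_hom cm).
rewrite scaler_suml; apply: eq_bigr => b _.
by rewrite linearZZ scalerA ropM.
Qed.

Definition tens : rep R (sgX L Q) :=
  @Rep _ _ (sgX L Q) Tt tens_op tens_op1 tens_opM.

Definition pure (v : V) (w : Yrep cm mu i) : tens := [ffun a => (w a : C) *: v].

Lemma pure_bilinear : is_bilinear pure.
Proof.
split=> [v|w] a x y; apply/ffunP => b; rewrite !ffunE.
  by rewrite scalerDl scalerA.
by rewrite scalerDr !scalerA mulrC.
Qed.

Lemma tens_pure (f : tens) : f = \sum_a pure (f a) (dlt R a).
Proof.
apply/ffunP => a; rewrite sum_ffunE (bigD1 a)//= big1 => [|b /negbTE ba].
  by rewrite !ffunE eqxx scale1r addr0.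
by rewrite !ffunE eq_sym ba scale0r.
Qed.

Lemma tens_ext_tensor : is_ext_tensor V (Yrep cm mu i) tens.
Proof.
exists pure.
  split; first exact: pure_bilinear.
  move=> Z b' [br bl].
  have lf : linear (fun f : tens => \sum_a b' (f a) (dlt R a)).
    by apply: linear_bigsum => a c f g; rewrite !ffunE bl.
  exists (to_linear lf); split.
    move=> v w; rewrite [in RHS](dlt_sum w) (lin_sum _ _ _ (br v)).
    apply: eq_bigr => a _; rewrite ffunE (linZ _ _ (br v)).
    by rewrite (linZ _ _ (bl (dlt R a))).
  move=> f' f'E t; rewrite [t in LHS]tens_pure linear_sum.
  by apply: eq_bigr => a _; rewrite f'E.
move=> x y v w Lx Qy; apply/ffunP => a; rewrite !ffunE scaler_suml.
by apply: eq_bigr => b _; rewrite ffunE linearZZ scalerA.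
Qed.

Fact inclQP (y : gQ) : Q y -> sgX L Q (1%g, y).
Proof. by split=> //; exact: sg1. Qed.

Fact inclQM (y z : gQ) : Q y -> Q z ->
  (1%g, (y * z)%g) = ((1%g, y) * (1%g, z))%g :> gV * gQ.
Proof. by move=> _ _; congr pair; rewrite /= mulg1. Qed.

Definition tensQ : rep R Q :=
  pull (f := fun y => (1%g, y) : gV * gQ) erefl inclQP inclQM tens.

Lemma pure_homQ (v : V) : @lhom _ _ _ (Yrep cm mu i) tensQ (pure v).
Proof.
split; first exact: pure_bilinear.1.
move=> y w Qy; apply/ffunP => a; rewrite !ffunE scaler_suml.
by apply: eq_bigr => b _; rewrite ffunE rop1 scalerA.
Qed.

(** Matrix units extract from a nonzero entry [f a] the pure tensors of [f a] with every basis
    column. Irreducibility of [V] then replaces [f a] by any vector, and such tensors span. *)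
Lemma tens_irreducible : irreducible V -> irreducible tens.
Proof.
move=> irrV; have [[v v0] _] := irrV.
apply: (@irreducibleI _ _ _ tens (pure v (dlt R (self rt i)))).
  apply: contra_neq v0 => /ffunP/(_ (self rt i)).
  by rewrite !ffunE eqxx scale1r.
move=> U f sU Uf f0 g; have [U0 UD UZ UK] := sU.
have [a fa] : exists a, f a != 0.
  apply: contrapT => nex; move/eqP: f0; apply; apply/ffunP => a.
  rewrite ffunE; apply/eqP; apply: contraT => wa.
  by exfalso; apply: nex; exists a.
have sQ : @subrep _ _ _ tensQ U.
  by split=> // y w Qy Uw; apply: UK => //; exact: inclQP.
have Ua b : U (pure (f a) (dlt R b)).
  suff -> : pure (f a) (dlt R b) =
      act cm (E (val b) (val a)) (f : tensQ) by exact: act_sub.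
  rewrite [f in RHS]tens_pure (lin_sum _ _ _ (act_linear cm _)).
  under eq_bigr do rewrite -(act_hom cm _ _ (pure_homQ _)) act_E_Yrep ffunE.
  rewrite (bigD1 a)//= big1 => [|c /negbTE ca].
    by rewrite eqxx scale1r addr0.
  rewrite eq_sym ca scale0r; exact: lin0 (pure_bilinear.1 _).
have Uv b w : U (pure w (dlt R b)).
  have sW : subrep [set w : V | U (pure w (dlt R b))].
    split=> /=.
    - by rewrite (lin0 (pure_bilinear.2 _)).
    - by move=> x y Ux Uy; rewrite (linD _ _ (pure_bilinear.2 _)); exact: UD.
    - by move=> x y Uy; rewrite (linZ _ _ (pure_bilinear.2 _)); exact: UZ.
    - move=> x y Lx Uy; have := UK (x, 1%g) _ (conj Lx (sg1 Q)) Uy.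
      congr U; apply/ffunP => c; rewrite !ffunE /= (iota1E cm).
      rewrite (bigD1 c)//= big1 => [|d /negbTE dc].
        by rewrite entry_id eqxx scale1r addr0 !ffunE linearZZ.
      by rewrite entry_id eq_sym dc scale0r.
  exact: irreducible_sub irrV sW fa (Ua b) w.
by rewrite (tens_pure g); apply: (subrep_sum _ sU).
Qed.

End TensorWithBlock.

Section BlockDecomposition.
Local Open Scope ring_scope.
Variable R : realType.
Local Notation C := R[i].
Variables (G : groupType) (N S : subgroup G) (theta : G -> C).
Variable Mi : rep R (sgX (sgT G) N).
Local Notation M := (resG Mi).
Let iota (n : G) (v : M) : M := rop Mi (1%g, n) v.
Variables (J : finType) (u : J -> G).
Hypothesis cm : commutant (M := M) N S theta iota u.
Variables (I : finType) (rt : I -> I) (E : I -> I -> M -> M).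
Hypothesis mu : matrix_units (M := M) rt E.

Let E_hom i j : lhom (E i j). Proof. exact: mu_hom mu i j. Qed.

Local Notation X := (Xrep mu).
Local Notation Y := (Yrep cm mu).
Local Notation T := (fun a b => tens cm mu (X a) b).

Lemma rop_pair (x : G * G) (v : Mi) : N x.2 ->
  rop Mi x v = rop Mi (1%g, x.2) (rop Mi (x.1, 1%g) v).
Proof.
move=> Nx; rewrite -ropM; [|by split=> //|by split=> //; exact: sg1].
by case: x Nx => x y _; congr (rop _ _ _); rewrite /mul /=; congr pair;
  rewrite ?mul1g ?mulg1.
Qed.

(** The tensor of [v] with the basis column at [c] goes to E_cb v. Only a = b is used in the
    decomposition, but allowing all pairs avoids a transport along that equality. *)
Definition block_map a b (f : T a b) : Mi :=
  \sum_c E (val c) b (imv (f c)).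

Lemma block_map_linear a b : linear (@block_map a b).
Proof.
apply: linear_bigsum => c x f g; rewrite !ffunE.
by rewrite -[imv _]/(x *: imv (f c) + imv (g c)) (E_hom _ _).1.
Qed.

HB.instance Definition _ a b :=
  GRing.isLinear.Build C (T a b) Mi *:%R (@block_map a b)
    (@block_map_linear a b).

Lemma block_map_hom a b : is_hom (@block_map a b : {linear T a b -> Mi}).
Proof.
move=> [x y] f [_ /= Ny].
have iv := Xrep_imv mu a.
have -> : block_map (rop (T a b) (x, y) f) =
    \sum_(c : blk rt b) \sum_(d : blk rt b) entry mu (iota y) (val c) (val d) *:
      E (val c) b (rop M x (imv (f d))).
  apply: eq_bigr => c _; rewrite ffunE (lin_sum _ _ _ iv.1).
  rewrite (lin_sum _ _ _ (E_hom _ _).1); apply: eq_bigr => d _.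
  by rewrite (linZ _ _ iv.1) (linZ _ _ (E_hom _ _).1) (lhom_rop _ iv).
rewrite exchange_big /= (rop_pair _ (x := (x, y)))// linear_sum.
rewrite [RHS]linear_sum; apply: eq_bigr => d _.
rewrite -(entryP mu _ _ (cm_hom cm Ny)); congr (rop Mi _ _).
by rewrite -[RHS]/(rop M x (E (val d) b (imv (f d)))) -(lhom_rop _ (E_hom _ _)).
Qed.

Lemma sum_classrep (V : nmodType) (F : I -> V) :
  \sum_i F i = \sum_(i : classrep rt) \sum_(a : blk rt (val i)) F (val a).
Proof.
have rtP i : rt (rt i) == rt i by rewrite (mu_rt mu).
rewrite (partition_big (fun i => exist _ (rt i) (rtP i) : classrep rt) xpredT)//=.
apply: eq_bigr => i _; rewrite -(big_sub (block rt (val i)) F).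
by apply: eq_bigl => a; rewrite -val_eqE /= inE (eqP (valP i)).
Qed.

Let mult (i j : classrep rt) : nat := (i == j).
Let idx := {ab : classrep rt * classrep rt & 'I_(mult ab.1 ab.2)}.

Fact diag_subproof i : (0 < mult i i)%N. Proof. by rewrite /mult eqxx. Qed.

Let diag (i : classrep rt) : idx :=
  existT (fun ab => 'I_(mult ab.1 ab.2)) (i, i) (Ordinal (diag_subproof i)).

Let diag_bij : bijective diag.
Proof.
exists (fun x => (tag x).1) => // -[[a b] k] /=.
have ab : a = b.
  by apply/eqP; case: k => k /=; rewrite /mult; case: eqP.
rewrite -ab in k *; congr existT; apply: val_inj => /=.
by case: k => k /=; rewrite /mult eqxx; case: k.
Qed.

Let comp (x : idx) : {linear T (val (tag x).1) (val (tag x).2) -> Mi} :=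
  @block_map (val (tag x).1) (val (tag x).2).

Let comp_direct_sum : is_direct_sum (V := Mi) comp.
Proof.
apply: (direct_sum_fintype diag_bij).
- by move=> x; exact: block_map_hom.
(* The entry at [c] is E_ic v, because E_ci E_ic = E_cc and these idempotents sum to the
   identity. *)
- move=> v; exists (fun x => [ffun c => imp (mu_idem mu (val (tag x).1))
    (E (val (tag x).1) (val c) v)] : T _ _).
  rewrite [LHS](mu_sum mu) sum_classrep; apply: eq_bigr => i _ /=.
  rewrite /block_map; apply: eq_bigr => c _; rewrite ffunE /=.
  rewrite (mu_mul mu (i := val i))// eqxx (mu_mul mu) ?eqxx//; exact: blkP.
- move=> w w0 i; apply/ffunP => c; rewrite ffunE; apply: val_inj => /=.
  have : E (val i) (val c) (\sum_l comp (diag l) (w (diag l))) = 0.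
    by rewrite w0 (lin0 (E_hom _ _).1).
  rewrite (lin_sum _ _ _ (E_hom _ _).1) (bigD1 i)//= [X in _ + X]big1; last first.
    move=> j ji; rewrite /= /block_map (lin_sum _ _ _ (E_hom _ _).1).
    rewrite big1// => d _; apply: (mu_off2 mu).
    rewrite (blkP c) (blkP d) (eqP (valP i)) (eqP (valP j)).
    by apply: contra_neq ji => /val_inj.
  rewrite addr0 /= /block_map (lin_sum _ _ _ (E_hom _ _).1).
  rewrite (bigD1 c)//= big1 => [|d dc].
    by rewrite (mu_mul mu) ?eqxx ?addr0 ?imvP//; rewrite blkP.
  rewrite (mu_mul mu) ?(blkP c)// ifF//; apply/negbTE.
  by rewrite eq_sym.
Qed.

Theorem decomposes_blocks :
  decomposes Mi (fun i : classrep rt => X (val i))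
    (fun i : classrep rt => Y (val i)) mult.
Proof.
exists (fun a b => T (val a) (val b)); split.
  by move=> a b; exact: tens_ext_tensor.
by exists comp; exact: comp_direct_sum.
Qed.

Theorem semisimple_blocks : semisimple Mi.
Proof.
exists idx, (fun x => T (val (tag x).1) (val (tag x).2)), comp.
split; last exact: comp_direct_sum.
by move=> x; apply: tens_irreducible; exact: Xrep_irreducible.
Qed.

End BlockDecomposition.

(** * Multiplicities in an arbitrary decomposition *)

Section DirectSums.
Local Open Scope ring_scope.
Variable R : realType.
Variables (gT : groupType) (K : subgroup gT) (V : rep R K).
Variables (I : choiceType) (W : I -> rep R K) (j : forall i, {linear W i -> V}).
Hypothesis jP : is_direct_sum j.

(** The family concentrated at [x]; the dependent type forces a transport. Uniqueness of
    coordinates, applied to such families, makes the summands embedded and disjoint. *)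
Let single (x : I) (t : W x) (i : I) : W i :=
  if pselect (x = i) is left e then eq_rect x (fun i => W i : Type) t i e else 0.

Let single_eq x (t : W x) : single t x = t.
Proof.
by rewrite /single; case: pselect => // e; rewrite (eq_irrelevance e erefl).
Qed.

Let single_neq x y (t : W x) : x <> y -> single t y = 0.
Proof. by move=> xy; rewrite /single; case: pselect. Qed.

Let single_finite x (t : W x) : finite_set [set i | single t i != 0].
Proof.
apply: (@sub_finite_set _ _ [set x]); last exact: finite_set1.
move=> i /= ti; apply: contrapT => ix; move/eqP: ti; apply; apply: single_neq.
by move=> xi; apply: ix.
Qed.

Let sum_single x (t : W x) : j x t = \sum_(i \in [set: I]) j i (single t i).
Proof.
rewrite (@fsbigE _ _ _ _ _ [:: x])//.
  by rewrite big_cons big_nil in_setT /= addr0 single_eq.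
move=> i _; rewrite inE => /eqP ix; rewrite single_neq ?linear0// => xi.
exact: ix.
Qed.

Lemma direct_sum_disjoint x y (s : W x) (t : W y) :
  x <> y -> j x s = j y t -> s = 0.
Proof.
move=> xy st; have [w [_ wU]] := jP.2 (j x s).
have ws : w = single s by apply: wU; split; [exact: single_finite|exact: sum_single].
have wt : w = single t.
  by apply: wU; split; [exact: single_finite|rewrite st; exact: sum_single].
rewrite -(single_eq s) -ws wt single_neq// => yx; exact: xy.
Qed.

Lemma direct_sum_inj x (s : W x) : j x s = 0 -> s = 0.
Proof.
move=> s0; have [w [_ wU]] := jP.2 (j x s).
have ws : w = single s by apply: wU; split; [exact: single_finite|exact: sum_single].
rewrite -(single_eq s) -ws.
have -> // : w = fun=> 0.
apply: wU; split.
  by rewrite (_ : [set i | _] = set0)//; apply/seteqP; split=> // i /=; rewrite eqxx.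
by rewrite s0 fsbig1// => i _; rewrite linear0.
Qed.

Lemma direct_sum_eq0 (Z : lmodType R[i]) (F : V -> Z) v : linear F ->
  (forall i (t : W i), F (j i t) = 0) -> F v = 0.
Proof.
move=> lF F0; have [w [[_ ->] _]] := jP.2 v.
by rewrite (lin_sum _ _ _ lF) big1// => i _; exact: F0.
Qed.

End DirectSums.

Section Tensors.
Local Open Scope ring_scope.
Variable R : realType.
Variables (V W T : lmodType R[i]) (b : V -> W -> T).
Hypothesis bP : is_tensor b.

(** [F] and 0 both factor the zero bilinear map, and the universal property allows only one such
    map. *)
Lemma tensor_eq0 (Z : lmodType R[i]) (F : T -> Z) t : linear F ->
  (forall v w, F (b v w) = 0) -> F t = 0.
Proof.
move=> lF F0; have b0 : @is_bilinear R V W Z (fun _ _ => 0).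
  by split=> [v|w] a x y; rewrite scaler0 addr0.
have [f [_ fU]] := bP.2 Z _ b0.
have := fU (to_linear lF) F0 t; rewrite /= => ->.
pose z : {linear T -> Z} := \0.
by have <- := fU z (fun _ _ => erefl) t.
Qed.

(** The bilinear map sending (v, w) to l(w) v factors through [b] and is nonzero at the given
    pair. *)
Lemma tensor_neq0 (l : W -> R[i]) v w : linear (l : W -> R[i]^o) ->
  l w != 0 -> v != 0 -> b v w != 0.
Proof.
move=> ll lw v0; have bl : @is_bilinear R V W V (fun v w => l w *: v).
  split=> [x|x] a y z; last by rewrite scalerDr !scalerA mulrC.
  by rewrite ll scalerDl -scalerA.
have [f [fE _]] := bP.2 V _ bl.
have fv : f (b v w) != 0 by rewrite fE scaler_eq0 (negbTE lw) (negbTE v0).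
by apply: contra_neq fv => ->; rewrite linear0.
Qed.

End Tensors.

Section Correspondence.
Local Open Scope ring_scope.
Variable R : realType.
Local Notation C := R[i].
Variables (G : groupType) (N S : subgroup G) (theta : G -> C).
Variable Mi : rep R (sgX (sgT G) N).
Local Notation M := (resG Mi).
Let iota (n : G) (v : M) : M := rop Mi (1%g, n) v.
Variables (J : finType) (u : J -> G).
Hypothesis cm : commutant (M := M) N S theta iota u.
Variables (I : finType) (rt : I -> I) (E : I -> I -> M -> M).
Hypothesis mu : matrix_units (M := M) rt E.
Hypothesis crM : completely_reducible M.

Let E_hom i j : lhom (E i j). Proof. exact: mu_hom mu i j. Qed.

Local Notation X := (Xrep mu).
Local Notation Y := (Yrep cm mu).

Variables (A B : choiceType) (pi : A -> rep R (sgT G)) (rho : B -> rep R N).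
Variable m : A -> B -> nat.
Hypothesis piP : lists_classes (constituent M) pi.
Hypothesis rhoP : lists_classes (Irr S theta) rho.
Variable T : A -> B -> rep R (sgX (sgT G) N).
Hypothesis TP : forall a b, is_ext_tensor (pi a) (rho b) (T a b).
Let idx := {ab : A * B & 'I_(m ab.1 ab.2)}.
Variable j : forall x : idx, {linear T (tag x).1 (tag x).2 -> Mi}.
Hypothesis jP : is_direct_sum j.

Fact tensor_map_ex : exists t : forall a b, pi a -> rho b -> T a b,
  forall a b, is_tensor (t a b) /\ forall x y v w, sgT G x -> N y ->
    rop (T a b) (x, y) (t a b v w) = t a b (rop (pi a) x v) (rop (rho b) y w).
Proof.
have h a b : exists t : pi a -> rho b -> T a b,
    is_tensor t /\ forall x y v w, sgT G x -> N y ->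
    rop (T a b) (x, y) (t v w) = t (rop (pi a) x v) (rop (rho b) y w).
  by have [t ? ?] := TP a b; exists t.
by exists (fun a b => projT1 (cid (h a b))) => a b; case: cid.
Qed.

Let t := projT1 (cid tensor_map_ex).

Let tP a b : is_tensor (@t a b).
Proof. by rewrite /t; case: cid => t' /= /(_ a b)[]. Qed.

Let tE a b x y v w : N y ->
  rop (T a b) (x, y) (t v w) = t (rop (pi a) x v) (rop (rho b) y w).
Proof. by rewrite /t; case: cid => t' /= /(_ a b)[_ h] Ny; exact: h. Qed.

Let component (x : idx) (v : pi (tag x).1) (w : rho (tag x).2) : M :=
  j x (t v w).

Let component_homG x w : lhom (fun v => @component x v w).
Proof.
split.
  move=> a v v'; rewrite /component ((tP _ _).1.2 w) linearP//.
move=> g v Gg; have := jP.1 x (g, 1%g) (t v w) (conj Gg (sg1 N)).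
by rewrite tE ?rop1//; exact: sg1.
Qed.

Let component_act x v w F : lhom F ->
  component v (act cm F w) = F (@component x v w).
Proof.
move=> hF.
apply: (@act_intertwine _ _ _ _ _ _ _ _ _ _ _ cm _ (fun w => component v w)) => //.
  by move=> a w' w''; rewrite /component ((tP _ _).1.1 v) linearP.
move=> n w' Nn; have := jP.1 x (1%g, n) (t v w') (conj Logic.I Nn).
by rewrite tE// rop1.
Qed.

Let iso_pi a : exists i : classrep rt, isomorphic (pi a) (X (val i)).
Proof. by have [i [? _]] := (lists_Xrep mu crM).2 _ (piP.1 a); exists i. Qed.

Let iso_rho b : exists i : classrep rt, isomorphic (rho b) (Y (val i)).
Proof. by have [i [? _]] := (lists_Yrep cm mu).2 _ (rhoP.1 b); exists i. Qed.

(** [cpi] and [crho] turn out to be bijections of [A] and [B] onto the blocks, and the multiplicity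
    to be 1 exactly where they agree. *)
Let cpi a := projT1 (cid (iso_pi a)).
Let crho b := projT1 (cid (iso_rho b)).

Let cpiP a : isomorphic (pi a) (X (val (cpi a))).
Proof. by rewrite /cpi; case: cid. Qed.

Let crhoP b : isomorphic (rho b) (Y (val (crho b))).
Proof. by rewrite /crho; case: cid. Qed.

Let cpiE a i : isomorphic (pi a) (X (val i)) -> cpi a = i.
Proof.
move=> ai; have [k [_ kU]] := (lists_Xrep mu crM).2 _ (piP.1 a).
by rewrite -(kU _ ai) (kU _ (cpiP a)).
Qed.

Let crhoE b i : isomorphic (rho b) (Y (val i)) -> crho b = i.
Proof.
move=> bi; have [k [_ kU]] := (lists_Yrep cm mu).2 _ (rhoP.1 b).
by rewrite -(kU _ bi) (kU _ (crhoP b)).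
Qed.

Let cpi_inj : injective cpi.
Proof.
move=> a a' aa'; have [k [_ kU]] := piP.2 _ (piP.1 a).
rewrite -(kU _ (isomorphic_refl _)); apply: kU.
by apply: isomorphic_trans (cpiP a) _; rewrite aa'; exact: isomorphic_sym.
Qed.

Let crho_inj : injective crho.
Proof.
move=> b b' bb'; have [k [_ kU]] := rhoP.2 _ (rhoP.1 b).
rewrite -(kU _ (isomorphic_refl _)); apply: kU.
by apply: isomorphic_trans (crhoP b) _; rewrite bb'; exact: isomorphic_sym.
Qed.

Let cpi_surj i : exists a, cpi a = i.
Proof.
have [a [ia _]] := piP.2 _ (Xrep_constituent mu (val i)).
by exists a; apply: cpiE; exact: isomorphic_sym.
Qed.

Let crho_surj i : exists b, crho b = i.
Proof.
have [b [ib _]] := rhoP.2 _ (Yrep_Irr cm mu (val i)).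
by exists b; apply: crhoE; exact: isomorphic_sym.
Qed.

(** [w] is a basis column seen through the isomorphism with the column module, and [l] reads off its
    coordinate; [l] serves to show that pure tensors with [w] are nonzero. *)
Let fixed_vector b : exists (w : rho b) (l : rho b -> C),
  [/\ linear (l : rho b -> C^o), l w != 0 &
    act cm (E (val (crho b)) (val (crho b))) w = w].
Proof.
have [f hf [g fK gK]] := crhoP b; set i := val (crho b) in f hf g fK gK *.
have hf' := lhom_linear hf.
have hg := lhom_inv hf' fK gK.
pose s := self rt i.
exists (g (dlt R s)), (fun w => f w s); split.
- by move=> a v w; rewrite linearP !ffunE.
- by rewrite gK ffunE eqxx oner_eq0.
- rewrite -(act_hom cm _ _ hg); congr g.
  by rewrite (act_E_Yrep s s) ffunE eqxx scale1r.
Qed.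

(* For w fixed by the matrix unit of its block, v |-> v (x) w maps pi a into
   the image X of that matrix unit, which is irreducible. *)
Let component_iso x : exists w : rho (tag x).2,
  (forall v, v != 0 -> component v w != 0) /\
  let i := val (crho (tag x).2) in forall v, E i i (component v w) = component v w.
Proof.
have [w [l [ll lw wE]]] := fixed_vector (tag x).2; exists w; split=> [v v0|i v].
  apply: contra_neq (tensor_neq0 (tP _ _) ll lw v0) => /(direct_sum_inj jP).
  exact.
by rewrite -component_act// wE.
Qed.

Let component_class (x : idx) : cpi (tag x).1 = crho (tag x).2.
Proof.
have [w [w0 wE]] := component_iso x.
have [irr _] := piP.1 (tag x).1; have [[v v0] _] := irr.
apply: cpiE; apply: (iso_Xrep mu (v := v) irr (component_homG w)).
by rewrite wE; exact: w0.
Qed.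

(** Both copies map [pi a] to the image of the same [E i i], and [f] is onto it. So a nonzero vector
    of one copy lies in the other, against directness of the sum. *)
Let component_unique (x y : idx) : tag x = tag y -> x = y.
Proof.
case: x y => [[a b] k] [ab' k'] /= e.
case: ab' / e in k' *; apply: contrapT => kk'.
set x : idx := existT _ (a, b) k; set y : idx := existT _ (a, b) k'.
have xy : x <> y by [].
have [w [w0 wE]] := component_iso x.
have [w' [w0' wE']] := component_iso y.
have [irr _] := piP.1 a; have [[v v0] _] := irr.
set i := val (crho b).
have ip := Xrep_imp mu i.
pose f (v : pi a) : X i := imp (mu_idem mu i) (@component y v w').
have hf : lhom f := lhom_comp (component_homG w') ip.
have fv : f v != 0.
  apply: contra_neq (w0' v v0) => /(congr1 (fun u => imv u)) /=.
  by rewrite wE'.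
have [g _ gK] := irreducible_hom_bij irr (Xrep_irreducible mu i) hf fv.
have /(congr1 (fun u => imv u)) := gK (imp (mu_idem mu i) (@component x v w)).
rewrite /= wE wE' => e.
have tv0 := direct_sum_disjoint jP xy (esym e).
by move/eqP: (w0 v v0); apply; rewrite /component tv0 linear0.
Qed.

(** [vec i] is nonzero and fixed by [E i i], so [E i i] is nonzero on some component. The [rho] of
    that component lies in block [i], hence so does its [pi], and injectivity of [cpi] and [crho]
    identifies its index with (a, b). *)
Let component_exists a b : cpi a = crho b -> (0 < m a b)%N.
Proof.
move=> ab; set i := val (crho b).
have [x [v [w Ex]]] : exists x v w, E i i (@component x v w) != 0.
  apply: contrapT => nex; move/eqP: (vec_neq0 mu i); apply.
  rewrite -E_vec; apply: (direct_sum_eq0 jP _ (E_hom i i).1) => x s.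
  apply: (tensor_eq0 (tP _ _) (F := fun s => E i i (j x s))).
    by move=> c s1 s2; rewrite linearP (E_hom i i).1.
  move=> v w; apply/eqP; apply: contraT => Ex; exfalso.
  by apply: nex; exists x, v, w.
have Ew : act cm (E i i) w != 0.
  apply: contra_neq Ex; rewrite -component_act// => ->.
  by rewrite /component (lin0 ((tP _ _).1.1 v)) linear0.
have xb : crho (tag x).2 = crho b.
  apply: crhoE; apply: isomorphic_sym.
  exact: (iso_Yrep mu (rhoP.1 _) Ew).
have xa : (tag x).1 = a.
  by apply: cpi_inj; rewrite component_class xb.
move/crho_inj: xb => xb; case: x xa xb {v w Ex Ew} => [[a' b'] k] /= <- <-.
exact: leq_ltn_trans (ltn_ord k).
Qed.

Theorem correspondence :
  [/\ (forall a b, m a b = 0 \/ m a b = 1),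
      (forall b, exists! a, m a b = 1),
      (forall a, exists! b, m a b = 1) &
      forall a b, m a b = 1 ->
        exists i, isomorphic (pi a) (X i) /\ isomorphic (rho b) (Y i)]%N.
Proof.
have mE a b : m a b = (cpi a == crho b).
  case: eqP => [ab|ab]; last first.
    case mab: (m a b) => [//|n]; exfalso; apply: ab.
    have k : 'I_(m a b) by rewrite mab; exact: ord0.
    exact: (component_class (existT (fun ab => 'I_(m ab.1 ab.2)) (a, b) k)).
  have m0 := component_exists ab; apply/eqP; rewrite eqn_leq m0 andbT leqNgt.
  apply/negP => m1.
  have := @component_unique (existT _ (a, b) (Ordinal m0))
    (existT _ (a, b) (Ordinal m1)) erefl.
  by move/eqP; rewrite eq_Tagged => /eqP/(congr1 val).
have m1E a b : m a b = 1%N <-> cpi a = crho b.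
  by rewrite mE; case: eqP.
split.
- by move=> a b; rewrite mE; case: (_ == _); [right|left].
- move=> b; have [a ab] := cpi_surj (crho b); exists a; split.
    by apply/m1E.
  by move=> a' /m1E a'b; apply: cpi_inj; rewrite ab.
- move=> a; have [b ab] := crho_surj (cpi a); exists b; split.
    by apply/m1E.
  by move=> b' /m1E ab'; apply: crho_inj; rewrite ab.
- move=> a b /m1E ab; exists (val (crho b)); split; last exact: crhoP.
  by rewrite -ab; exact: cpiP.
Qed.

End Correspondence.

(** * The induced representation *)

Section Maschke.
Local Open Scope ring_scope.
Variable R : realType.
Variables (gT : groupType) (L K : subgroup gT).
Hypothesis KL : forall x, K x -> L x.

Definition restr (V : rep R L) : rep R K :=
  @Rep _ _ K V (rop V) (@rop1 _ _ _ V)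
    (fun x y v Kx Ky => ropM v (KL Kx) (KL Ky)).

Variables (T : finType) (y : T -> gT).
Hypothesis yL : forall l, L (y l).
Hypothesis yP : forall x, L x -> exists! l, K (x * (y l)^-1)%g.

(** Maschke's averaging: the conjugate of a [K]-equivariant projector by [x] depends only on the
    coset K x, and the mean over cosets is [L]-equivariant. *)
Lemma completely_reducible_finite_index (V : rep R L) :
  completely_reducible (restr V) -> completely_reducible V.
Proof.
move=> crV U sU; have [U0 UD UZ UL] := sU.
have sUK : @subrep _ _ _ (restr V) U.
  by split=> // x u Kx; apply: UL; exact: KL.
have [p [hp pU pid]] := crV U sUK.
have [l0 _] := yP (sg1 L).
pose f x v := rop V x^-1%g (p (rop V x v)).
have fK k x v : K k -> L x -> f (k * x)%g v = f x v.
  move=> Kk Lx; have Lk := KL Kk; rewrite /f invgM !ropM//; try exact: sgV.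
  have -> : p (rop V k (rop V x v)) = rop V k (p (rop V x v)).
    exact: (lhom_rop _ hp Kk).
  by rewrite -[rop V k^-1%g _]ropM ?mulVg ?rop1//; exact: sgV.
have n0 : #|T|%:R != 0 :> R[i].
  by rewrite Num.Theory.pnatr_eq0 -lt0n; apply/card_gt0P; exists l0.
exists (fun v => #|T|%:R^-1 *: \sum_l f (y l) v); split.
- apply: lhom_scale; split.
    apply: linear_bigsum => l; apply: linear_comp (linear_linear _).
    exact: linear_comp (linear_linear _) hp.1.
  move=> x v Lx.
  (* [s] is the permutation of the cosets induced by right translation by [x]. *)
  have /choice[s sP] : forall l, exists l', K (y l * x * (y l')^-1)%g.
    by move=> l; have [l' [? _]] := yP (sgM (yL l) Lx); exists l'.
  have s_inj : injective s.
    move=> l l' ll'; have [l'' [_ lU]] := yP (yL l).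
    rewrite -(lU l) ?mulgV; last exact: sg1.
    apply: lU; have := sgM (sP l) (sgV (sP l')).
    by rewrite -ll' !invgM invgK !mulgA mulgVK mulgK.
  rewrite [in RHS](reindex_inj s_inj) linear_sum; apply: eq_bigr => l _.
  have -> : f (y (s l)) v = f (y l * x)%g v.
    by rewrite -(fK _ (y (s l)) v (sP l))// mulgVK.
  rewrite /f invgM !ropM//; try by [exact: sgV|apply: sgV].
  by rewrite -[RHS]ropM ?mulgV ?rop1//; exact: sgV.
- move=> v; apply: UZ; apply: (subrep_sum _ sU) => l _.
  by apply: UL => //; exact: sgV.
- move=> u Uu; under eq_bigr => l _.
    rewrite /f pid; last by apply: UL.
    rewrite -ropM ?mulVg ?rop1//; last exact: sgV.
    over.
  by rewrite sumr_const -[u *+ _]scaler_nat scalerA mulVf// scale1r.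
Qed.

End Maschke.

(** * Restriction of sigma to H *)

Section Clifford.
Local Open Scope ring_scope.
Variable R : realType.
Variables (G : groupType) (H : normalSubgroup G) (N S : subgroup G).
Variables (theta : G -> R[i]) (sigma : rep R (sdprod H N)).
Hypothesis SN : forall s, S s -> N s.
Hypothesis SH : forall s, S s -> H s.
Hypothesis S_normal : forall n s, N n -> S s -> S (n * s * n^-1)%g.
Hypothesis sigma_theta : forall s v, S s ->
  rop sigma (s^-1%g \rtimes s) v = theta s *: v.
Variables (J : finType) (u : J -> G).
Hypothesis uN : forall j, N (u j).
Hypothesis uS : forall x, N x -> exists j, S ((u j)^-1 * x)%g.

Local Notation sH := (resH sigma).
Local Notation opH h := (rop sigma (h \rtimes 1%g)).
Local Notation opN n := (rop sigma (1%g \rtimes n)).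

Lemma sdprodH h : H h -> sdprod H N (h \rtimes 1%g).
Proof. by move=> Hh; split=> //; exact: sg1. Qed.

Lemma sdprodN n : N n -> sdprod H N (1%g \rtimes n).
Proof. by move=> Nn; split=> //; exact: sg1. Qed.

Lemma opNH n h v : N n -> H h ->
  opN n (opH h v) = opH (n * h * n^-1)%g (opN n v).
Proof.
move=> Nn Hh; rewrite -!ropM; try by [exact: sdprodN|exact: sdprodH|
  apply: sdprodH; exact: nsgJ].
by congr (rop _ _ _); congr pair; rewrite /= ?(mul1g, mulg1, invg1).
Qed.

Lemma opNM m n v : N m -> N n -> opN (m * n)%g v = opN m (opN n v).
Proof.
move=> Nm Nn; rewrite -ropM; try exact: sdprodN.
by congr (rop _ _ _); congr pair; rewrite /= ?(mul1g, mulg1, mulgV).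
Qed.

Lemma opHM h k v : H h -> H k -> opH (h * k)%g v = opH h (opH k v).
Proof.
move=> Hh Hk; rewrite -ropM; try exact: sdprodH.
by congr (rop _ _ _); congr pair; rewrite /= ?(mul1g, mulg1, invg1).
Qed.

Lemma opN1 v : opN 1%g v = v.
Proof. exact: rop1. Qed.

Lemma op_pair h n v : H h -> N n -> rop sigma (h \rtimes n) v = opH h (opN n v).
Proof.
move=> Hh Nn; rewrite -ropM; [|exact: sdprodH|exact: sdprodN].
by congr (rop _ _ _); congr pair; rewrite /= ?(mul1g, mulg1, invg1).
Qed.

(** 1 \rtimes s is the product of s \rtimes 1 and s^-1 \rtimes s. Hence [S] inside [N] preserves
    [H]-subrepresentations, and only the finitely many cosets of [S] in [N] matter for their
    translates. *)
Lemma opNS s v : S s -> opN s v = opH s (theta s *: v).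
Proof.
move=> Ss; rewrite -sigma_theta// -ropM; last 2 first.
- exact: sdprodH (SH Ss).
- by split=> /=; [apply: sgV; exact: SH|exact: SN].
by congr (rop _ _ _); congr pair; rewrite /= ?(mul1g, mulg1, invg1, mulgV).
Qed.

Let translate (E : set sigma) n := [set v | E (opN n v)].

Let subrep_translate E n : @subrep _ _ _ sH E -> N n ->
  @subrep _ _ _ sH (translate E n).
Proof.
move=> [E0 ED EZ EH] Nn; split; rewrite /translate /=.
- by rewrite linear0.
- by move=> v w Ev Ew; rewrite linearD; exact: ED.
- by move=> a v Ev; rewrite linearZZ; exact: EZ.
- by move=> h v Hh Ev; rewrite opNH//; apply: EH => //; exact: nsgJ.
Qed.

Let essential_translate E n : @subrep _ _ _ sH E -> @essential _ _ _ sH E ->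
  N n -> @essential _ _ _ sH (translate E n).
Proof.
move=> sE eE Nn Y sY [y y0 Yy]; have [Y0 YD YZ YH] := sY.
have Nn' := sgV Nn.
have nK v : opN n (opN n^-1%g v) = v by rewrite -opNM// mulgV opN1.
have Kn v : opN n^-1%g (opN n v) = v by rewrite -opNM// mulVg opN1.
have sY' := subrep_translate sY Nn'.
have [|z [z0 Yz Ez]] := eE _ sY'.
  exists (opN n y); last by rewrite /translate /= Kn.
  by apply: contra_neq y0 => y0; rewrite -(Kn y) y0 linear0.
exists (opN n^-1%g z); split=> //; last by rewrite /translate /= nK.
by apply: contra_neq z0 => z0; rewrite -(nK z) z0 linear0.
Qed.

(** Induction on the list: [Y] intersected with one translate is still a nonzero subrepresentation,
    inside which the other translates are met. *)
Let essential_inter E (s : seq G) : @subrep _ _ _ sH E ->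
  @essential _ _ _ sH E -> {in s, forall n, N n} ->
  @essential _ _ _ sH [set v | {in s, forall n, translate E n v}].
Proof.
move=> sE eE; elim: s => [|n s IHs] sN Y sY [y y0 Yy].
  by exists y; split.
have Nn : N n by apply: sN; rewrite mem_head.
have [|||z [z0 [Yz Ez] sz]] := IHs _ [set v | Y v /\ translate E n v].
- by move=> m ms; apply: sN; rewrite in_cons ms orbT.
- have [Y0 YD YZ YH] := sY; have [E0 ED EZ EH] := subrep_translate sE Nn.
  split=> /=; first by [].
  + by move=> v w [? ?] [? ?]; split; [exact: YD|exact: ED].
  + by move=> a v [? ?]; split; [exact: YZ|exact: EZ].
  + by move=> h v Hh [? ?]; split; [exact: YH|exact: EH].
- have [z [z0 Yz Ez]] := essential_translate sE eE Nn sY (ex_intro2 _ _ y y0 Yy).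
  by exists z.
exists z; split=> // m; rewrite in_cons => /orP[/eqP->//|]; exact: sz.
Qed.

(* The intersection of the N-translates of an essential E is essential, and
   stable under H and N, hence contains every irreducible summand of sigma. *)
Theorem clifford : semisimple sigma -> completely_reducible sH.
Proof.
move=> [I [W [j [irrW jP]]]]; apply: essential_completely_reducible => E sE eE v.
have [E0 ED EZ EH] := sE.
(* By normality n = s' u_i with s' in [S], and [E] is stable under s' by [opNS]; so representatives
   suffice. *)
have transl n w : {in [seq u i | i : J], forall n, translate E n w} -> N n ->
    translate E n w.
  move=> Ew Nn; have [i Si] := uS Nn; have Ni := uN i.
  set s := ((u i)^-1 * n)%g in Si.
  have Ss : S (u i * s * (u i)^-1)%g by exact: S_normal.
  have -> : n = (u i * s * (u i)^-1 * u i)%g by rewrite mulgVK /s mulVKg.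
  rewrite /translate /= opNM//; last exact: SN.
  rewrite opNS//; apply: EH; first exact: SH.
  by apply: EZ; apply: Ew; apply: map_f; rewrite mem_enum.
pose D := [set w | forall n, N n -> translate E n w].
have sD : @subrep _ _ _ sigma D.
  split.
  - by move=> n Nn; rewrite /translate /= linear0.
  - move=> x y Dx Dy n Nn; rewrite /translate /= linearD; apply: ED.
      exact: Dx.
    exact: Dy.
  - by move=> a x Dx n Nn; rewrite /translate /= linearZZ; apply: EZ; exact: Dx.
  - move=> [h m] x [/= Hh Nm] Dx n Nn.
    rewrite /translate /= (@op_pair h m)// opNH//; apply: EH; first exact: nsgJ.
    by rewrite -opNM//; apply: Dx; exact: sgM.
have DE w : D w -> E w by move=> /(_ _ (sg1 N)); rewrite /translate /= opN1.
have eD : @essential _ _ _ sH D.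
  move=> Y sY exY.
  have [|z [z0 Yz sz]] :=
      essential_inter (s := [seq u i | i : J]) sE eE _ sY exY.
    by move=> n /mapP[i _ ->].
  by exists z; split=> // n; exact: transl.
have Dj i w : D (j i w).
  have hj := lhom_linear (jP.1 i).
  have [[w0 w00] _] := irrW i.
  have sj : @subrep _ _ _ sH [set x | exists2 w, [set: W i] w & j i w = x].
    have [? ? ? jH] := subrep_im hj (@subrep_setT _ _ _ (W i)).
    by split=> // h x Hh; apply: jH; exact: sdprodH.
  have [|z [z0 [x _ xz] Dz]] := eD _ sj.
    exists (j i w0); last by exists w0.
    apply/eqP => h; move/eqP: w00; apply; exact: (direct_sum_inj jP h).
  apply: (irreducible_sub (irrW i) (subrep_preim hj sD) _ (u := x)).
    by apply/eqP => x0; move: z0; rewrite -xz x0 linear0 eqxx.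
  by rewrite /= xz.
apply: DE; have [w [[_ ->] _]] := jP.2 v.
by apply: (subrep_sum _ sD).
Qed.

End Clifford.

(** * Functions in the induced representation *)

Section Induced.
Local Open Scope ring_scope.
Variable R : realType.
Local Notation C := R[i].
Variables (G : groupType) (H : normalSubgroup G) (N : subgroup G).
Variable sigma : rep R (sdprod H N).

Local Notation Is := (Irep sigma).
Local Notation M := (resG Is).
Local Notation sH := (resH sigma).
Local Notation opH h := (rop sigma (h \rtimes 1%g)).
Local Notation opN n := (rop sigma (1%g \rtimes n)).
Local Notation L := (sdprod (sgT G) N).

(* A function f in the induced representation is determined by its values at
   g \rtimes 1. *)
Definition ev (f : Is) (g : G) : sigma := indval f (g \rtimes 1%g).

Lemma ev_linear g : linear (fun f => ev f g).
Proof. by []. Qed.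

Let indE (f : Is) (x y : sdp G) : sdprod H N x -> L y ->
  indval f (x * y)%g = rop sigma x (indval f y).
Proof. by case: f => f /= /asboolP[h _]; exact: h. Qed.

Let ind0 (f : Is) (y : sdp G) : ~ L y -> indval f y = 0.
Proof. by case: f => f /= /asboolP[_ h]; exact: h. Qed.

Lemma ev_H f h g : H h -> ev f (h * g)%g = opH h (ev f g).
Proof.
move=> Hh; rewrite /ev -indE; [|exact: sdprodH|by split=> //; exact: sg1].
by congr indval; congr pair; rewrite /= ?(mul1g, mulg1, invg1).
Qed.

Lemma ev_op f g n y : N n ->
  ev (rop Is (g, n) f) y = opN n (ev f (n^-1 * y * g)%g).
Proof.
move=> Nn; rewrite /ev /= asboolT; last by split=> //; exact: sg1.
rewrite -indE; [|exact: sdprodN|by split=> //; exact: sg1].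
by congr indval; congr pair;
  rewrite /= ?(mul1g, mulg1, invg1) ?mulgA ?mulVKg ?mulgV ?mul1g.
Qed.

Lemma ev_rop f g y : ev (rop M g f) y = ev f (y * g)%g.
Proof.
rewrite -[rop M g f]/(rop Is (g, 1%g) f) ev_op ?opN1 ?invg1 ?mul1g//.
exact: sg1.
Qed.

Lemma ev_inj f f' : (forall g, ev f g = ev f' g) -> f = f'.
Proof.
move=> ff'; apply: val_inj; apply/funext => -[a b].
rewrite -[LHS]/(indval f (a, b)) -[RHS]/(indval f' (a, b)).
have [Nb|nNb] := pselect (N b); last by rewrite !ind0// => -[].
have -> : (a, b) = ((1%g \rtimes b) * ((b^-1 * a * b)%g \rtimes 1%g))%g :> sdp G.
  by congr pair; rewrite /= ?mulg1// mul1g !mulgA mulgV mul1g mulgK.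
have Lb : L ((b^-1 * a * b)%g \rtimes 1%g) by split=> //; exact: sg1.
rewrite !indE//; try exact: sdprodN.
by congr (rop _ _ _); exact: ff'.
Qed.

(** a \rtimes b is the product of 1 \rtimes b and (b^-1 a b) \rtimes 1, which forces the value of
    the extension there. *)
Lemma ev_ext (F : G -> sigma) :
  (forall h g, H h -> F (h * g)%g = opH h (F g)) ->
  exists f : Is, forall g, ev f g = F g.
Proof.
move=> FH.
pose f (x : sdp G) : sigma := if `[< N x.2 >] then
  opN x.2 (F (x.2^-1 * x.1 * x.2)%g) else 0.
have fP : f \in ind_pred (sdprod (sgT G) N) (V := sigma).
  apply/asboolP; split; last first.
    by move=> [a b] nL; rewrite /f asboolF// => Nb; exact: nL.
  move=> [h n] [a b] [/= Hh Nn] [_ /= Nb]; rewrite /f /= !asboolT//; last exact: sgM.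
  have Hh' : H ((n * b)^-1 * h * (n * b))%g by exact: nsgJV.
  rewrite (_ : _ * _ = ((n * b)^-1 * h * (n * b)) * (b^-1 * a * b))%g; last first.
    by rewrite !invgM !mulgA mulgK mulgVK.
  rewrite FH// opNH//; last exact: sgM.
  rewrite opNM// [RHS](op_pair _ Hh Nn); congr (rop sigma (_ \rtimes _) _).
  by rewrite !mulgA mulgV mul1g -[(h * n * b)%g]mulgA mulgK.
exists (Ind fP) => g; rewrite /ev /= /f /= asboolT; last exact: sg1.
by rewrite opN1 invg1 mul1g mulg1.
Qed.

(** Delta functions on the cosets of [H], valued in [sigma]; by [sum_del] they span. *)
Fact del_subproof g v : exists f : Is, forall y,
  ev f y = if `[< H (y * g^-1)%g >] then opH (y * g^-1)%g v else 0.
Proof.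
apply: (ev_ext (F := fun y =>
  if `[< H (y * g^-1)%g >] then opH (y * g^-1)%g v else 0)).
move=> h y Hh; rewrite -mulgA; have [Hy|nHy] := pselect (H (y * g^-1)%g).
  have Hhy : H (h * (y * g^-1))%g by exact: sgM.
  by rewrite !asboolT// (opHM _ Hh Hy).
rewrite (asboolF nHy).
rewrite asboolF ?linear0// => Hhy; apply: nHy.
by rewrite -[(y * _)%g](mulKg h); apply: sgM => //; exact: sgV.
Qed.

Definition del g v : Is := projT1 (cid (del_subproof g v)).

Lemma ev_delE g v y :
  ev (del g v) y = if `[< H (y * g^-1)%g >] then opH (y * g^-1)%g v else 0.
Proof. by rewrite /del; case: cid. Qed.

Lemma ev_del g v : ev (del g v) g = v.
Proof. by rewrite ev_delE mulgV asboolT ?rop1//; exact: sg1. Qed.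

Lemma ev_del_off g v y : ~ H (y * g^-1)%g -> ev (del g v) y = 0.
Proof. by move=> nH; rewrite ev_delE asboolF. Qed.

Lemma del_eq f g v : ev f g = v ->
  (forall y, ~ H (y * g^-1)%g -> ev f y = 0) -> f = del g v.
Proof.
move=> fg f0; apply: ev_inj => y; rewrite ev_delE.
case: asboolP => [Hy|]; last exact: f0.
by rewrite -fg -ev_H// mulgVK.
Qed.

Lemma del_linear g : linear (del g).
Proof.
move=> a v w; apply: esym; apply: del_eq; first by rewrite ev_linear !ev_del.
by move=> y nH; rewrite ev_linear !ev_del_off// scaler0 addr0.
Qed.

Lemma del_H h g v : H h -> del (h * g)%g (opH h v) = del g v.
Proof.
move=> Hh; apply: del_eq.
  rewrite ev_delE invgM mulgA mulgV mul1g asboolT; last exact: sgV.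
  by rewrite -opHM ?mulVg ?rop1//; exact: sgV.
move=> y nH; apply: ev_del_off => Hy; apply: nH.
rewrite invgM mulgA in Hy.
by rewrite -[(y * g^-1)%g](mulgVK h); exact: sgM.
Qed.

Lemma rop_del g x v : rop M x (del g v) = del (g * x^-1)%g v.
Proof.
apply: del_eq; first by rewrite ev_rop mulgVK ev_del.
move=> y nH; rewrite ev_rop ev_del_off//.
by rewrite -mulgA -[x in (_ * (x * _))%g]invgK -invgM.
Qed.

Lemma ropN_del n g v : N n ->
  rop Is (1%g, n) (del g v) = del (n * g)%g (opN n v).
Proof.
move=> Nn; apply: del_eq; first by rewrite ev_op// mulg1 mulKg ev_del.
move=> y nH; rewrite ev_op// mulg1 ev_del_off ?linear0// => Hy; apply: nH.
by have := nsgJ n Hy; rewrite invgM !mulgA mulgV mul1g.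
Qed.

(** Elements of N_H fix the coset H g and act on it by the operators of (i), whereas elements of [N]
    outside [H] move it. *)
Lemma ropNH_del n g v : N n -> H n ->
  rop Is (1%g, n) (del g v) = del g (rop sigma (n^-1%g \rtimes n) v).
Proof.
move=> Nn Hn; have Hn' := sgV Hn.
by rewrite (op_pair _ Hn' Nn) ropN_del// -(del_H (n * g)%g _ Hn') mulKg.
Qed.

Variables (T : finType) (y : T -> G).
Hypothesis yP : forall x, exists! l, H (x * (y l)^-1)%g.

Lemma sum_del f : f = \sum_l del (y l) (ev f (y l)).
Proof.
apply: ev_inj => x; rewrite (lin_sum _ _ _ (ev_linear x)).
have [l [Hl lU]] := yP x; rewrite (bigD1 l)//= big1 => [|l' ll'].
  by rewrite addr0 ev_delE asboolT// -ev_H// mulgVK.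
by rewrite ev_del_off// => /lU ll; rewrite ll eqxx in ll'.
Qed.

(* If E is essential in the restriction of M to H, so is the set of v with
   del x v in E, for every x. *)
Theorem induced_completely_reducible :
  completely_reducible sH -> completely_reducible M.
Proof.
move=> crs; have essT E := @completely_reducible_essential _ _ _ sH E crs.
have HT h : H h -> sgT G h by [].
have yT l : sgT G (y l) by [].
(* [H] has finite index in [G], so it is enough to show that an essential subrepresentation over [H]
   contains every delta function. *)
apply: (@completely_reducible_finite_index _ _ _ _ HT T y yT (fun x _ => yP x) M).
set MH := restr HT M.
apply: essential_completely_reducible => E sE eE f.
have [E0 ED EZ EH] := sE.
have Edel x v : E (del x v).
  pose Ex := [set v | E (del x v)].
  apply: (essT Ex).
    split; rewrite /Ex /=.
    - by rewrite (lin0 (@del_linear x)).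
    - by move=> v1 v2 *; rewrite (linD _ _ (@del_linear x)); exact: ED.
    - by move=> a v1 *; rewrite (linZ _ _ (@del_linear x)); exact: EZ.
    - move=> h v1 Hh Ev.
      have -> : del x (opH h v1) = rop M (x^-1 * h * x)%g (del x v1).
        rewrite rop_del -(del_H x _ (sgV Hh)) -opHM ?mulVg ?rop1//; last exact: sgV.
        by congr (del _ _); rewrite !invgM invgK !mulgA mulgV mul1g.
      by apply: EH => //; exact: nsgJV.
  move=> Y sY [v0 v00 Yv0]; have [Y0 YD YZ YH] := sY.
  have sY' : @subrep _ _ _ MH [set f | exists2 v, Y v & del x v = f].
    split.
    - by exists 0; rewrite ?(lin0 (@del_linear x)).
    - move=> _ _ [v1 Y1 <-] [v2 Y2 <-]; exists (v1 + v2); first exact: YD.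
      by rewrite (linD _ _ (@del_linear x)).
    - move=> a _ [v1 Y1 <-]; exists (a *: v1); first exact: YZ.
      by rewrite (linZ _ _ (@del_linear x)).
    - move=> h _ Hh [v1 Y1 <-]; exists (opH (x * h * x^-1)%g v1).
        by apply: YH => //; exact: nsgJ.
      rewrite -[RHS]/(rop M h (del x v1)) rop_del.
      rewrite -(del_H (x * h^-1)%g _ (nsgJ x Hh)); congr (del _ _).
      by rewrite !mulgA mulgVK mulgK.
  have [|g [g0 [v1 Y1 vg] Eg]] := eE _ sY'.
    exists (del x v0); last by exists v0.
    apply/eqP => d0; move/eqP: v00; apply.
    by rewrite -(ev_del x v0) d0.
  exists v1; split=> //; last by rewrite /Ex /= vg.
  apply/eqP => v10; move/eqP: g0; apply.
  by rewrite -vg v10 (lin0 (@del_linear x)).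
by rewrite (sum_del f); apply: (subrep_sum _ sE).
Qed.

End Induced.

(** * Mackey's description of the endomorphisms *)

Section Commutants.
Local Open Scope ring_scope.
Variable R : realType.
Local Notation C := R[i].
Variables (G : groupType) (H : normalSubgroup G) (N S : subgroup G).
Variables (theta : G -> C) (sigma : rep R (sdprod H N)).
Hypothesis S_sub : forall s, S s -> sgI N H s.
Hypothesis sigma_theta : forall s v, S s ->
  rop sigma (s^-1%g \rtimes s) v = theta s *: v.
Variables (k : nat) (t : 'I_k -> G).
Hypothesis tP : coset_reps (sgI N H) S t.

Local Notation Is := (Irep sigma).
Local Notation M := (resG Is).
Local Notation sH := (resH sigma).
Local Notation opH h := (rop sigma (h \rtimes 1%g)).
Local Notation opN n := (rop sigma (1%g \rtimes n)).

Definition twist (n : G) : sH -> sH := rop sigma (n^-1%g \rtimes n).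

Lemma twist_hom n : sgI N H n -> lhom (twist n).
Proof.
move=> [Nn Hn]; split; first exact: linear_linear.
move=> h v Hh; rewrite /twist /= -!ropM; try by
  [exact: sdprodH|split=> //; exact: sgV].
by congr (rop _ _ _); congr pair;
  rewrite /= ?(mul1g, mulg1, invg1) ?mulgA ?mulVg ?mul1g.
Qed.

Lemma twistM m n v : sgI N H m -> sgI N H n ->
  twist (m * n)%g v = twist m (twist n v).
Proof.
move=> [Nm Hm] [Nn Hn]; rewrite /twist -ropM; last 2 first.
- by split=> //; exact: sgV.
- by split=> //; exact: sgV.
apply: (congr1 (fun x => rop sigma x v)).
by congr pair; rewrite /= invgM ?mulgA ?mulVg ?mul1g.
Qed.

Hypothesis sigma_End : forall T : {linear sigma -> sigma},
  @is_hom R G H sH sH T ->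
  exists! c : {ffun 'I_k -> C}, forall v,
    T v = \sum_(i < k) c i *: rop sigma ((t i)^-1%g \rtimes t i) v.

Lemma sigma_commutant : commutant (sgI N H) S theta twist t.
Proof.
split=> //.
- exact: twist_hom.
- by move=> v; rewrite /twist invg1; exact: rop1.
- by move=> *; exact: twistM.
- exact: tP.1.
- by move=> x /tP.2[i [Si _]]; exists i.
- move=> T hT; have [c [cP _]] := sigma_End (T := to_linear hT.1) hT.2.
  by exists c => v; exact: cP.
(* [c] and 0 are both coordinates of the zero endomorphism, which are unique. *)
- move=> c c0 j.
  have z : lhom (fun _ : sH => 0 : sH).
    by split=> [a u v|x v _]; rewrite ?linear0 ?addr0.
  have [d [_ dU]] := sigma_End (T := to_linear z.1) z.2.
  have -> : c j = [ffun j => c j] j by rewrite ffunE.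
  have <- : d = [ffun j => c j].
    apply: dU => v; rewrite -[LHS](c0 v); apply: eq_bigr => i _.
    by rewrite ffunE.
  have -> : d = [ffun=> 0].
    by apply: dU => v; rewrite big1// => i _; rewrite ffunE scale0r.
  by rewrite ffunE.
Qed.

Hypothesis sigma_conj : forall g, ~ (exists h n, [/\ H h, N n & g = (h * n)%g]) ->
  forall tau : rep R H, constituent (conj_rep g sH) tau ->
    ~ constituent sH tau.
Hypothesis sigma_cr : completely_reducible sH.
Variables (A : finType) (nu : A -> G).
Hypothesis nuN : forall a, N (nu a).
Hypothesis nuP : forall x, N x -> exists! a, H (x * (nu a)^-1)%g.
Variables (T : finType) (y : T -> G).
Hypothesis yP : forall x, exists! l, H (x * (y l)^-1)%g.

Let iota (n : G) (f : M) : M := rop Is (1%g, n) f.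
Let basis (ai : A * 'I_k) : G := (nu ai.1 * t ai.2)%g.

(** The [x]-component of [F] in Mackey's formula: it intertwines [sigma] with its conjugate by
    x^-1. *)
Let mackey_intertwine (F : M -> M) x h v : lhom F -> H h ->
  ev (F (del 1%g (opH h v))) x =
  opH (x * h * x^-1)%g (ev (F (del 1%g v)) x).
Proof.
move=> hF Hh.
have -> : del 1%g (opH h v) = rop M h (del 1%g v).
  rewrite rop_del mul1g -(del_H 1%g _ (sgV Hh)) mulg1.
  by rewrite -opHM ?mulVg ?rop1//; exact: sgV.
rewrite (lhom_rop _ hF)// ev_rop -ev_H ?mulgVK//; exact: nsgJ.
Qed.

(** If the component at [x] were nonzero on some irreducible summand of [sigma], it would embed it
    into a conjugate of [sigma], giving a common constituent excluded by (ii). *)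
Lemma mackey_off (F : M -> M) x v : lhom F ->
  ~ (exists h n, [/\ H h, N n & x = (h * n)%g]) ->
  ev (F (del 1%g v)) x = 0.
Proof.
move=> hF nx.
have [I [rt [E mu]]] := commutant_matrix_units sigma_commutant sigma_cr.
pose Tx (w : sH) : conj_rep x^-1%g sH := ev (F (del 1%g w)) x.
have hTx : @lhom _ _ _ sH (conj_rep x^-1%g sH) Tx.
  split=> [a u w|h w Hh].
    by rewrite /Tx (del_linear 1%g) hF.1.
  by rewrite /Tx /= mackey_intertwine// invgK.
rewrite -[LHS]/(Tx v) [v in Tx v](mu_sum mu) (lin_sum _ _ _ hTx.1) big1// => i _.
apply/eqP; apply: contraT => Ti.
pose f (w : Xrep mu i) := Tx (imv w).
have hf : lhom f := lhom_comp (Xrep_imv mu i) hTx.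
have f0 w : f w = 0 -> w = 0.
  move=> fw; apply/eqP; apply: contraNT Ti => w0; apply/eqP.
  have := irreducible_sub (Xrep_irreducible mu i) (subrep_ker hf) w0 fw.
  by move/(_ (imp (mu_idem mu i) v)).
(* The conjugating element is x^-1, and H N is stable under inversion because [H] is normal. *)
have nx' : ~ (exists h n, [/\ H h, N n & x^-1%g = (h * n)%g]).
  move=> [h [n [Hh Nn xhn]]]; apply: nx.
  exists (n^-1 * h^-1 * n)%g, n^-1%g; split.
  - by apply: nsgJV; exact: sgV.
  - exact: sgV.
  - by rewrite mulgK -invgM -xhn invgK.
exfalso; apply: (sigma_conj nx' (tau := Xrep mu i)); last exact: Xrep_constituent.
split; first exact: Xrep_irreducible.
exists (Xrep mu i), (to_linear hf.1), idfun; split=> //; first exact: hf.2.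
  move=> w w' /eqP; rewrite -subr_eq0 -linearB => /eqP/f0/eqP.
  by rewrite subr_eq0 => /eqP.
by move=> w; exists w.
Qed.

Lemma mackey_support (F : M -> M) v : lhom F ->
  F (del 1%g v) = \sum_a del (nu a) (ev (F (del 1%g v)) (nu a)).
Proof.
move=> hF; apply: ev_inj => x; rewrite (lin_sum _ _ _ (ev_linear x)).
have [[h [n [Hh Nn xhn]]]|nx] := pselect (exists h n, [/\ H h, N n & x = (h * n)%g]).
  have [a [Ha aU]] := nuP Nn.
  have xa b : H (x * (nu b)^-1)%g -> a = b.
    move=> Hb; apply: aU; rewrite -[n](mulKg h) -xhn -mulgA.
    by apply: sgM => //; exact: sgV.
  have Hxa : H (x * (nu a)^-1)%g by rewrite xhn -mulgA; exact: sgM.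
  rewrite (bigD1 a)//= big1 => [|b ba].
    by rewrite addr0 ev_delE asboolT// -ev_H// mulgVK.
  by rewrite ev_del_off// => /xa ab; rewrite ab eqxx in ba.
rewrite mackey_off// big1// => a _; rewrite ev_del_off// => Hxa.
by apply: nx; exists (x * (nu a)^-1)%g, (nu a); rewrite mulgVK.
Qed.

Lemma iota_hom n : N n -> lhom (iota n).
Proof.
move=> Nn; split; first exact: linear_linear.
move=> g f _; apply: ev_inj => x.
rewrite -[iota n (rop M g f)]/(rop Is (1%g, n) (rop M g f)).
by rewrite ev_op// mulg1 !ev_rop ev_op// mulg1 mulgA.
Qed.

Lemma iotaM m n f : N m -> N n -> iota (m * n)%g f = iota m (iota n f).
Proof.
move=> Nm Nn; have -> : iota (m * n)%g f = rop Is ((1%g, m) * (1%g, n))%g f.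
  by apply: (congr1 (fun x => rop Is x f)); congr pair; rewrite /= mulg1.
by rewrite ropM.
Qed.

Lemma iota_del a i g v :
  iota (basis (a, i)) (del g v) =
  del (nu a * g)%g (opN (nu a) (twist (t i) v)).
Proof.
have [Nt Ht] := tP.1 i; rewrite iotaM//.
have -> : iota (t i) (del g v) = del g (twist (t i) v) by exact: ropNH_del.
exact: ropN_del.
Qed.

Let opN_inj n v : N n -> opN n v = 0 -> v = 0.
Proof.
move=> Nn nv; have := sgV Nn => Nn'.
have <- : opN n^-1%g (opN n v) = v by rewrite -opNM// mulVg opN1.
by rewrite nv linear0.
Qed.

(** The functions [del 1 v] generate over [G], so an endomorphism is determined by its components at
    the [nu a]. Undoing the action of [nu a] turns each of them into an endomorphism of [sigma] over
    [H], to which (i) applies. *)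
Theorem induced_commutant : commutant (M := M) N S theta iota basis.
Proof.
have cs := sigma_commutant.
have N_t i : N (t i) by case: (tP.1 i).
have NS s : S s -> N s by case/S_sub.
split=> //.
- exact: iota_hom.
- by move=> f; exact: rop1.
- by move=> *; exact: iotaM.
- move=> s f Ss; have [Ns Hs] := S_sub Ss; apply: ev_inj => x.
  rewrite (linZ _ _ (ev_linear x)) -[LHS]/(ev (rop Is (1%g, s) f) x).
  rewrite ev_op// mulg1 (ev_H _ _ (sgV Hs)) -sigma_theta//.
  rewrite (op_pair _ (sgV Hs) Ns) opNH//; last exact: sgV.
  by rewrite mulgV mul1g.
- by move=> [a i]; exact: sgM.
- move=> x Nx; have [a [Ha _]] := nuP Nx.
  have [|i [Si _]] := tP.2 ((nu a)^-1 * x)%g.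
    split; first by apply: sgM => //; exact: sgV.
    by have := nsgJV (nu a) Ha; rewrite -mulgA mulgVK.
  by exists (a, i); rewrite /basis /= invgM -mulgA.
- move=> F hF.
  have /choice[c cP] : forall a, exists c : 'I_k -> C, forall v,
      ev (F (del 1%g v)) (nu a) = opN (nu a) (\sum_i c i *: twist (t i) v).
    move=> a; have Na := nuN a; have Na' := sgV Na.
    pose P (v : sH) : sH := opN (nu a)^-1%g (ev (F (del 1%g v)) (nu a)).
    have hP : @lhom _ _ _ sH sH P.
      split=> [b u w|h w Hh].
        by rewrite /P (del_linear 1%g) hF.1 ev_linear linearP.
      rewrite -[LHS]/(opN (nu a)^-1%g (ev (F (del 1%g (opH h w))) (nu a))).
      rewrite mackey_intertwine// opNH//; last exact: nsgJ.
      by rewrite invgK !mulgA mulVg mul1g mulgVK.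
    have [c cP] := cm_span cs hP; exists c => v; rewrite -cP /P.
    by rewrite -opNM// mulgV opN1.
  exists (fun ai => c ai.1 ai.2) => f.
  pose F' f := \sum_ai c ai.1 ai.2 *: iota (basis ai) f.
  have hF' : @lhom _ _ _ M M F'.
    apply: lhom_sum => -[a i]; apply: lhom_scale; apply: iota_hom; exact: sgM.
  have FF' v : F (del 1%g v) = F' (del 1%g v).
    rewrite mackey_support// /F'.
    rewrite -(pair_bigA _ (fun a i => c a i *: iota (basis (a, i)) (del 1%g v))).
    apply: eq_bigr => a _; rewrite cP linear_sum (lin_sum _ _ _ (del_linear (nu a))).
    apply: eq_bigr => i _; rewrite linearZZ (linZ _ _ (del_linear (nu a))).
    by rewrite iota_del mulg1.
  rewrite -[RHS]/(F' f) (sum_del yP f) (lin_sum _ _ _ hF.1) (lin_sum _ _ _ hF'.1).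
  apply: eq_bigr => l _; set w := ev f (y l).
  have -> : del (y l) w = rop M (y l)^-1%g (del 1%g w).
    by rewrite rop_del invgK mul1g.
  by rewrite (lhom_rop _ hF)// (lhom_rop _ hF')// FF'.
(* Evaluation at [nu a] isolates the terms of that coset and leaves a relation between the operators
   of (i). *)
- move=> c c0 [a i].
  apply: (cm_free cs (c := fun i => c (a, i))) => v.
  apply: (opN_inj (nuN a)).
  have : \sum_a \sum_i c (a, i) *: iota (basis (a, i)) (del 1%g v) = 0.
    by rewrite pair_bigA -[RHS](c0 (del 1%g v)); apply: eq_bigr => -[].
  move/(congr1 (fun f => ev f (nu a))).
  rewrite -[X in _ = X -> _]/(0 : sigma).
  rewrite (lin_sum _ _ _ (ev_linear (nu a))) (bigD1 a)//= [X in _ + X]big1.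
    rewrite addr0 (lin_sum _ _ _ (ev_linear (nu a))) => e; rewrite -[RHS]e.
    rewrite -[LHS]/(opN (nu a) (\sum_j c (a, j) *: (twist (t j) v : sigma))).
    rewrite linear_sum; apply: eq_bigr => j _.
    by rewrite (linZ _ _ (ev_linear (nu a))) iota_del mulg1 ev_del linearZZ.
  move=> b ba; rewrite (lin_sum _ _ _ (ev_linear (nu a))) big1// => j _.
  rewrite (linZ _ _ (ev_linear (nu a))) iota_del mulg1 ev_del_off ?scaler0// => Hab.
  have [a' [_ aU]] := nuP (nuN a).
  have e1 : a' = a by apply: aU; rewrite mulgV; exact: sg1.
  have e2 : a' = b by exact: aU.
  by rewrite -e1 -e2 eqxx in ba.
Qed.

End Commutants.

(** * Dimensions *)

Section Bases.
Local Open Scope ring_scope.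
Variable R : realType.
Local Notation C := R[i].

Lemma sum_pair (U : nmodType) (A B : finType) (F : A * B -> U) :
  \sum_x F x = \sum_a \sum_b F (a, b).
Proof. by rewrite pair_bigA; apply: eq_bigr => -[]. Qed.

Section OneSpace.
Variables (V : lmodType C) (I : choiceType) (e : I -> V).

Lemma fsbig_comb_seq (s : seq I) (c : I -> C) : uniq s ->
  (forall i, i \notin s -> c i = 0) ->
  \sum_(i \in [set: I]) c i *: e i = \sum_(i <- s) c i *: e i.
Proof.
move=> us c0; rewrite (@fsbigE _ _ _ _ _ s)//.
  by apply: eq_bigl => i; rewrite in_setT.
by move=> i _ /c0 ->; rewrite scale0r.
Qed.

Lemma finite_support_seq (c : I -> C) : finite_set [set i | c i != 0] ->
  exists2 s, uniq s & forall i, i \notin s -> c i = 0.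
Proof.
move=> /finite_seqP[s sE]; exists (undup s); first exact: undup_uniq.
move=> i; rewrite mem_undup => si; apply/eqP; apply: contraNT si => ci.
by have : [set i | c i != 0] i by []; rewrite sE.
Qed.

Lemma seq_finite_support (s : seq I) (c : I -> C) :
  (forall i, i \notin s -> c i = 0) -> finite_set [set i | c i != 0].
Proof.
move=> c0; apply: (@sub_finite_set _ _ [set` s]); last exact: finite_seq.
by move=> i /=; apply: contraNT => /c0 ->.
Qed.

(** Coefficients vanish off [s], so a combination may be rewritten over any larger list, and
    combinations with different supports compared. *)
Definition spanning := forall v, exists (s : seq I) (c : I -> C),
  [/\ uniq s, forall i, i \notin s -> c i = 0 & v = \sum_(i <- s) c i *: e i].

Definition independent := forall (s : seq I) (c : I -> C), uniq s ->
  \sum_(i <- s) c i *: e i = 0 -> forall i, i \in s -> c i = 0.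

Lemma is_basisP : is_basis e <-> spanning /\ independent.
Proof.
split=> [be|[sp ind] v].
  split=> [v|s c us c0].
    have [c [[fc vE] _]] := be v; have [s us cs] := finite_support_seq fc.
    by exists s, c; split=> //; rewrite vE (fsbig_comb_seq us).
  pose c' i := if i \in s then c i else 0.
  have c'0 i : i \notin s -> c' i = 0 by rewrite /c' => /negbTE ->.
  have [d [_ dU]] := be 0.
  have dc : d = c'.
    apply: dU; split; first exact: seq_finite_support c'0.
    rewrite (fsbig_comb_seq us c'0) -[LHS]c0 big_seq [RHS]big_seq.
    by apply: eq_bigr => i si; rewrite /c' si.
  have d0 : d = fun=> 0.
    apply: dU; split; first exact: (@seq_finite_support [::]).
    by rewrite fsbig1// => i _; rewrite scale0r.
  move=> i si; have : c' i = 0 by rewrite -dc d0.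
  by rewrite /c' si.
have [s [c [us cs vE]]] := sp v; exists c; split.
  by split; [exact: seq_finite_support cs|rewrite (fsbig_comb_seq us)].
move=> d [fd vd]; have [s' us' ds'] := finite_support_seq fd.
pose r := undup (s ++ s'); have ur : uniq r by exact: undup_uniq.
have cr i : i \notin r -> c i = 0.
  by rewrite mem_undup mem_cat negb_or => /andP[/cs].
have dr i : i \notin r -> d i = 0.
  by rewrite mem_undup mem_cat negb_or => /andP[_ /ds'].
apply/funext => i; have [ir|ir] := boolP (i \in r); last by rewrite cr// dr.
apply/eqP; rewrite -subr_eq0; apply/eqP; move: i ir.
apply: (ind r (fun i => c i - d i) ur).
under eq_bigr do rewrite scalerBl.
rewrite sumrB -(fsbig_comb_seq ur cr) -(fsbig_comb_seq ur dr) -vd.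
by rewrite (fsbig_comb_seq us cs) -vE subrr.
Qed.

End OneSpace.

Lemma has_dim_bij (V W : lmodType C) (D : choiceType) (f : V -> W) :
  linear f -> bijective f -> has_dim W D -> has_dim V D.
Proof.
move=> lf [g fK gK] [e /is_basisP[sp ind]].
have lg := @can2_linear _ _ _ (to_linear lf) g fK gK.
exists (g \o e); apply/is_basisP; split=> [v|s c us c0].
  have [s [c [us cs fE]]] := sp (f v); exists s, c; split=> //.
  rewrite -(fK v) fE (lin_sum _ _ _ lg).
  by apply: eq_bigr => i _; rewrite (linZ _ _ lg).
apply: (ind s c us); rewrite -[LHS]gK (lin_sum _ _ _ lg).
under eq_bigr do rewrite (linZ _ _ lg).
by rewrite c0 (lin0 lf).
Qed.

Lemma isomorphic_has_dim (gT : groupType) (K : subgroup gT) (V W : rep R K)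
    (D : choiceType) : isomorphic V W -> has_dim W D -> has_dim V D.
Proof. by move=> [f _ bf]; apply: (has_dim_bij (linear_linear f)). Qed.

(** Basis goes to basis. The relation [graph], two combinations with the same coefficients, is
    linear and single-valued in both directions. *)
Lemma has_dim_iso (V W : lmodType C) (D : choiceType) :
  has_dim V D -> has_dim W D -> exists f : V -> W,
    [/\ linear f, forall v, f v = 0 -> v = 0 & forall w, exists v, f v = w].
Proof.
move=> [e /is_basisP[spe inde]] [e' /is_basisP[spe' inde']].
pose graph v w := exists (s : seq D) (c : D -> C),
  [/\ uniq s, forall i, i \notin s -> c i = 0,
      v = \sum_(i <- s) c i *: e i & w = \sum_(i <- s) c i *: e' i].
have graph_lin a v w v' w' : graph v w -> graph v' w' ->
    graph (a *: v + v') (a *: w + w').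
  move=> [s [c [us cs -> ->]]] [s' [c' [us' cs' -> ->]]].
  pose r := undup (s ++ s'); have ur : uniq r by exact: undup_uniq.
  have cr i : i \notin r -> c i = 0.
    by rewrite mem_undup mem_cat negb_or => /andP[/cs].
  have dr i : i \notin r -> c' i = 0.
    by rewrite mem_undup mem_cat negb_or => /andP[_ /cs'].
  exists r, (fun i => a * c i + c' i); split=> //.
  - by move=> i ir; rewrite cr// dr// mulr0 addr0.
  - rewrite -(fsbig_comb_seq e us cs) -(fsbig_comb_seq e us' cs').
    rewrite (fsbig_comb_seq e ur cr) (fsbig_comb_seq e ur dr).
    rewrite scaler_sumr -big_split; apply: eq_bigr => i _ /=.
    by rewrite scalerA scalerDl.
  - rewrite -(fsbig_comb_seq e' us cs) -(fsbig_comb_seq e' us' cs').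
    rewrite (fsbig_comb_seq e' ur cr) (fsbig_comb_seq e' ur dr).
    rewrite scaler_sumr -big_split; apply: eq_bigr => i _ /=.
    by rewrite scalerA scalerDl.
have graph0 w : graph 0 w -> w = 0.
  move=> [s [c [us cs /esym c0 ->]]]; rewrite big_seq big1// => i si.
  by rewrite (inde s c us c0 i si) scale0r.
have graph0' v : graph v 0 -> v = 0.
  move=> [s [c [us cs -> /esym c0]]]; rewrite big_seq big1// => i si.
  by rewrite (inde' s c us c0 i si) scale0r.
have graph_fun v w w' : graph v w -> graph v w' -> w = w'.
  move=> vw vw'; apply/eqP; rewrite eq_sym -subr_eq0; apply/eqP/graph0.
  by have := graph_lin (-1) _ _ _ _ vw vw'; rewrite !scaleN1r !addNr addrC.
have /choice[f fP] : forall v, exists w, graph v w.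
  by move=> v; have [s [c [us cs vE]]] := spe v;
    exists (\sum_(i <- s) c i *: e' i), s, c.
exists f; split.
- by move=> a v w; apply: graph_fun (fP _) _; exact: graph_lin.
- by move=> v fv; apply: graph0'; rewrite -fv.
- move=> w; have [s [c [us cs wE]]] := spe' w.
  exists (\sum_(i <- s) c i *: e i); apply: graph_fun (fP _) _.
  by exists s, c.
Qed.

(** [V] is the direct sum of copies of [W] embedded by the [psi f]. When these are a basis of an
    algebra composed with one embedding, this expresses freeness over the algebra. *)
Definition freely_spanned (V W : lmodType C) (F : finType) (psi : F -> W -> V) :=
  [/\ forall f, linear (psi f),
      forall v, exists w, v = \sum_f psi f (w f) &
      forall w, \sum_f psi f (w f) = 0 -> forall f, w f = 0].

Lemma freely_spanned_has_dim (V W : lmodType C) (F : finType) (D : choiceType)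
    (psi : F -> W -> V) :
  has_dim W D -> freely_spanned psi -> has_dim V (F * D)%type.
Proof.
move=> [e /is_basisP[spe inde]] [lpsi sp ind].
pose e' (x : F * D) := psi x.1 (e x.2).
exists e'; apply/is_basisP.
have sum_pairs (s : seq D) (c : F * D -> C) :
    \sum_(x <- [seq (f, d) | f <- enum F, d <- s]) c x *: e' x =
    \sum_f psi f (\sum_(d <- s) c (f, d) *: e d).
  rewrite big_allpairs_dep big_enum /=; apply: eq_bigr => f _.
  rewrite (lin_sum _ _ _ (lpsi f)); apply: eq_bigr => d _.
  by rewrite (linZ _ _ (lpsi f)).
have pairs_uniq (s : seq D) : uniq s -> uniq [seq (f, d) | f <- enum F, d <- s].
  by move=> us; apply: allpairs_uniq => //; [exact: enum_uniq|move=> [? ?] [? ?]].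
have mem_pairs (s : seq D) (x : F * D) :
    (x \in [seq (f, d) | f <- enum F, d <- s]) = (x.2 \in s).
  apply/allpairsP/idP => [[[f d] [_ ds ->]]//|xs].
  by exists x; split=> //; [rewrite mem_enum|case: x xs].
split=> [v|r c ur c0].
  have [w ->] := sp v.
  have /choice[sc scP] : forall f, exists sc : seq D * (D -> C),
      [/\ uniq sc.1, forall d, d \notin sc.1 -> sc.2 d = 0 &
          w f = \sum_(d <- sc.1) sc.2 d *: e d].
    by move=> f; have [s [c ?]] := spe (w f); exists (s, c).
  pose s := undup (flatten [seq (sc f).1 | f : F]).
  have us : uniq s by exact: undup_uniq.
  have scs f d : d \notin s -> (sc f).2 d = 0.
    have [_ h _] := scP f; move=> ds; apply: h; apply: contra ds => ds.
    rewrite mem_undup; apply/flattenP; exists (sc f).1 => //.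
    by apply: map_f; rewrite mem_enum.
  exists [seq (f, d) | f <- enum F, d <- s], (fun x => (sc x.1).2 x.2); split.
  - exact: pairs_uniq.
  - by move=> x; rewrite mem_pairs; exact: scs.
  - rewrite sum_pairs; apply: eq_bigr => f _ /=; congr (psi f _).
    have [usf csf ->] := scP f.
    by rewrite -(fsbig_comb_seq e usf csf) (fsbig_comb_seq e us (scs f)).
pose c' x := if x \in r then c x else 0.
have c'0 x : x \notin r -> c' x = 0 by rewrite /c' => /negbTE ->.
pose s := undup [seq x.2 | x <- r].
have us : uniq s by exact: undup_uniq.
have c's x : x \notin [seq (f, d) | f <- enum F, d <- s] -> c' x = 0.
  rewrite mem_pairs => xs; apply: c'0; apply: contra xs => xr.
  by rewrite mem_undup; apply: map_f.
have : \sum_f psi f (\sum_(d <- s) c' (f, d) *: e d) = 0.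
  rewrite -sum_pairs -(fsbig_comb_seq _ (pairs_uniq _ us) c's).
  rewrite (fsbig_comb_seq _ ur c'0) -[RHS]c0 big_seq [RHS]big_seq.
  by apply: eq_bigr => x xr; rewrite /c' xr.
move=> /ind w0 [f d] xr.
have -> : c (f, d) = c' (f, d) by rewrite /c' xr.
apply: (inde s (fun d => c' (f, d)) us (w0 f)).
by rewrite mem_undup; apply/mapP; exists (f, d).
Qed.

(* The matrices c and d express the q j and the E l through each other, V' being
   a retract of V. *)
Lemma freely_spanned_change (V V' W : lmodType C) (J L Z : finType)
    (proj : V -> V') (incl : V' -> V) (q : J -> V -> V) (E : L -> V -> V')
    (g : Z -> W -> V) (c : J -> L -> C) (d : L -> J -> C) :
  linear proj -> (forall v', proj (incl v') = v') -> linear incl ->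
  (forall z, linear (g z)) -> (forall j, linear (q j)) ->
  (forall l, linear (E l)) ->
  (forall j v, proj (q j v) = \sum_l c j l *: E l v) ->
  (forall l v, incl (E l v) = \sum_j d l j *: q j v) ->
  (forall l l', \sum_j d l j * c j l' = (l == l')%:R) ->
  freely_spanned (fun (jz : J * Z) w => q jz.1 (g jz.2 w)) ->
  freely_spanned (fun (lz : L * Z) w => E lz.1 (g lz.2 w)).
Proof.
move=> lp pK li lg lq lE pq iE dc [_ sp ind]; split.
- by move=> [l z]; exact: linear_comp.
- move=> v'; have [w /(congr1 proj)] := sp (incl v').
  rewrite pK => ->.
  exists (fun lz => \sum_j c j lz.1 *: w (j, lz.2)).
  rewrite (lin_sum _ _ _ lp) [LHS]sum_pair [RHS]sum_pair /=.
  under eq_bigr do under eq_bigr do rewrite pq.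
  rewrite [LHS]exchange_big [RHS]exchange_big /=; apply: eq_bigr => z _.
  rewrite exchange_big /=; apply: eq_bigr => l _.
  rewrite (lin_sum _ _ _ (lg z)) (lin_sum _ _ _ (lE l)).
  by apply: eq_bigr => j _; rewrite (linZ _ _ (lg z)) (linZ _ _ (lE l)).
- move=> w w0.
  (* Under [incl] the relation becomes one between the [q j], whose coefficients vanish; multiplying
     by [c] recovers [w]. *)
  have h j z : \sum_l d l j *: w (l, z) = 0.
    apply: (ind (fun jz => \sum_l d l jz.1 *: w (l, jz.2)) _ (j, z)).
    rewrite -[RHS](lin0 li) -w0 (lin_sum _ _ _ li) [LHS]sum_pair [RHS]sum_pair /=.
    under [RHS]eq_bigr do under eq_bigr do rewrite iE.
    rewrite [LHS]exchange_big [RHS]exchange_big /=; apply: eq_bigr => z' _.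
    rewrite [RHS]exchange_big /=; apply: eq_bigr => j' _.
    rewrite (lin_sum _ _ _ (lg z')) (lin_sum _ _ _ (lq j')).
    by apply: eq_bigr => l _; rewrite (linZ _ _ (lg z')) (linZ _ _ (lq j')).
  move=> [l' z].
  have : \sum_j c j l' *: (\sum_l d l j *: w (l, z)) = 0.
    by rewrite big1// => j _; rewrite h scaler0.
  under eq_bigr do rewrite scaler_sumr.
  rewrite exchange_big /=.
  under eq_bigr => l _.
    under eq_bigr do rewrite scalerA mulrC.
    rewrite -scaler_suml dc.
    over.
  rewrite (bigD1 l')//= eqxx scale1r big1 ?addr0// => l ll'.
  by rewrite (negbTE ll') scale0r.
Qed.

End Bases.

(** * Transversals and indices *)

Section Transversals.
Local Open Scope group_scope.
Variables (gT : groupType).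

Lemma card_transversal (L K : subgroup gT) (T T' : finType) (y : T -> gT)
    (y' : T' -> gT) :
  (forall l, L (y l)) -> (forall l, L (y' l)) ->
  (forall x, L x -> exists! l, K ((y l)^-1 * x)) ->
  (forall x, L x -> exists! l, K ((y' l)^-1 * x)) -> #|T| = #|T'|.
Proof.
suff le (T1 T2 : finType) (y1 : T1 -> gT) (y2 : T2 -> gT) :
    (forall l, L (y1 l)) -> (forall x, L x -> exists! l, K ((y1 l)^-1 * x)) ->
    (forall x, L x -> exists! l, K ((y2 l)^-1 * x)) -> (#|T1| <= #|T2|)%N.
  move=> Ly Ly' yP y'P; apply/eqP.
  by rewrite eqn_leq (le _ _ y y')// (le _ _ y' y).
move=> Ly1 y1P y2P.
have /choice[f fP] : forall l, exists l', K ((y2 l')^-1 * y1 l).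
  by move=> l; have [l' [? _]] := y2P _ (Ly1 l); exists l'.
apply: (@leq_card _ _ f) => l l' ll'; have [m [_ mU]] := y1P _ (Ly1 l').
transitivity m; last by apply: mU; rewrite mulVg; exact: sg1.
apply: esym; apply: mU; have := sgM (sgV (fP l)) (fP l').
by rewrite -ll' invgM invgK mulgA mulgK.
Qed.

(** [A] indexes the cosets of [H] that meet [N], and [B] the orbits of [N] on G/H. As [N] acts
    through HN/H, which acts freely, every orbit has |A| elements. *)
Lemma transversal_split (H : normalSubgroup gT) (N : subgroup gT) (n : nat) :
  has_index (sgT gT) H n ->
  exists (A B : finType) (nu : A -> gT) (y : B -> gT),
    [/\ forall a, N (nu a),
        forall x, N x -> exists! a, H (x * (nu a)^-1),
        forall x, exists! ab : A * B, H (x * (nu ab.1 * y ab.2)^-1) &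
        (#|A| * #|B|)%N = n].
Proof.
move=> [t [_ tP]].
have HC x z : H (x^-1 * z) -> H (z * x^-1).
  by move=> /(nsgJ x); rewrite mulgA mulgV mul1g.
have HC' x z : H (z * x^-1) -> H (x^-1 * z).
  by move=> /(nsgJV x); rewrite -mulgA mulgVK.
have /choice[c cP] : forall x, exists i, H (x * (t i)^-1).
  by move=> x; have [i [Hi _]] := tP x I; exists i; exact: HC.
have HV x z : H (x * z^-1) -> H (z * x^-1).
  by move=> /sgV; rewrite invgM invgK.
have HT x z w : H (x * z^-1) -> H (z * w^-1) -> H (x * w^-1).
  by move=> Hx Hz; have := sgM Hx Hz; rewrite mulgA mulgVK.
have cE x i : H (x * (t i)^-1) -> c x = i.
  move=> Hi; have [j [_ jU]] := tP x I.
  by rewrite -(jU _ (HC' _ _ Hi)) (jU _ (HC' _ _ (cP x))).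
have cH x z : H (x * z^-1) -> c x = c z.
  by move=> xz; apply: cE; exact: HT xz (cP z).
have Hc x z : c x = c z -> H (x * z^-1).
  by move=> xz; apply: HT (cP x) _; rewrite xz; exact/HV/cP.
have HR x z w : H (x * z^-1) -> H ((x * w) * (z * w)^-1).
  by rewrite invgM mulgA mulgK.
have HL x z w : H (x * z^-1) -> H ((w * x) * (w * z)^-1).
  by move=> /(nsgJ w); rewrite invgM !mulgA.
pose inN i := `[< exists2 x, N x & c x = i >].
pose A : finType := {i | inN i}.
have /choice[nu nuP] : forall a : A, exists x, N x /\ c x = val a.
  by move=> [i /= /asboolP[x]]; exists x.
have inNx x : N x -> inN (c x) by move=> Nx; apply/asboolP; exists x.
pose e i j := `[< exists2 x, N x & c (x * t i) = j >].
have ct i : c (t i) = i by apply: cE; rewrite mulgV; exact: sg1.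
have [|||r [er rE]] := @equiv_representatives 'I_n e.
- by move=> i; apply/asboolP; exists 1; [exact: sg1|rewrite mul1g ct].
- move=> i j /asboolP[x Nx <-]; apply/asboolP; exists x^-1; first exact: sgV.
  apply: cE; apply: HV; rewrite -[X in H (X * _)](mulKg x); apply: HL.
  exact: cP.
- move=> i j k /asboolP[x Nx <-] /asboolP[z Nz <-]; apply/asboolP.
  exists (z * x); first exact: sgM.
  by apply: cH; rewrite -[z * x * t i]mulgA; apply: HL; exact: cP.
pose B : finType := {i | r i == i}.
have rr i : r (r i) == r i by rewrite -(rE _ _ (er i)).
have rs i : e (r i) i.
  have /asboolP[x Nx xi] := er i; apply/asboolP; exists x^-1; first exact: sgV.
  rewrite -xi; apply: cE; apply: HV; rewrite -[X in H (X * _)](mulKg x).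
  by apply: HL; exact: cP.
have nuU x : N x -> exists! a, H (x * (nu a)^-1).
  move=> Nx; exists (exist _ (c x) (inNx x Nx)); split.
    by apply: Hc; rewrite (nuP _).2.
  by move=> a /cH xa; apply: val_inj; rewrite /= xa (nuP a).2.
have prodP x : exists! ab : A * B, H (x * (nu ab.1 * t (val ab.2))^-1).
  have /asboolP[z Nz zx] := rs (c x); have [a [Ha _]] := nuU z Nz.
  exists (a, exist _ (r (c x)) (rr (c x))); split=> [|[a' b'] /= Hx].
    apply: HT (Hc _ _ (esym zx)) _; exact: HR.
  have bb' : b' = exist _ (r (c x)) (rr (c x)).
    apply: val_inj => /=; rewrite -(eqP (valP b')); apply: rE.
    by apply/asboolP; exists (nu a'); [exact: (nuP a').1|exact/cH/HV].
  rewrite bb' /= in Hx *; congr pair.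
  have [a'' [_ aU]] := nuU _ Nz.
  rewrite -(aU _ Ha); apply: aU; rewrite -[z](mulgK (t (r (c x)))) -mulgA -invgM.
  exact: HT (Hc _ _ zx) Hx.
exists A, B, nu, (fun b => t (val b)); split=> //.
- by move=> a; exact: (nuP a).1.
- rewrite -card_prod -[RHS]card_ord.
  apply: (@card_transversal (sgT gT) H _ _
    (fun ab => nu ab.1 * t (val ab.2)) t) => //.
  move=> x _; have [ab [Hab abU]] := prodP x.
  by exists ab; split=> [|ab' /HC /abU//]; exact: HC'.
Qed.

End Transversals.

(** * Dimensions of the irreducible constituents *)

Section BlockDimensions.
Local Open Scope ring_scope.
Variable R : realType.
Local Notation C := R[i].
Variables (gT : groupType) (K : subgroup gT) (M : rep R K).
Variables (gQ : groupType) (Q S : subgroup gQ) (theta : gQ -> C).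
Variable iota : gQ -> M -> M.
Variables (J : finType) (u : J -> gQ).
Hypothesis cm : commutant Q S theta iota u.
Variables (I : finType) (rt : I -> I) (E : I -> I -> M -> M).
Hypothesis mu : matrix_units rt E.

Let E_hom i j : lhom (E i j). Proof. exact: mu_hom mu i j. Qed.

Lemma has_dim_Yrep i : has_dim (Yrep cm mu i) 'I_#|{: blk rt i}|.
Proof.
exists (fun a => dlt R (enum_val a)); apply/is_basisP; split=> [w|s c us c0 a sa].
  exists (enum 'I_#|{: blk rt i}|), (fun a => w (enum_val a)); split.
  - exact: enum_uniq.
  - by move=> a; rewrite mem_enum.
  - rewrite big_enum /= [LHS]dlt_sum.
    by rewrite (reindex _ (onW_bij _ (@enum_val_bij (blk rt i)))).
have /ffunP/(_ (enum_val a)) := c0; rewrite sum_ffunE ffunE => <-.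
rewrite (bigD1_seq a)//= big1 => [|b ba].
  by rewrite !ffunE eqxx addr0 [_ *: _]mulr1.
by rewrite !ffunE (inj_eq enum_val_inj) eq_sym (negbTE ba) [_ *: _]mulr0.
Qed.

(** On a line the basis columns at [a] and [b] are proportional. *)
Lemma blk_singleton i (a b : blk rt i) :
  has_dim (Yrep cm mu i) 'I_1 -> a = b.
Proof.
move=> [e /is_basisP[sp _]].
have line (v : Yrep cm mu i) : exists x : C, v = x *: e ord0.
  have [s [c [us cs ->]]] := sp v; exists (\sum_(k <- s) c k).
  by rewrite scaler_suml; apply: eq_bigr => k _; rewrite (ord1 k).
have [x xE] := line (dlt R a); have [y yE] := line (dlt R b).
apply/eqP; apply: contraT => ab.
have xa : x * (e ord0 a : C) = 1.
  by move/ffunP/(_ a): xE; rewrite !ffunE eqxx => h; exact: esym h.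
have ya : y * (e ord0 a : C) = 0.
  by move/ffunP/(_ a): yE; rewrite !ffunE (negbTE ab) => h; exact: esym h.
have y0 : y = 0.
  apply/eqP; move/eqP: ya; rewrite mulf_eq0 => /orP[//|/eqP ea].
  by move/eqP: xa; rewrite ea mulr0 eq_sym oner_eq0.
move/ffunP/(_ b): yE; rewrite y0 scale0r !ffunE eqxx => /eqP.
by rewrite oner_eq0.
Qed.

Lemma E_span i T v : lhom T ->
  E i i (T v) = \sum_(b : blk rt i) entry mu T i (val b) *: E i (val b) v.
Proof.
move=> hT; rewrite [v in LHS](mu_sum mu) (lin_sum _ _ _ hT.1).
rewrite (lin_sum _ _ _ (E_hom i i).1) (sum_blk (rt := rt) (i := i)) => [|c ci].
  apply: eq_bigr => b _; have ib : rt i = rt (val b) by rewrite blkP.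
  pose s : blk rt (val b) := exist _ i (introT eqP ib).
  rewrite (entryP mu (self rt (val b)) _ hT) (lin_sum _ _ _ (E_hom i i).1).
  rewrite (bigD1 s)//= big1 => [|d ds]; rewrite (linZ _ _ (E_hom i i).1).
    by rewrite (mu_mul mu)// eqxx addr0.
  rewrite (mu_mul mu)// ifF ?scaler0//; apply/negbTE.
  by apply: contra ds => /eqP ds; apply/eqP/val_inj.
rewrite (entryP mu (self rt c) _ hT) (lin_sum _ _ _ (E_hom i i).1) big1// => d _.
by rewrite (linZ _ _ (E_hom i i).1) (mu_off2 mu) ?scaler0// blkP.
Qed.

(** Row [i] of the matrix units is a basis of E_ii End(M), and the [iota (u j)] one of End(M). The
    matrices [entry] and [coefs] pass between the two, so freeness of [M] over the second yields
    freeness of E_ii M over the first. *)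
Lemma Xrep_freely_spanned (W : lmodType C) (Z : finType) (g : Z -> W -> M) i :
  (forall z, linear (g z)) ->
  freely_spanned (fun (jz : J * Z) w => iota (u jz.1) (g jz.2 w)) ->
  freely_spanned (V := Xrep mu i) (fun (bz : blk rt i * Z) w =>
    imp (mu_idem mu i) (E i (val bz.1) (g bz.2 w))).
Proof.
move=> lg fr; have hu j := cm_hom cm (cm_rep cm j).
have ip := (Xrep_imp mu i).1; have iv := (Xrep_imv mu i).1.
apply: (@freely_spanned_change R M (Xrep mu i) W J (blk rt i) Z
  (imp (mu_idem mu i)) (fun v => imv v) (fun j => iota (u j))
  (fun b v => imp (mu_idem mu i) (E i (val b) v)) g
  (fun j b => entry mu (iota (u j)) i (val b))
  (fun b j => coefs cm (E i (val b)) j)) => //.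
- by move=> v; exact: imvK.
- by move=> j; case: (hu j).
- by move=> b; exact: linear_comp (E_hom _ _).1 ip.
- move=> j v; apply: val_inj => /=; rewrite E_span// (lin_sum _ _ _ iv).
  by apply: eq_bigr => b _; rewrite (linZ _ _ iv) /= (mu_mul mu)// eqxx.
- by move=> b v; rewrite /= (mu_mul mu)// eqxx; exact: coefsP.
(* The two expressions of E_ib are compared on [v], which every matrix unit of row [i] in the block
   kills except the one at b'. *)
- move=> b b'; pose v := E (val b') i (vec mu i).
  have vE (b1 : blk rt i) : E i (val b1) v = (b1 == b')%:R *: vec mu i.
    rewrite (mu_mul mu) ?blkP// (inj_eq val_inj).
    by case: eqP => _; rewrite ?scale1r ?scale0r ?E_vec.
  have uE j : E i i (iota (u j) v) = entry mu (iota (u j)) i (val b') *: vec mu i.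
    rewrite E_span// (bigD1 b')//= big1 => [|d /negbTE db].
      by rewrite vE eqxx scale1r addr0.
    by rewrite vE db scale0r scaler0.
  have : E i i (E i (val b) v) = E i (val b) v by rewrite (mu_mul mu)// eqxx.
  rewrite [E i (val b) v in LHS](coefsP cm v (E_hom i (val b))).
  rewrite (lin_sum _ _ _ (E_hom i i).1).
  under eq_bigr do rewrite (linZ _ _ (E_hom i i).1) uE scalerA.
  rewrite vE -scaler_suml => /eqP.
  rewrite -subr_eq0 -scalerBl scaler_eq0 (negbTE (vec_neq0 mu i)) orbF.
  by rewrite subr_eq0 => /eqP.
Qed.

End BlockDimensions.

(** * Freeness of sigma and of the induced representation *)

Section InducedDimensions.
Local Open Scope ring_scope.
Variable R : realType.
Local Notation C := R[i].
Variables (G : groupType) (H : normalSubgroup G) (N S : subgroup G).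
Variables (theta : G -> C) (sigma : rep R (sdprod H N)).
Variables (k : nat) (t : 'I_k -> G).
Hypothesis tP : coset_reps (sgI N H) S t.

Local Notation Is := (Irep sigma).
Local Notation M := (resG Is).
Local Notation sH := (resH sigma).
Local Notation opN n := (rop sigma (1%g \rtimes n)).
Local Notation tw := (@twist R G H N sigma).

Hypothesis cs : commutant (M := sH) (sgI N H) S theta tw t.
Hypothesis sigma_cr : completely_reducible sH.
Hypothesis NH_dim1 : forall chi : rep R (sgI N H),
  Irr S theta chi -> has_dim chi 'I_1.
Variable D : choiceType.
Hypothesis sigma_dim :
  forall tau : rep R H, constituent sH tau -> has_dim tau D.

(* The twisted group algebra of sgI N H is a product of lines, so sigma is a
   sum of irreducibles indexed by its idempotents, all of them copies of one
   vector space W; embedding W diagonally makes sigma free over the algebra. *)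
Lemma twist_freely_spanned : exists (W : lmodType C) (F : W -> sH),
  [/\ linear F, has_dim W D &
      freely_spanned (fun (x : 'I_k * unit) w => tw (t x.1) (F w))].
Proof.
have [I [rt [E mu]]] := commutant_matrix_units cs sigma_cr.
have E_hom i j : lhom (E i j) := mu_hom mu i j.
have blk1 i (a : blk rt i) : a = self rt i.
  exact: blk_singleton (NH_dim1 (Yrep_Irr cs mu i)).
have E_diag i j v : E i i (E j j v) = if i == j then E i i v else 0.
  by rewrite (mu_mul mu)//; case: eqP => // ->.
(* Without idempotents [sigma] would be 0, and the relation with all coefficients 1, nonempty since
   N_H/S contains the class of 1, would contradict freeness. *)
have [i0 _] : exists i : I, true.
  have [j0 _] := tP.2 1%g (sg1 _).
  apply: contrapT => nex; have no (i : I) : False by apply: nex; exists i.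
  have z : (1 : C) = 0; last by have /eqP := z; rewrite oner_eq0.
  apply: (cm_free cs (c := fun=> 1) _ j0) => v.
  by rewrite big1// => j _; rewrite scale1r [LHS](mu_sum mu) big1.
have Xdim i : has_dim (Xrep mu i) D by apply: sigma_dim; exact: Xrep_constituent.
pose L i := projT1 (cid (has_dim_iso (Xdim i0) (Xdim i))).
have LP i := projT2 (cid (has_dim_iso (Xdim i0) (Xdim i))).
have lL i : linear (L i) by case: (LP i) => h _ _; exact: h.
have L0 i w : L i w = 0 -> w = 0 by case: (LP i) => _ h _; exact: h.
have Lsurj i v : exists w, L i w = v by case: (LP i) => _ _ h; exact: h.
pose F (w : Xrep mu i0) : sH := \sum_i imv (L i w).
have lF : linear F.
  by apply: linear_bigsum => i; exact: linear_comp (lL i) (Xrep_imv mu i).1.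
have EF i w : E i i (F w) = imv (L i w).
  rewrite (lin_sum _ _ _ (E_hom i i).1) (bigD1 i)//= big1 => [|j ji].
    by rewrite imvP addr0.
  by rewrite -[imv (L j w)]imvP E_diag eq_sym (negbTE ji).
exists (Xrep mu i0), F; split=> //.
have twist_h j := cm_hom cs (cm_rep cs j).
have twistE j v :
    tw (t j) v = \sum_i entry mu (tw (t j)) i i *: E i i v.
  rewrite [LHS](mu_sum mu); apply: eq_bigr => i _.
  rewrite (E_span mu i _ (twist_h j)) (bigD1 (self rt i))//= big1 ?addr0// => b.
  by rewrite (blk1 _ b) eqxx.
apply: (@freely_spanned_change R sH sH (Xrep mu i0) I 'I_k unit idfun idfun
  (fun i => E i i) (fun j => tw (t j)) (fun _ => F)
  (fun i j => coefs cs (E i i) j)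
  (fun j i => entry mu (tw (t j)) i i)) => //.
- by move=> i; case: (E_hom i i).
- by move=> j; case: (twist_h j).
- by move=> i v; exact: (coefsP cs v (E_hom i i)).
(* Putting the idempotents back into the expression of [tw (t l)] returns [tw (t l)]; freeness then
   compares coefficients. *)
- move=> l l'; apply/eqP; rewrite -subr_eq0; apply/eqP.
  apply: (cm_free cs (c := fun l' =>
    \sum_i entry mu (tw (t l)) i i * coefs cs (E i i) l' -
    (l == l')%:R)) => v.
  under eq_bigr do rewrite scalerBl scaler_suml.
  rewrite sumrB exchange_big /= [X in _ - X](bigD1 l)//= eqxx scale1r.
  rewrite [X in _ - (_ + X)]big1 => [|j /negbTE jl].
    rewrite addr0 [in X in _ - X]twistE; apply/eqP; rewrite subr_eq0; apply/eqP.
    apply: eq_bigr => i _; rewrite (coefsP cs v (E_hom i i)) scaler_sumr.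
    by apply: eq_bigr => j _; rewrite scalerA.
  by rewrite eq_sym jl scale0r.
- have sum_unit (h : I * unit -> sH) : \sum_x h x = \sum_i h (i, tt).
    rewrite sum_pair; apply: eq_bigr => i _.
    by rewrite (bigD1 tt)//= big1 ?addr0// => -[].
  split.
  + by move=> [i ?]; exact: linear_comp lF (E_hom i i).1.
  + move=> v; have /choice[w wP] : forall i, exists w, L i w = imp (mu_idem mu i) v.
      by move=> i; exact: Lsurj.
    exists (fun x => w x.1); rewrite sum_unit [LHS](mu_sum mu).
    by apply: eq_bigr => i _; rewrite /= EF wP.
  + move=> w; rewrite sum_unit => w0 [i []]; apply: (L0 i); apply: val_inj => /=.
    have := congr1 (E i i) w0; rewrite (lin0 (E_hom i i).1) => <-.
    rewrite (lin_sum _ _ _ (E_hom i i).1) (bigD1 i)//= big1 => [|j ji].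
      by rewrite E_diag eqxx EF addr0.
    by rewrite E_diag eq_sym (negbTE ji).
Qed.

Variables (A B : finType) (nu : A -> G) (y : B -> G).
Hypothesis nuN : forall a, N (nu a).
Hypothesis nuyP : forall x, exists! ab : A * B, H (x * (nu ab.1 * y ab.2)^-1)%g.

(** A function amounts to its values at the representatives [nu a * y b]. Moving a delta function at
    [y b] by [nu a] reaches that point, where freeness of [sigma] under the [tw (t i)] parametrises
    the value. *)
Lemma induced_freely_spanned (W : lmodType C) (F : W -> sH) :
  linear F ->
  freely_spanned (fun (x : 'I_k * unit) w => tw (t x.1) (F w)) ->
  freely_spanned (V := M) (fun (x : (A * 'I_k) * B) w =>
    rop Is (1%g, nu x.1.1 * t x.1.2)%g (del (y x.2) (F w : sigma))).
Proof.
move=> lF [_ sp ind].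
have sum_unit (h : 'I_k * unit -> sH) : \sum_x h x = \sum_i h (i, tt).
  rewrite sum_pair; apply: eq_bigr => i _.
  by rewrite (bigD1 tt)//= big1 ?addr0// => -[].
have opNK a v : opN (nu a) (opN (nu a)^-1%g v) = v.
  by rewrite -opNM ?mulgV ?opN1//; exact: sgV.
have opN_eq0 a v : opN (nu a) v = 0 -> v = 0.
  move=> v0; have <- : opN (nu a)^-1%g (opN (nu a) v) = v.
    by rewrite -opNM ?mulVg ?opN1//; exact: sgV.
  by rewrite v0 linear0.
have termE a i b w :
    rop Is (1%g, nu a * t i)%g (del (y b) (F w : sigma)) =
    del (nu a * y b)%g (opN (nu a) (tw (t i) (F w))).
  exact: (iota_del tP nuN a i (y b)).
have sumE (w : (A * 'I_k) * B -> W) :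
    (\sum_x rop Is (1%g, nu x.1.1 * t x.1.2)%g (del (y x.2) (F (w x) : sigma)) : M)
    = \sum_(ab : A * B) del (nu ab.1 * y ab.2)%g (opN (nu ab.1)
        (\sum_i tw (t i) (F (w ((ab.1, i), ab.2))) : sigma)) :> M.
  rewrite [LHS]sum_pair [LHS]sum_pair [RHS]sum_pair /=; apply: eq_bigr => a _.
  rewrite exchange_big /=; apply: eq_bigr => b _.
  rewrite linear_sum (lin_sum _ _ _ (del_linear _)).
  by apply: eq_bigr => i _; rewrite termE.
split.
- move=> [[a i] b]; apply: (linear_comp _ (linear_linear _)).
  exact: linear_comp lF (@del_linear _ _ _ _ sigma _).
- move=> f.
  pose v (ab : A * B) : sH := opN (nu ab.1)^-1%g (ev f (nu ab.1 * y ab.2)%g).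
  have [w wP] := choice (fun ab => sp (v ab)).
  exists (fun x => w (x.1.1, x.2) (x.1.2, tt)).
  rewrite sumE [LHS](sum_del nuyP f); apply: eq_bigr => -[a b] _ /=.
  congr del; have := wP (a, b); rewrite sum_unit /= => <-.
  by rewrite opNK.
- move=> w; rewrite sumE => w0 [[a i] b].
  apply: (ind (fun x => w ((a, x.1), b)) _ (i, tt)).
  rewrite sum_unit /=; apply: (opN_eq0 a).
  have := congr1 (fun f => ev f (nu a * y b)%g) w0.
  rewrite -[X in _ = X -> _]/(0 : sigma) => e; rewrite -[RHS]e.
  rewrite (lin_sum _ _ _ (ev_linear _)) (bigD1 (a, b))//= ev_del.
  rewrite [X in _ = _ + X]big1 ?addr0//.
  move=> ab' nab; apply: ev_del_off => Hab.
  have [ab [_ abU]] := nuyP (nu a * y b)%g.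
  move/eqP: nab; apply; rewrite -(abU ab' Hab).
  by apply: abU; rewrite mulgV; exact: sg1.
Qed.

End InducedDimensions.

(** The products of representatives [nu a] of N modulo N_H and [t i] of N_H modulo [S] form a
    transversal of [S] in [N]. *)
Lemma card_split_transversal (G : groupType) (H : normalSubgroup G)
    (N S : subgroup G) (A : finType) (nu : A -> G) (k n : nat) (t : 'I_k -> G) :
  (forall s, S s -> sgI N H s) -> (forall a, N (nu a)) ->
  (forall x, N x -> exists! a, H (x * (nu a)^-1)) ->
  coset_reps (sgI N H) S t -> has_index N S n -> (#|A| * k)%N = n.
Proof.
move=> S_sub nuN nuP [tN tP] [u [uN uP]].
rewrite -[k in LHS]card_ord -card_prod -[RHS]card_ord.
apply: (@card_transversal _ N S _ _ (fun ai => nu ai.1 * t ai.2) u) => //.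
  by move=> [a i]; apply: sgM => //; case: (tN i).
move=> x Nx; have [a [Ha aU]] := nuP x Nx.
have [|i [Si iU]] := tP ((nu a)^-1 * x).
  split; first by apply: sgM => //; exact: sgV.
  by have := nsgJV (nu a) Ha; rewrite -mulgA mulgVK.
exists (a, i); split=> [|[b j] /= Sbj]; first by rewrite /= invgM -mulgA.
have ab : a = b.
  apply: aU; have [_ Hbj] := S_sub _ Sbj; have [_ Hj] := tN j.
  have := nsgJ (nu b) (sgM Hj Hbj).
  by rewrite invgM !mulgA mulgK mulgV mul1g.
by rewrite -ab in Sbj *; congr pair; apply: iU; rewrite mulgA -invgM.
Qed.

Lemma card_bij (T T' : finType) : #|T| = #|T'| ->
  exists f : T -> T', bijective f.
Proof.
move=> e; exists (fun x => enum_val (cast_ord e (enum_rank x))).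
exists (fun x => enum_val (cast_ord (esym e) (enum_rank x))) => x.
  by rewrite enum_valK cast_ordK enum_rankK.
by rewrite enum_valK cast_ordKV enum_rankK.
Qed.

Theorem lemma8p2 (R : realType) (G : topGroupType)
  (H : normalSubgroup G) (N S : subgroup G) (iGH iNS : nat)
  (theta : G -> R[i]) (sigma : rep R (sdprod H N))
  (G_lp : locally_profinite G)
  (H_open : open (sgset H))
  (H_index : has_index (sgT G) H iGH)
  (GH_abelian : forall x y : G, H (x * y * x^-1 * y^-1))
  (N_closed : closed (sgset N))
  (S_sub : forall s, S s -> sgI N H s)
  (S_abelian : forall s t, S s -> S t -> s * t = t * s)
  (S_open : exists2 U : set G, open U & sgset S = U `&` sgset N)
  (S_normal : forall n s, N n -> S s -> S (n * s * n^-1))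
  (S_index : has_index N S iNS)
  (theta_char : smooth_character S theta)
  (theta_norm : forall n s, N n -> S s -> theta (n * s * n^-1) = theta s)
  (NH_dim1 : forall chi : rep R (sgI N H), Irr S theta chi -> has_dim chi 'I_1)
  (sigma_smooth : smooth sigma)
  (sigma_fl : finite_length sigma)
  (sigma_ss : semisimple sigma)
  (sigma_theta : forall s v, S s ->
     rop sigma (s^-1 \rtimes s) v = (theta s *: v)%R)
  (sigma_End : exists (k : nat) (t : 'I_k -> G),
     coset_reps (sgI N H) S t /\
     forall T : {linear sigma -> sigma},
       @is_hom R G H (resH sigma) (resH sigma) T ->
       exists! c : {ffun 'I_k -> R[i]}, forall v,
         T v = (\sum_(i < k) c i *: 
              rop sigma ((t i)^-1 \rtimes t i)%g v)%R)
  (sigma_conj : forall g,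
     ((exists h n, [/\ H h, N n & g = h * n]) ->
        isomorphic (conj_rep g (resH sigma)) (resH sigma)) /\
     (~ (exists h n, [/\ H h, N n & g = h * n]) ->
        forall tau : rep R H, constituent (conj_rep g (resH sigma)) tau ->
          ~ constituent (resH sigma) tau))
  (sigma_dim : exists D : choiceType,
     forall tau : rep R H, constituent (resH sigma) tau -> has_dim tau D) :
  let I_sigma := Irep sigma in
  semisimple I_sigma /\
  (exists (A B : choiceType) (X : A -> rep R (sgT G)) (Y : B -> rep R N)
     (m : A -> B -> nat),
     [/\ lists_classes (constituent (resG I_sigma)) X,
         lists_classes (Irr S theta) Y &
         decomposes I_sigma X Y m]) /\
  forall (A B : choiceType) (pi : A -> rep R (sgT G)) (rho : B -> rep R N)
     (m : A -> B -> nat),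
    lists_classes (constituent (resG I_sigma)) pi ->
    lists_classes (Irr S theta) rho ->
    decomposes I_sigma pi rho m ->
    [/\ (forall a b, m a b = 0%N \/ m a b = 1%N),
        (forall b, exists! a, m a b = 1%N),
        (forall a, exists! b, m a b = 1%N) &
        forall a b, m a b = 1%N ->
          exists (Dpi Dsigma : choiceType) (drho : nat),
            [/\ (0 < drho)%N,
                has_dim (pi a) Dpi, has_dim (rho b) 'I_drho,
                has_dim sigma Dsigma &
                exists f : Dpi * 'I_iNS -> 'I_iGH * Dsigma * 'I_drho,
                  bijective f]].
Proof.
have SN s : S s -> N s by case/S_sub.
have SH s : S s -> H s by case/S_sub.
have [k [t [tP sEnd]]] := sigma_End; have [D sigmaD] := sigma_dim.
have [u [uN uP]] := S_index.
have uS x : N x -> exists j, S ((u j)^-1 * x).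
  by move=> /uP[j [Sj _]]; exists j.
have [A0 [B0 [nu [y [nuN nuP nuyP cardAB]]]]] := transversal_split N H_index.
have sconj g := (sigma_conj g).2.
have sigma_cr := clifford SN SH S_normal sigma_theta uN uS sigma_ss.
have cs := sigma_commutant S_sub sigma_theta tP sEnd.
have cI := induced_commutant S_sub sigma_theta tP sEnd sconj sigma_cr nuN nuP nuyP.
have crI := induced_completely_reducible nuyP sigma_cr.
have [I [rt [E mu]]] := commutant_matrix_units cI crI.
have lX := lists_Xrep mu crI; have lY := lists_Yrep cI mu.
move=> Is; split; first exact: (semisimple_blocks cI mu).
split.
  exists (classrep rt), (classrep rt), (fun i => Xrep mu (val i)),
    (fun i => Yrep cI mu (val i)), (fun i j => nat_of_bool (i == j)).
  by split; [exact: lX|exact: lY|exact: (decomposes_blocks cI mu)].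
move=> A B pi rho m piP rhoP [T [TP [j jP]]].
have [m01 mb ma mi] := correspondence cI mu crI piP rhoP TP jP.
split=> // a b /mi[i [piX rhoY]].
have [W [F [lF WD Ffree]]] := twist_freely_spanned tP cs sigma_cr NH_dim1 sigmaD.
have Ifree := induced_freely_spanned tP nuN nuyP lF Ffree.
have lg b0 : linear (fun w => del (y b0) (F w : sigma)) :=
  linear_comp lF (@del_linear _ _ _ _ sigma _).
have Xfree := Xrep_freely_spanned cI mu i lg Ifree.
exists ((blk rt i * B0) * D)%type, (('I_k * unit) * D)%type, #|{: blk rt i}|.
split.
- by apply/card_gt0P; exists (self rt i).
- exact: isomorphic_has_dim piX (freely_spanned_has_dim WD Xfree).
- exact: isomorphic_has_dim rhoY (has_dim_Yrep cI mu i).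
- exact: (freely_spanned_has_dim WD Ffree).
(* The factor [D], possibly infinite, is carried along unchanged; the finite factors agree because
   |G/H| = |A0| |B0| and |N/S| = |A0| k. *)
have [f [g fK gK]] : exists f : (blk rt i * B0) * 'I_iNS ->
    ('I_iGH * ('I_k * unit)) * 'I_#|{: blk rt i}|, bijective f.
  apply: card_bij; rewrite !card_prod !card_ord card_unit -cardAB.
  rewrite -(card_split_transversal S_sub nuN nuP tP S_index).
  by rewrite muln1 -mulnA mulnC; congr (_ * _)%N; rewrite mulnCA mulnA.
exists (fun x => let z := f (x.1.1, x.2) in ((z.1.1, (z.1.2, x.1.2)), z.2)).
exists (fun z => let x := g ((z.1.1, z.1.2.1), z.2) in ((x.1, z.1.2.2), x.2)).
- by move=> [[x d] l] /=; case: (f (x, l)) (fK (x, l)) => [[p q] r] /= ->.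
- by move=> [[p [q d]] r] /=; case: (g (p, q, r)) (gK (p, q, r)) => x l /= ->.
Qed.
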